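(* For any $\varphi \in C^1[0,1]$, the map $\alpha \mapsto \int_{[0,1]} \varphi \, d\nu_\alpha$ is continuously differentiable on $(0,1)$.
   Context: For $\alpha \in (0,1)$ let $T_\alpha \colon [0,1] \to [0,1]$ be the map $T_\alpha(x) = x(1+2^\alpha x^\alpha)$ for $x \in [0,1/2]$ and $T_\alpha(x) = 2x-1$ for $x \in (1/2,1]$. It is known that each $T_\alpha$ admits a unique absolutely continuous (with respect to Lebesgue measure) invariant probability measure, which is denoted $\nu_\alpha$. *)

(* Defs.v *)
From HB Require Import structures.
From mathcomp Require Import all_boot all_order all_algebra.
From mathcomp Require Import all_classical all_reals all_analysis.
Set Implicit Arguments.
Unset Strict Implicit.
Unset Printing Implicit Defensive.
Import Order.TTheory GRing.Theory Num.Theory.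
Import numFieldNormedType.Exports.
Local Open Scope classical_set_scope.
Local Open Scope ring_scope.

(* A total function on R; only its values on [0, 1] matter.  At x = 0 the
   library convention 0 `^ alpha = 0 (alpha != 0) is the intended one. *)
Definition T_map (R : realType) (alpha x : R) : R :=
  if x <= 2^-1 then x * (1 + 2 `^ alpha * x `^ alpha) else 2 * x - 1.

(* Borel probability measures on [0, 1] are represented by Borel probability
   measures on R that give full mass to [0, 1]; for these, absolute continuity
   with respect to Lebesgue measure on R and on [0, 1] coincide. *)
Definition is_acip (R : realType) (alpha : R)
    (mu : probability (measurableTypeR R) R) : Prop :=
  [/\ mu `[0, 1]%classic = 1%E,
      mu `<< (@lebesgue_measure R) &
      forall A : set (measurableTypeR R), measurable A -> A `<=` `[0, 1]%classic ->
        mu (`[0, 1]%classic `&` T_map alpha @^-1` A) = mu A].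

(* The difference quotients are taken inside [0, 1], so that the derivative is
   one-sided at 0 and 1; the values of phi outside [0, 1] are irrelevant. *)
Definition C1_unit_interval (R : realType) (phi : R -> R) : Prop :=
  exists dphi : R -> R,
    {within `[0, 1], continuous dphi} /\
    forall x : R, x \in `[0, 1] ->
      (fun y => (phi y - phi x) / (y - x)) @ within `[0, 1] x^' --> dphi x.

Definition C1_open (R : realType) (U : set R) (f : R -> R) : Prop :=
  (forall a : R, a \in U -> derivable f a 1) /\ {in U, continuous (derive1 f)}.

(* Main.v *)
Require Import Defs.
From HB Require Import structures.
From mathcomp Require Import all_boot all_order all_algebra.
From mathcomp Require Import all_classical all_reals all_analysis.
From mathcomp Require Import measurable_realfun.
From mathcomp Require Import ring lra.
Set Implicit Arguments.
Unset Strict Implicit.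
Unset Printing Implicit Defensive.
Import Order.TTheory GRing.Theory Num.Theory.
Import numFieldNormedType.Exports.
Local Open Scope classical_set_scope.
Local Open Scope ring_scope.

(** The map T_alpha has a neutral fixed point at 0, so its transfer operator
    has no spectral gap; the proof passes to the first return map to ]1/2, 1],
    which is uniformly expanding with countably many branches, and carries the
    result back.

    In the coordinate y, with x = (1 + y) / 2, the inverse branches b_n
    (n >= 0) of the return map apply the inverse of the left branch of T_alpha
    n times to x.  They decrease to 0 like n^(-1/alpha), hence are dominated,
    uniformly for alpha in a compact interval [a0, a1] of ]0, 1[, by a summable
    sequence M; and so are their y-derivatives and the alpha-derivatives of all
    of these.  The estimates are done in the logarithmic coordinate
    x = exp(-z) / 2, where the left branch is z |-> z - ln (1 + exp(-alpha z))
    and its iterated inverse Gam alpha n z is monotone in alpha, which bounds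
    the parameter derivative by Gam / alpha without any further dynamics.

    Let Q be the operator K |-> sum_n (K o b_n - K(b_n 0)) on distribution
    functions, i.e. the transfer operator of the return map acting on measures
    through their distribution functions.  It maps the cone of densities k with
    |k'| <= 8 k into the smaller cone |k'| <= 6 k, so that a fixed proportion
    of the mass can be split off at each step: the iterates of Q converge
    exponentially fast on functions of mass zero, with the density and its
    derivative (contraction).  This yields an invariant distribution function U
    of total mass 1 (invU), uniformly regular in alpha, and
        U_s - U_t = sum_j Q_t^j ((Q_s - Q_t) U_s),
    where the increments of Q cost one derivative of the density of U_s.
    Dividing by s - t and letting s, t -> alpha gives, by dominated convergence
    for series (tannery), a limit that depends on alpha only (U_response).

    The invariant measure nu_alpha enters through its distribution function F.
    Invariance on [0, y] gives F(x) = sum_n K(b_n) along the preimages of x,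
    where K is the distribution function of nu_alpha on ]1/2, 1], and this K is
    a fixed point of Q.  Absolute continuity makes K a limit, in total
    variation, of smooth functions; as Q does not increase total variation,
    contraction forces K to be a multiple of U (fixed_unique).  Hence
    F = Hcdf / Hcdf 1, where Hcdf x alpha is an explicit uniformly convergent
    series in U_alpha and Gam (cdf0_quot), and F has the same differentiability
    in alpha.

    Finally, by Fubini, the integral of phi against nu_alpha equals
    phi 1 - \int_0^1 phi' F, and dominated convergence differentiates this
    under the integral.  Difference quotients are taken throughout between two
    sequences be and ga, both converging to alpha: convergence of such
    quotients to a common limit is strict differentiability, which gives the
    continuity of the derivative as well. *)

(** * Dominated series *)

Section Series.
Context {R : realType}.
Implicit Types (f g M : nat -> R) (C : R).

Definition tsum f : R := limn (series f).

Definition summable_ge0 M := (forall n, 0 <= M n) /\ cvgn (series M).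

Lemma cvg_dom M C f : summable_ge0 M -> (forall n, `|f n| <= C * M n) ->
  cvgn (series f).
Proof.
move=> [M0 cM] fM; apply: normed_cvg.
have CM0 n : 0 <= C * M n by exact: le_trans (fM n).
apply: (@series_le_cvg _ _ (fun n => C * M n)) => //=.
by have := @is_cvg_seriesZ R M C cM; exact.
Qed.

Lemma ltr_tail M C f N : summable_ge0 M -> (forall n, `|f n| <= C * M n) ->
  `|tsum f - series f N| <= C * (tsum M - series M N).
Proof.
move=> sM fM; have cf := cvg_dom sM fM; case: sM => M0 cM.
have h1 : (fun K => `|series f K - series f N|) @ \oo -->
    `|tsum f - series f N|.
  by apply: cvg_norm; apply: cvgB => //; exact: cvg_cst.
have h2 : (fun K => C * (series M K - series M N)) @ \oo -->
    C * (tsum M - series M N).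
  by apply: cvgMr; apply: cvgB => //; exact: cvg_cst.
apply: (ler_cvg_to h1 h2).
near=> K.
have NK : (N <= K)%N by near: K; exact: nbhs_infty_ge.
rewrite !sub_series_geq// mulr_sumr.
by apply: le_trans (ler_norm_sum _ _ _) _; apply: ler_sum.
Unshelve. all: by end_near. Qed.

Lemma tsum_norm M C f : summable_ge0 M -> (forall n, `|f n| <= C * M n) ->
  `|tsum f| <= C * tsum M.
Proof.
move=> sM fM; have := ltr_tail 0 sM fM.
by rewrite /series /= !big_geq// !subr0.
Qed.

Lemma tsum_ge0 f : cvgn (series f) -> (forall n, 0 <= f n) -> 0 <= tsum f.
Proof.
move=> cf f0; apply: (limr_ge cf); near=> n; exact: sumr_ge0.
Unshelve. all: by end_near. Qed.

Lemma tsumD f g : cvgn (series f) -> cvgn (series g) ->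
  tsum (fun n => f n + g n) = tsum f + tsum g.
Proof. exact: lim_seriesD. Qed.

Lemma tsumB f g : cvgn (series f) -> cvgn (series g) ->
  tsum (fun n => f n - g n) = tsum f - tsum g.
Proof. exact: lim_seriesB. Qed.

Lemma tsumZ f C : cvgn (series f) -> tsum (fun n => C * f n) = C * tsum f.
Proof. exact: lim_seriesZ. Qed.

Lemma tsum_telescope (a : nat -> R) l : a n @[n --> \oo] --> l ->
  series (fun n => a n - a n.+1) @ \oo --> a 0%N - l.
Proof.
move=> al; rewrite (_ : series _ = (fun n => a 0%N - a n)).
  by apply: cvgB => //; exact: cvg_cst.
apply/funext => n; rewrite seriesEnat/=.
elim: n => [|n ih]; first by rewrite big_geq// subrr.
by rewrite big_nat_recr//= ih addrA subrK.
Qed.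

(** Dominated convergence for series: the tail beyond a common index is
    small uniformly along the filter, and the head is a finite sum. *)
Lemma tannery {T : topologicalType} (F : set_system T) {FF : ProperFilter F}
    (f : T -> nat -> R) g M C : summable_ge0 M ->
  (\forall t \near F, forall n, `|f t n| <= C * M n) ->
  (forall n, f t n @[t --> F] --> g n) ->
  (forall n, `|g n| <= C * M n) /\ tsum (f t) @[t --> F] --> tsum g.
Proof.
move=> sM fM fg.
have gM n : `|g n| <= C * M n.
  have h : `|f t n| @[t --> F] --> `|g n| by apply: cvg_norm.
  have h' : (fun=> C * M n) @ F --> C * M n by exact: cvg_cst.
  apply: (ler_cvg_to h h'); near=> t; move: (n); near: t; exact: fM.
split => //; apply/cvgrPdist_lt => e e0.
have h : (fun N => C * (tsum M - series M N)) @ \oo --> 0.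
  rewrite -(mulr0 C) -(subrr (tsum M)).
  by apply: cvgMr; apply: cvgB; [exact: cvg_cst|case: sM].
have e30 : 0 < e / 3 by rewrite divr_gt0.
have /cvgrPdist_lt/(_ _ e30)[N _ HN] := h.
have {}HN := HN N (leqnn N).
have hs : series (f t) N @[t --> F] --> series g N.
  apply: cvg_big => [|i _]; [exact: add_continuous|exact: fg].
near=> t.
have h1 : `|series g N - series (f t) N| < e / 3.
  by near: t; move/cvgrPdist_lt : hs => /(_ _ e30).
have h2 := ltr_tail N sM gM.
have h3 : `|tsum (f t) - series (f t) N| <= C * (tsum M - series M N).
  apply: ltr_tail => //; near: t; exact: fM.
rewrite sub0r normrN in HN.
have {}HN := le_lt_trans (ler_norm _) HN.
move: h1 h2 h3; rewrite ltr_norml !ler_norml ltr_norml.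
move: (tsum _) (tsum _) (series g N) (series (f t) N) (C * _) HN => a b c d q.
lra.
Unshelve. all: by end_near. Qed.

Lemma MVT_bound (f df : R -> R) (a b x y C : R) :
  (forall z, a < z < b -> is_derive z 1 f (df z)) ->
  (forall z, a < z < b -> `|df z| <= C) ->
  a < x < b -> a < y < b -> `|f y - f x| <= C * `|y - x|.
Proof.
move=> fd dfC; wlog xy : x y / x <= y.
  move=> h ax ay; have [/h|/ltW /h] := leP x y; first exact.
  by rewrite distrC (distrC y x); exact.
move=> /andP[ax xb] /andP[ay yb].
have [z||z zxy ->] := @MVT_segment _ f df x y xy.
- rewrite in_itv/= => /andP[xz zy]; apply: fd; lra.
- apply: derivable_within_continuous => z; rewrite in_itv/= => /andP[xz zy].
  have := fd z; case => //; lra.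
rewrite normrM ler_wpM2r//; apply: dfC.
move: zxy; rewrite in_itv/=; lra.
Qed.

Lemma lip_closed (f df : R -> R) (C : R) :
  (forall y : R, 0 <= y <= 1 -> is_derive y 1 f (df y)) ->
  (forall y : R, 0 < y < 1 -> `|df y| <= C) ->
  forall x y : R, 0 <= x <= 1 -> 0 <= y <= 1 -> `|f y - f x| <= C * `|y - x|.
Proof.
move=> fd dfC.
have lt (x y : R) : 0 <= x <= 1 -> 0 <= y <= 1 -> x < y ->
    `|f y - f x| <= C * `|y - x|.
  move=> /andP[x0 x1] /andP[y0 y1] xy.
  have [c cxy ->] : exists2 c, c \in `]x, y[%R & f y - f x = df c * (y - x).
    apply: MVT => // [z|].
      by rewrite in_itv/= => /andP[? ?]; apply: fd; lra.
    apply: derivable_within_continuous => z; rewrite in_itv/= => /andP[xz zy].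
    by case: (fd z _) => //; lra.
  rewrite normrM ler_wpM2r// dfC//; move: cxy; rewrite in_itv/=; lra.
move=> x y x01 y01; have [xy|yx|->] := ltgtP x y; first exact: lt.
  by rewrite distrC (distrC y); exact: lt.
by rewrite !subrr normr0 mulr0.
Qed.

Lemma is_derive_quotP (f : R -> R) (x l : R) :
  is_derive x 1 f l <-> h^-1 * (f (h + x) - f x) @[h --> 0^'] --> l.
Proof.
have e : (fun h : R => h^-1 * (f (h + x) - f x)) =
    (fun h : R => h^-1 *: ((f \o shift x) (h *: (1:R)) - f x)).
  by apply/funext => h /=; rewrite [h *: 1]mulr1.
rewrite e; split => [[fx <-]//|h]; split; first by apply/cvg_ex; exists l.
exact: cvg_lim h.
Qed.

(** Termwise differentiation: the difference quotients are dominated by the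
    bound on the derivatives (mean value), so dominated convergence applies. *)
Lemma is_derive_tsum (f df : nat -> R -> R) (a b : R) M C C' : summable_ge0 M ->
  (forall n z, a < z < b -> is_derive z 1 (f n) (df n z)) ->
  (forall n z, a < z < b -> `|f n z| <= C' * M n) ->
  (forall n z, a < z < b -> `|df n z| <= C * M n) ->
  forall x, a < x < b ->
    is_derive x 1 (fun y => tsum (f ^~ y)) (tsum (df ^~ x)).
Proof.
move=> sM fd fM dfM x axb; apply/is_derive_quotP.
have near_ab : \forall h \near (0 : R)^', a < h + x < b.
  near=> h; have he : `|h| < Num.min (x - a) (b - x).
    near: h; apply: dnbhs0_lt; move: axb => /andP[? ?].
    by rewrite lt_min !subr_gt0; apply/andP.
  move: he; rewrite lt_min !ltr_norml.
  by move=> /andP[/andP[? ?] /andP[? ?]]; apply/andP; split; lra.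
have [||_] := @tannery _ (0 : R)^' _
    (fun h n => h^-1 * (f n (h + x) - f n x)) (df ^~ x) M C sM.
- near=> h => n.
  have h0 : h != 0 by near: h; exact: nbhs_dnbhs_neq.
  have hx : a < h + x < b by near: h.
  rewrite normrM normfV ler_pdivrMl ?normr_gt0//.
  have := MVT_bound (fd n) (dfM n) axb hx.
  by rewrite addrK mulrC.
- by move=> n; apply/is_derive_quotP; exact: fd.
apply: cvg_trans; apply: near_eq_cvg; near=> h.
have hx : a < h + x < b by near: h.
have cf z : a < z < b -> cvgn (series (f ^~ z)).
  by move=> hz; apply: cvg_dom sM _ => n; exact: fM.
rewrite -tsumB; [|exact: cf|exact: cf].
by rewrite -tsumZ//; apply: (@is_cvg_seriesB R); exact: cf.
Unshelve. all: by end_near. Qed.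
End Series.

(** * Distribution functions with their density and its derivative *)

Section Jets.
Context {R : realType}.

(** A measure on [0, 1] given by its distribution function [jK] (up to a
    constant), its density [jk] and the derivative [jk1] of the density.
    Carrying the three functions explicitly lets the transfer operator act by
    explicit series.  The densities are only controlled on the open interval. *)
Record jet := Jet { jK : R -> R; jk : R -> R; jk1 : R -> R }.

Implicit Types (J : jet) (C a m : R).

Record jet_bound C J : Prop := JetBound {
  jb_lip : forall x y : R, 0 <= x <= 1 -> 0 <= y <= 1 ->
    `|jK J y - jK J x| <= C * `|y - x|;
  jb_d : forall y : R, 0 < y < 1 -> is_derive y 1 (jK J) (jk J y);
  jb_d1 : forall y : R, 0 < y < 1 -> is_derive y 1 (jk J) (jk1 J y);
  jb_k : forall y : R, 0 < y < 1 -> `|jk J y| <= C;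
  jb_k1 : forall y : R, 0 < y < 1 -> `|jk1 J y| <= C }.

(** Logarithmically Lipschitz densities of total mass [m]: a bound on the
    oscillation of the density that is relative to its size, hence stable under
    positive superpositions. *)
Record jet_cone a m J : Prop := JetCone {
  jc_bound : exists C, jet_bound C J;
  jc_ge0 : forall y : R, 0 < y < 1 -> 0 <= jk J y;
  jc_le : forall y : R, 0 < y < 1 -> `|jk1 J y| <= a * jk J y;
  jc_mass : jK J 1 - jK J 0 = m }.

Record jet_eq J J' : Prop := JetEq {
  je_K : forall y : R, 0 <= y <= 1 -> jK J y = jK J' y;
  je_k : forall y : R, 0 < y < 1 -> jk J y = jk J' y;
  je_k1 : forall y : R, 0 < y < 1 -> jk1 J y = jk1 J' y }.

Definition jet_lin c J c' J' := Jet
  (fun y => c * jK J y + c' * jK J' y) (fun y => c * jk J y + c' * jk J' y)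
  (fun y => c * jk1 J y + c' * jk1 J' y).

(** Lebesgue measure. *)
Definition jet_id := Jet id (fun=> 1) (fun=> 0).

Lemma ndecr_derive (f df : R -> R) (a b x y : R) :
  (forall z, a < z < b -> is_derive z 1 f (df z)) ->
  (forall z, a < z < b -> 0 <= df z) ->
  a < x -> x <= y -> y < b -> f x <= f y.
Proof.
move=> fd df0 ax xy yb.
have [z||z zxy] := @MVT_segment _ f df x y xy.
- rewrite in_itv/= => /andP[xz zy]; apply: fd; lra.
- apply: derivable_within_continuous => z; rewrite in_itv/= => /andP[xz zy].
  have := fd z; case => //; lra.
rewrite -subr_ge0 => ->; apply: mulr_ge0; last by rewrite subr_ge0.
by apply: df0; move: zxy; rewrite in_itv/=; lra.
Qed.

(** Gronwall: exp(a z) f(z) is nondecreasing and exp(- a z) f(z) is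
    nonincreasing. *)
Lemma loglip_le (f df : R -> R) (a x y : R) : 0 <= a ->
  (forall z : R, 0 < z < 1 -> is_derive z 1 f (df z)) ->
  (forall z : R, 0 < z < 1 -> 0 <= f z) ->
  (forall z : R, 0 < z < 1 -> `|df z| <= a * f z) ->
  0 < x < 1 -> 0 < y < 1 -> f x <= expR a * f y.
Proof.
move=> a0 fd f0 dfa x01 y01.
suff : f x <= expR (a * `|x - y|) * f y.
  move/le_trans; apply; rewrite ler_wpM2r ?f0// ler_expR ler_piMr//.
  by rewrite ler_norml; lra.
have [xy|yx] := leP x y.
- have h : f x * expR (a * x) <= f y * expR (a * y).
    apply: (@ndecr_derive (fun z => f z * expR (a * z))
      (fun z => (df z + a * f z) * expR (a * z)) 0 1) => //.
    + move=> z z01; have := fd z z01 => ?; apply: is_derive_eq.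
      by rewrite /GRing.scale/=; ring.
    + move=> z z01; rewrite mulr_ge0 ?expR_ge0//.
      by have := dfa z z01; rewrite ler_norml; lra.
    + by case/andP: x01.
    + by case/andP: y01.
  rewrite ler0_norm ?subr_le0// opprB mulrBr expRD expRN mulrAC ler_pdivlMr ?expR_gt0//.
  by rewrite [X in _ <= X]mulrC.
- have h : - (f y * expR (- a * y)) <= - (f x * expR (- a * x)).
    apply: (@ndecr_derive (fun z => - (f z * expR (- a * z)))
      (fun z => (- df z + a * f z) * expR (- a * z)) 0 1) => //.
    + move=> z z01; have := fd z z01 => ?; apply: is_derive_eq.
      by rewrite /GRing.scale/=; ring.
    + move=> z z01; rewrite mulr_ge0 ?expR_ge0//.
      by have := dfa z z01; rewrite ler_norml; lra.
    + by case/andP: y01.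
    + exact: ltW.
    + by case/andP: x01.
  move: h; rewrite lerN2 => h.
  rewrite gtr0_norm ?subr_gt0// mulrBr expRD -mulrA -ler_pdivrMl ?expR_gt0//.
  by rewrite -expRN -mulNr mulrC -mulNr [expR (- a * y) * _]mulrC.
Qed.

(** Mean value theorem, with the derivative at the intermediate point
    compared to [f y] by [loglip_le]. *)
Lemma loglip_lip (f df : R -> R) (a x y : R) : 0 <= a ->
  (forall z : R, 0 < z < 1 -> is_derive z 1 f (df z)) ->
  (forall z : R, 0 < z < 1 -> 0 <= f z) ->
  (forall z : R, 0 < z < 1 -> `|df z| <= a * f z) ->
  0 < x < 1 -> 0 < y < 1 -> `|f x - f y| <= a * expR a * `|x - y| * f y.
Proof.
move=> a0 fd f0 dfa x01 y01.
rewrite mulrAC; apply: (@MVT_bound _ f df 0 1) => // z z01.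
apply: le_trans (dfa z z01) _; rewrite -mulrA ler_wpM2l//.
exact: (loglip_le a0 fd f0 dfa z01 y01).
Qed.

Lemma lip_continuous (f : R -> R) C :
  (forall x y : R, 0 <= x <= 1 -> 0 <= y <= 1 -> `|f y - f x| <= C * `|y - x|) ->
  {within `[0, 1], continuous f}.
Proof.
move=> fC; apply/subspace_continuousP => x; rewrite /= in_itv/= => x01.
apply/cvgrPdist_lt => e e0.
have C0 : 0 <= C by have := fC 0 1; rewrite subr0 normr1 mulr1 => h;
  apply: le_trans (h _ _); rewrite ?lexx ?ler01 ?normr_ge0.
have ep : 0 < e / (C + 1) by apply: divr_gt0 => //; exact: ltr_wpDl.
rewrite near_withinE; near=> y => y01.
have y01' : 0 <= y <= 1 by move: y01; rewrite /= in_itv.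
apply: le_lt_trans (fC _ _ y01' x01) _.
have h : `|x - y| < e / (C + 1).
  by near: y; exact: cvgr_dist_lt.
apply: (@le_lt_trans _ _ ((C + 1) * `|x - y|)).
  by apply: ler_wpM2r => //; lra.
by rewrite mulrC -ltr_pdivlMr//; lra.
Unshelve. all: by end_near. Qed.

(** The density lies within a factor exp(a) of each of its values, and its
    mean value is [m]. *)
Lemma cone_bounds a m J : 0 <= a -> jet_cone a m J -> forall y : R, 0 < y < 1 ->
  m * expR (- a) <= jk J y <= m * expR a.
Proof.
move=> a0 [[C jb] k0 k1 mass] y y01.
have [c c01 hc] : exists2 c, c \in `]0, 1[%R & jK J 1 - jK J 0 = jk J c * (1 - 0).
  apply: MVT => [//|z|]; first by rewrite in_itv/=; exact: jb_d jb z.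
  exact: lip_continuous (jb_lip jb).
have {}c01 : 0 < c < 1 by move: c01; rewrite in_itv.
have {}hc : jk J c = m by move: hc; rewrite mass subr0 mulr1.
rewrite -hc; apply/andP; split.
- rewrite expRN ler_pdivrMr ?expR_gt0// mulrC.
  exact: (loglip_le a0 (jb_d1 jb) k0 k1).
- rewrite mulrC; exact: (loglip_le a0 (jb_d1 jb) k0 k1).
Qed.

Lemma cone_jet_bound a m J : 1 <= a -> jet_cone a m J ->
  jet_bound (a * expR a * m) J.
Proof.
move=> a1 jc; have a0 : 0 <= a by lra.
have kb := cone_bounds a0 jc.
case: jc => [[C jb] k0 k1 mass].
have m0 : 0 <= m.
  have h2 : 0 < (2^-1 : R) < 1 by lra.
  have := kb _ h2 => /andP[_]; have := k0 _ h2 => h /(le_trans h).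
  by rewrite pmulr_lge0 ?expR_gt0.
have e0 := expR_gt0 a.
have kle y : 0 < y < 1 -> `|jk J y| <= a * expR a * m.
  move=> y01; rewrite ger0_norm ?k0//; have /andP[_ /le_trans] := kb y y01.
  by apply; rewrite -mulrA [expR a * m]mulrC ler_peMl// mulr_ge0// ltW.
split => //; [|exact: jb_d jb|exact: jb_d1 jb|]; last first.
  move=> y y01; apply: le_trans (k1 y y01) _; rewrite -mulrA ler_wpM2l//.
  by have /andP[_] := kb y y01; rewrite mulrC.
have lt x y : 0 <= x <= 1 -> 0 <= y <= 1 -> x < y ->
    `|jK J y - jK J x| <= a * expR a * m * `|y - x|.
  move=> x01 y01 xy.
  have [c cxy ->] : exists2 c, c \in `]x, y[%R & jK J y - jK J x = jk J c * (y - x).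
    apply: MVT => // [z|].
      by rewrite in_itv/= => /andP[? ?]; apply: (jb_d jb); lra.
    apply: (continuous_subspaceW _ (lip_continuous (jb_lip jb))) => z /=.
    by rewrite !in_itv/=; lra.
  rewrite normrM ler_wpM2r// kle//; move: cxy; rewrite in_itv/=; lra.
move=> x y x01 y01; have [xy|yx|->] := ltgtP x y; first exact: lt.
  by rewrite distrC (distrC y); exact: lt.
by rewrite !subrr normr0 mulr0.
Qed.

Lemma jet_bound_lin C C' c c' J J' : jet_bound C J -> jet_bound C' J' ->
  jet_bound (`|c| * C + `|c'| * C') (jet_lin c J c' J').
Proof.
move=> jb jb'.
have tri (u v A B : R) : `|u| <= A -> `|v| <= B ->
    `|c * u + c' * v| <= `|c| * A + `|c'| * B.
  move=> uA vB; apply: le_trans (ler_normD _ _) _; rewrite !normrM.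
  by apply: lerD; apply: ler_wpM2l.
split => [x y x01 y01|y y01|y y01|y y01|y y01] /=.
- rewrite mulrDl -!mulrA.
  rewrite (_ : _ - _ = c * (jK J y - jK J x) + c' * (jK J' y - jK J' x)); last by ring.
  by apply: tri; [exact: jb_lip jb _ _ _ _|exact: jb_lip jb' _ _ _ _].
- have := jb_d jb y01; have := jb_d jb' y01 => ? ?; apply: is_derive_eq.
  by rewrite /GRing.scale/=; ring.
- have := jb_d1 jb y01; have := jb_d1 jb' y01 => ? ?; apply: is_derive_eq.
  by rewrite /GRing.scale/=; ring.
- by apply: tri; [exact: jb_k jb _ _|exact: jb_k jb' _ _].
- by apply: tri; [exact: jb_k1 jb _ _|exact: jb_k1 jb' _ _].
Qed.

Lemma jet_bound_id : jet_bound 1 jet_id.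
Proof.
split => [x y _ _|y _|y _|y _|y _] /=; rewrite ?mul1r ?normr1 ?normr0//.
- exact: is_derive_id.
- exact: is_derive_cst.
Qed.

End Jets.

(** * The transfer operator of a family of contracting branches *)

Section Branches.
Context {R : realType}.
Implicit Types (J : @jet R) (C a m : R).

(** Inverse branches of a full-branched expanding map of ]0, 1], with first
    and second derivatives [b1] and [b2].  The contraction factor 1/2, the
    distortion bound |b''| <= 2 b' and the Lipschitz constant [d2] of b'' relative
    to b' make the constants uniform in a parameter; [M] dominates the
    first derivatives.  The last three fields say that the images of the branches
    tile ]0, 1] from right to left, so that the operator below preserves mass. *)
Record branches (M : nat -> R) (d2 : R) (b b1 b2 : nat -> R -> R) : Prop := Branches {
  brM : summable_ge0 M;
  br_d2 : 0 <= d2;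
  br_cc : forall n y, 0 <= y <= 1 -> 0 <= b n y <= 1;
  br_oo : forall n y, 0 < y < 1 -> 0 < b n y < 1;
  br_ndecr : forall n x y, 0 <= x -> x <= y -> y <= 1 -> b n x <= b n y;
  br_lip : forall n x y, 0 <= x <= 1 -> 0 <= y <= 1 ->
    `|b n y - b n x| <= M n * `|y - x|;
  br_lip2 : forall n x y, 0 <= x <= 1 -> 0 <= y <= 1 ->
    `|b n y - b n x| <= 2^-1 * `|y - x|;
  br_d : forall n (y : R), 0 < y < 1 -> is_derive y 1 (b n) (b1 n y);
  br_d1 : forall n (y : R), 0 < y < 1 -> is_derive y 1 (b1 n) (b2 n y);
  br_1ge0 : forall n y, 0 < y < 1 -> 0 <= b1 n y;
  br_1half : forall n y, 0 < y < 1 -> b1 n y <= 2^-1;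
  br_1M : forall n y, 0 < y < 1 -> b1 n y <= M n;
  br_2le : forall n y, 0 < y < 1 -> `|b2 n y| <= 2 * b1 n y;
  br_2lip : forall n x y, 0 < x < 1 -> 0 < y < 1 ->
    `|b2 n x - b2 n y| <= d2 * `|x - y| * b1 n y;
  br_top : b 0%N 1 = 1;
  br_adj : forall n, b n.+1 1 = b n 0;
  br_lim0 : b n 0 @[n --> \oo] --> 0 }.

Section Operator.
Variables (M : nat -> R) (d2 : R) (b b1 b2 : nat -> R -> R).
Hypothesis br : branches M d2 b b1 b2.

(** The distribution function of the image, under the map with inverse branches
    [b], of the measure with distribution function [K]; subtracting the value
    at 0 makes the series converge. *)
Definition QK (K : R -> R) : R -> R :=
  fun y => tsum (fun n => K (b n y) - K (b n 0)).

Definition Qj J := Jet (QK (jK J))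
  (fun y => tsum (fun n => b1 n y * jk J (b n y)))
  (fun y => tsum (fun n => b2 n y * jk J (b n y) + b1 n y ^+ 2 * jk1 J (b n y))).

Let M0 n : 0 <= M n. Proof. by case: (brM br). Qed.

Lemma br_cc0 n : 0 <= b n 0 <= 1.
Proof. by apply: (br_cc br); rewrite lexx ler01. Qed.

Lemma QK_term C (K : R -> R) y n :
  (forall x y : R, 0 <= x <= 1 -> 0 <= y <= 1 -> `|K y - K x| <= C * `|y - x|) ->
  0 <= y <= 1 -> `|K (b n y) - K (b n 0)| <= C * M n.
Proof.
move=> KC y01; have C0 : 0 <= C.
  by have := KC 0 1; rewrite subr0 normr1 mulr1 => h;
    apply: le_trans (h _ _); rewrite ?lexx ?ler01 ?normr_ge0.
apply: le_trans (KC _ _ (br_cc0 n) (br_cc br n y01)) _.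
rewrite ler_wpM2l//; apply: le_trans (br_lip br n _ y01) _.
  by rewrite lexx ler01.
by rewrite subr0 ler_piMr// ger0_norm; lra.
Qed.

Lemma Qk_term C J y n : jet_bound C J -> 0 < y < 1 ->
  `|b1 n y * jk J (b n y)| <= C * M n.
Proof.
move=> jb y01; rewrite normrM mulrC.
have := jb_k jb (br_oo br n y01); have := br_1M br n y01.
rewrite (ger0_norm (br_1ge0 br n y01)) => h1 h2.
by apply: ler_pM => //; exact: (br_1ge0 br).
Qed.

Lemma Q1_term C J y n : jet_bound C J -> 0 < y < 1 ->
  `|b2 n y * jk J (b n y) + b1 n y ^+ 2 * jk1 J (b n y)| <= 3 * C * M n.
Proof.
move=> jb y01; apply: le_trans (ler_normD _ _) _; rewrite [X in X + _]normrM [X in _ + X]normrM normrX.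
have k0 := jb_k jb (br_oo br n y01); have k1 := jb_k1 jb (br_oo br n y01).
have C0 : 0 <= C by exact: le_trans k0.
have b10 := br_1ge0 br n y01; have bM := br_1M br n y01.
have bh := br_1half br n y01; have b2l := br_2le br n y01.
have h1 : `|b2 n y| * `|jk J (b n y)| <= 2 * M n * C.
  apply: ler_pM => //; apply: le_trans b2l _; exact: ler_wpM2l.
have h2 : `|b1 n y| ^+ 2 * `|jk1 J (b n y)| <= M n * C.
  apply: ler_pM => //.
  rewrite ger0_norm// expr2 -[leRHS]mul1r; apply: ler_pM => //; lra.
apply: le_trans (lerD h1 h2) _; lra.
Qed.

Definition Qnorm : R := 3 * (1 + tsum M).

Lemma tsumM_ge0 : 0 <= tsum M.
Proof. by apply: tsum_ge0 => //; case: (brM br). Qed.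

Lemma Qj_bound C J : jet_bound C J -> jet_bound (C * Qnorm) (Qj J).
Proof.
move=> jb; have sM := brM br; have tM := tsumM_ge0.
have C0 : 0 <= C.
  by apply: le_trans (@jb_k _ _ _ jb 2^-1 _); [exact: normr_ge0|lra].
have CM : C * tsum M <= C * Qnorm by apply: ler_wpM2l => //; rewrite /Qnorm; lra.
split => /=.
- move=> x y x01 y01; rewrite /QK -tsumB; last 2 first.
  + by apply: cvg_dom sM _ => n; apply: QK_term y01; exact: jb_lip jb.
  + by apply: cvg_dom sM _ => n; apply: QK_term x01; exact: jb_lip jb.
  apply: (@le_trans _ _ (C * `|y - x| * tsum M)).
    apply: tsum_norm => // n.
    rewrite (_ : _ - _ = jK J (b n y) - jK J (b n x)); last by ring.
    apply: le_trans (jb_lip jb (br_cc br n x01) (br_cc br n y01)) _.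
    by rewrite -mulrA ler_wpM2l// mulrC; exact: (br_lip br).
  by rewrite mulrAC ler_wpM2r.
- move=> y y01; apply: (@is_derive_tsum R _
    (fun n z => b1 n z * jk J (b n z)) 0 1 M C C) => // n z z01; last 2 first.
  + by apply: QK_term; [exact: jb_lip jb|lra].
  + exact: Qk_term.
  have := jb_d jb (br_oo br n z01); have := br_d br n z01 => h1 h2.
  apply: is_derive_eq; rewrite /GRing.scale/=; ring.
- move=> y y01; apply: (@is_derive_tsum R (fun n z => b1 n z * jk J (b n z))
    (fun n z => b2 n z * jk J (b n z) + b1 n z ^+ 2 * jk1 J (b n z)) 0 1 M (3 * C) C) => // n z z01; last 2 first.
  + exact: Qk_term.
  + exact: Q1_term.
  have := jb_d1 jb (br_oo br n z01); have := br_d br n z01.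
  have := br_d1 br n z01 => h1 h2 h3.
  apply: is_derive_eq; rewrite /GRing.scale/=; ring.
- move=> y y01; apply: le_trans CM; apply: tsum_norm => // n; exact: Qk_term.
- move=> y y01; apply: (@le_trans _ _ (3 * C * tsum M)).
    by apply: tsum_norm => // n; exact: Q1_term.
  by rewrite -mulrA mulrCA ler_wpM2l// /Qnorm; lra.
Qed.

Lemma QK_0 K : QK K 0 = 0.
Proof.
rewrite /QK (_ : (fun n => _) = (fun n => 0)).
  rewrite /tsum (_ : series _ = (fun=> 0)); first exact: lim_cst.
  by apply/funext => n; rewrite /series/= big1.
by apply/funext => n; rewrite subrr.
Qed.

(** The series telescopes, since consecutive branches are adjacent. *)
Lemma QK_1 (K : R -> R) : K (b n 0) @[n --> \oo] --> K 0 ->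
  QK K 1 = K 1 - K 0.
Proof.
move=> K0; rewrite /QK.
rewrite (_ : (fun n => _) =
  (fun n => (fun n => K (b n 1)) n - (fun n => K (b n 1)) n.+1)); last first.
  by apply/funext => n /=; rewrite (br_adj br).
rewrite /tsum (cvg_lim _ (@tsum_telescope _ (fun n => K (b n 1)) (K 0) _))//.
  by rewrite (br_top br).
rewrite -(cvg_shiftS (fun n => K (b n 1))).
by under eq_fun do rewrite (br_adj br).
Qed.

Lemma lip_b0 C (K : R -> R) :
  (forall x y : R, 0 <= x <= 1 -> 0 <= y <= 1 -> `|K y - K x| <= C * `|y - x|) ->
  K (b n 0) @[n --> \oo] --> K 0.
Proof.
move=> KC.
have h : C * `|b n 0 - (0 : R)| @[n --> \oo] --> C * `|0 - (0 : R)|.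
  by apply: cvgMr; apply: cvg_norm; apply: cvgB; [exact: br_lim0 br|exact: cvg_cst].
rewrite subrr normr0 mulr0 in h.
apply/cvgrPdist_lt => e e0; move/cvgrPdist_lt : h => /(_ e e0).
apply: filterS => n; rewrite sub0r normrN => h.
rewrite distrC; apply: le_lt_trans (KC _ _ _ (br_cc0 n)) _.
  by rewrite lexx ler01.
exact: le_lt_trans (ler_norm _) h.
Qed.

Lemma Qj_mass C J : jet_bound C J ->
  jK (Qj J) 1 - jK (Qj J) 0 = jK J 1 - jK J 0.
Proof. by move=> jb; rewrite /= QK_0 subr0 QK_1//; exact: lip_b0 (jb_lip jb). Qed.

(** Lasota-Yorke inequality in cone form: b' <= 1/2 halves the logarithmic
    Lipschitz constant and the distortion of b' adds 2. *)
Lemma Qj_cone a m J : 0 <= a -> jet_cone a m J -> jet_cone (a / 2 + 2) m (Qj J).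
Proof.
move=> a0 [[C jb] k0 k1 mass]; have sM := brM br.
have ck y : 0 < y < 1 -> cvgn (series (fun n => b1 n y * jk J (b n y))).
  by move=> y01; apply: cvg_dom sM _ => n; exact: (Qk_term n jb).
split => /=.
- by exists (C * Qnorm); exact: Qj_bound.
- move=> y y01; apply: tsum_ge0; first exact: ck.
  by move=> n; rewrite mulr_ge0 ?(br_1ge0 br)// k0//; exact: (br_oo br).
- move=> y y01; apply: tsum_norm => [|n].
    split; last exact: ck.
    by move=> n; rewrite mulr_ge0 ?(br_1ge0 br)// k0//; exact: (br_oo br).
    have kk0 := k0 _ (br_oo br n y01).
    have b10 := br_1ge0 br n y01.
    apply: le_trans (ler_normD _ _) _; rewrite [X in X + _]normrM [X in _ + X]normrM normrX.
    rewrite (ger0_norm kk0) (ger0_norm b10).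
    have h1 := ler_wpM2r kk0 (br_2le br n y01).
    have h2 : b1 n y ^+ 2 * `|jk1 J (b n y)| <= b1 n y * 2^-1 * (a * jk J (b n y)).
      rewrite expr2; apply: ler_pM => //; first exact: mulr_ge0.
        by apply: ler_wpM2l => //; exact: (br_1half br).
      by apply: k1; exact: (br_oo br).
    apply: le_trans (lerD h1 h2) _; lra.
- by rewrite (Qj_mass jb).
Qed.

Lemma Qj_eq J J' : jet_eq J J' -> jet_eq (Qj J) (Qj J').
Proof.
move=> [eK ek ek1]; split => y y01 /=; congr tsum; apply/funext => n.
- by rewrite !eK ?br_cc0//; exact: (br_cc br).
- by rewrite ek//; exact: (br_oo br).
- by rewrite ek ?ek1//; exact: (br_oo br).
Qed.

Lemma Qj_lin C C' c c' J J' : jet_bound C J -> jet_bound C' J' ->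
  jet_eq (Qj (jet_lin c J c' J')) (jet_lin c (Qj J) c' (Qj J')).
Proof.
move=> jb jb'; have sM := brM br.
have lin (f g : nat -> R) : cvgn (series f) -> cvgn (series g) ->
    tsum (fun n => c * f n + c' * g n) = c * tsum f + c' * tsum g.
  move=> cf cg; rewrite tsumD ?tsumZ//.
    exact: (@is_cvg_seriesZ R _ _ cf).
  exact: (@is_cvg_seriesZ R _ _ cg).
split => y y01 /=; rewrite /QK -lin.
- by congr tsum; apply/funext => n; ring.
- by apply: cvg_dom sM _ => n; apply: QK_term y01; exact: jb_lip jb.
- by apply: cvg_dom sM _ => n; apply: QK_term y01; exact: jb_lip jb'.
- by congr tsum; apply/funext => n; ring.
- by apply: cvg_dom sM _ => n; exact: (Qk_term n jb).
- by apply: cvg_dom sM _ => n; exact: (Qk_term n jb').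
- by congr tsum; apply/funext => n; ring.
- by apply: cvg_dom sM _ => n; exact: (Q1_term n jb).
- by apply: cvg_dom sM _ => n; exact: (Q1_term n jb').
Qed.

End Operator.
End Branches.

(** * Exponential contraction and the invariant distribution function *)

Section Contraction.
Context {R : realType}.
Implicit Types (J : @jet R) (C a m : R).

Lemma jet_eq_refl J : jet_eq J J. Proof. by split. Qed.

Lemma jet_eq_trans J J' J'' : jet_eq J J' -> jet_eq J' J'' -> jet_eq J J''.
Proof.
by move=> [h1 h2 h3] [g1 g2 g3]; split => y y01; rewrite ?h1 ?h2 ?h3 ?g1 ?g2 ?g3.
Qed.

Lemma jet_bound_ge0 C J : jet_bound C J -> 0 <= C.
Proof.
by move=> jb; apply: le_trans (@jb_k _ _ _ jb 2^-1 _); [exact: normr_ge0|lra].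
Qed.

(** Proportion of the mass that can be removed as a multiple of Lebesgue
    measure from a density with |k'| <= 6 k while keeping |k'| <= 8 k: by
    [cone_bounds] such a density is at least exp(- 6) times its mass m, and
    6 k <= 8 (k - gap m) as soon as gap m <= k / 4. *)
Definition gap : R := expR (- 6) / 4.

Lemma gap_gt0 : 0 < gap. Proof. by rewrite divr_gt0 ?expR_gt0. Qed.

Lemma gap_lt1 : gap < 1.
Proof.
have : expR (- 6) < 1 :> R by rewrite expR_lt1; lra.
rewrite /gap; lra.
Qed.

Definition rate : R := 1 - gap.

Lemma rate_ge0 : 0 <= rate. Proof. by have := gap_lt1; rewrite /rate; lra. Qed.

Lemma rate_summable : summable_ge0 (fun j => rate ^+ j).
Proof.
split; first by move=> n; rewrite exprn_ge0// rate_ge0.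
have -> : (fun j => rate ^+ j) = geometric 1 rate.
  by apply/funext => n; rewrite /= mul1r.
apply: is_cvg_geometric_series; rewrite ger0_norm ?rate_ge0//.
by have := gap_gt0; rewrite /rate; lra.
Qed.

Lemma cone_mass_ge0 a m J : 0 <= a -> jet_cone a m J -> 0 <= m.
Proof.
move=> a0 jc; have h2 : 0 < (2^-1 : R) < 1 by lra.
have /andP[_] := cone_bounds a0 jc h2; have := jc_ge0 jc h2 => h /(le_trans h).
by rewrite pmulr_lge0 ?expR_gt0.
Qed.

(** Doeblin step: subtracting [gap] times the mass shrinks the mass by [rate]
    and costs only the enlargement of the cone from 6 to 8. *)
Lemma cone_shift m J : jet_cone 6 m J ->
  jet_cone 8 (m * rate) (jet_lin 1 J (- (gap * m)) jet_id).
Proof.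
move=> jc; have kb := cone_bounds (ler0n R 6) jc.
have m0 := cone_mass_ge0 (ler0n R 6) jc.
case: jc => [[C jb] k0 k1 mass].
have kb' y : 0 < y < 1 -> 4 * (gap * m) <= jk J y.
  move=> y01; have /andP[h _] := kb _ y01; apply: le_trans h.
  by rewrite /gap; lra.
split => /=.
- exists (`|1| * C + `|- (gap * m)| * 1).
  by apply: jet_bound_lin => //; exact: jet_bound_id.
- move=> y y01; have := kb' y y01; have := k0 y y01; lra.
- move=> y y01; have := kb' y y01; have := k0 y y01.
  by rewrite mulr0 addr0 mul1r; have := k1 y y01; lra.
- by rewrite -mass /rate; ring.
Qed.

Section System.
Variables (M : nat -> R) (d2 : R) (b b1 b2 : nat -> R -> R).
Hypothesis br : branches M d2 b b1 b2.
Local Notation Q := (Qj b b1 b2).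
Local Notation QN := (Qnorm M).

Lemma iterQ_bound C J j : jet_bound C J -> exists C', jet_bound C' (iter j Q J).
Proof.
move=> jb; elim: j => [|j [C' ih]]; first by exists C.
by exists (C' * QN); exact: (Qj_bound br ih).
Qed.

(** A jet of mass zero is a difference of two elements of the cone of equal
    mass.  One application of [Q] sends the 8-cone to the 6-cone; the same
    multiple of Lebesgue measure is then removed from both, which does not
    change the difference. *)
Lemma iterQ_split C E j : jet_bound C E -> jK E 1 - jK E 0 = 0 ->
  exists W1 W2, [/\ jet_cone 8 (2 * C * rate ^+ j) W1,
    jet_cone 8 (2 * C * rate ^+ j) W2 &
    jet_eq (iter j Q E) (jet_lin 1 W1 (-1) W2)].
Proof.
move=> jb E0; have C0 := jet_bound_ge0 jb.
elim: j => [|j [W1 [W2 [w1 w2 e]]]].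
  (* 2 C makes the density at least C, which bounds its derivative *)
  exists (jet_lin 1 E (2 * C) jet_id), (jet_lin (2 * C) jet_id 0 jet_id).
  have ji := @jet_bound_id R.
  split; [split|split|split] => /=.
  - by eexists; exact: (jet_bound_lin _ _ jb ji).
  - by move=> y y01; have := jb_k jb y01; rewrite ler_norml; lra.
  - move=> y y01; have := jb_k jb y01; have := jb_k1 jb y01.
    by rewrite mulr0 addr0 mul1r !ler_norml; lra.
  - by rewrite expr0; lra.
  - by eexists; exact: (jet_bound_lin _ _ ji ji).
  - by move=> y y01; lra.
  - by move=> y y01; rewrite !mulr0 addr0 normr0; lra.
  - by rewrite expr0; lra.
  - by move=> y y01; ring.
  - by move=> y y01; ring.
  - by move=> y y01; ring.
have q1 := Qj_cone br (ler0n _ 8) w1; have q2 := Qj_cone br (ler0n _ 8) w2.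
have e6 : 8 / 2 + 2 = 6 :> R by lra.
rewrite e6 in q1 q2.
have [[C1 jb1] _ _ _] := w1; have [[C2 jb2] _ _ _] := w2.
do 2 eexists; split; [rewrite exprSr mulrA; exact: cone_shift q1| |].
  by rewrite exprSr mulrA; exact: cone_shift q2.
rewrite iterS; apply: jet_eq_trans (Qj_eq br e) _.
apply: jet_eq_trans (Qj_lin br 1 (-1) jb1 jb2) _.
by split => y y01 /=; ring.
Qed.

Definition Bq : R := 32 * expR 8.

(** Both parts of the decomposition [iterQ_split] have mass of order
    [rate ^+ j], and elements of the cone are bounded by their mass. *)
Lemma contraction C E j : jet_bound C E -> jK E 1 - jK E 0 = 0 ->
  jet_bound (Bq * C * rate ^+ j) (iter j Q E).
Proof.
move=> jb E0; have [W1 [W2 [w1 w2 [eK ek ek1]]]] := iterQ_split j jb E0.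
have /cone_jet_bound := w1 => /(_ (ler1n _ 8)) jb1.
have /cone_jet_bound := w2 => /(_ (ler1n _ 8)) jb2.
have := jet_bound_lin 1 (-1) jb1 jb2.
have -> : `|1| * (8 * expR 8 * (2 * C * rate ^+ j)) +
    `|-1| * (8 * expR 8 * (2 * C * rate ^+ j)) = Bq * C * rate ^+ j.
  by rewrite normrN normr1 /Bq; ring.
move=> jbl; have [C' jb'] := iterQ_bound j jb.
split; [|exact: jb_d jb'|exact: jb_d1 jb'| |].
- by move=> x y x01 y01; rewrite !eK//; exact: jb_lip jbl _ _ x01 y01.
- by move=> y y01; rewrite ek//; exact: jb_k jbl _ y01.
- by move=> y y01; rewrite ek1//; exact: jb_k1 jbl _ y01.
Qed.

Record jet_cvg (Jm : nat -> @jet R) J : Prop := JetCvg {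
  jv_K : forall y, 0 <= y <= 1 -> jK (Jm j) y @[j --> \oo] --> jK J y;
  jv_k : forall y, 0 < y < 1 -> jk (Jm j) y @[j --> \oo] --> jk J y;
  jv_k1 : forall y, 0 < y < 1 -> jk1 (Jm j) y @[j --> \oo] --> jk1 J y }.

Lemma Qj_cvg C (Jm : nat -> @jet R) J : (forall j, jet_bound C (Jm j)) ->
  jet_cvg Jm J -> jet_cvg (fun j => Q (Jm j)) (Q J).
Proof.
move=> jb [cK ck ck1]; have sM := brM br; split => y y01 /=.
- have [|n|_ //] := @tannery R _ \oo _
    (fun j n => jK (Jm j) (b n y) - jK (Jm j) (b n 0))
    (fun n => jK J (b n y) - jK J (b n 0)) M C sM.
    by apply: nearW => j n; apply: (QK_term br) y01; exact: jb_lip (jb j).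
  by apply: cvgB; apply: cK; [exact: (br_cc br)|exact: (br_cc0 br)].
- have [|n|_ //] := @tannery R _ \oo _
    (fun j n => b1 n y * jk (Jm j) (b n y))
    (fun n => b1 n y * jk J (b n y)) M C sM.
    by apply: nearW => j n; exact: (Qk_term br).
  by apply: cvgMr; apply: ck; exact: (br_oo br).
- have [|n|_ //] := @tannery R _ \oo _
    (fun j n => b2 n y * jk (Jm j) (b n y) + b1 n y ^+ 2 * jk1 (Jm j) (b n y))
    (fun n => b2 n y * jk J (b n y) + b1 n y ^+ 2 * jk1 J (b n y)) M (3 * C) sM.
    by apply: nearW => j n; exact: (Q1_term br).
  by apply: cvgD; apply: cvgMr; [apply: ck|apply: ck1]; exact: (br_oo br).
Qed.

Lemma jet_cvg_unique Jm J J' : jet_cvg Jm J -> jet_cvg Jm J' -> jet_eq J J'.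
Proof.
move=> [h1 h2 h3] [g1 g2 g3]; split => y y01.
- exact: (cvg_unique _ (h1 y y01) (g1 y y01)).
- exact: (cvg_unique _ (h2 y y01) (g2 y y01)).
- exact: (cvg_unique _ (h3 y y01) (g3 y y01)).
Qed.

(** [Q] applied to Lebesgue measure, minus Lebesgue measure: it has mass zero. *)
Definition jet_defect := jet_lin 1 (Q jet_id) (-1) jet_id.

(** The limit of the iterates of [Q] on Lebesgue measure, as a telescoping
    series of iterates of [jet_defect]. *)
Definition invU := Jet
  (fun y => y + tsum (fun j => jK (iter j Q jet_defect) y))
  (fun y => 1 + tsum (fun j => jk (iter j Q jet_defect) y))
  (fun y => tsum (fun j => jk1 (iter j Q jet_defect) y)).

Lemma defect_bound : jet_bound (QN + 1) jet_defect.
Proof.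
have ji := @jet_bound_id R.
have := jet_bound_lin 1 (-1) (Qj_bound br ji) ji.
by rewrite normrN normr1 !mul1r.
Qed.

Lemma defect_mass : jK jet_defect 1 - jK jet_defect 0 = 0.
Proof.
have := Qj_mass br (@jet_bound_id R); rewrite /jet_defect /= => h.
rewrite -[RHS](subrr (1 : R)) -[X in _ = X - _](subr0 (1:R)) -h; ring.
Qed.

Lemma iter_defect j : jet_eq (iter j Q jet_defect)
  (jet_lin 1 (iter j.+1 Q jet_id) (-1) (iter j Q jet_id)).
Proof.
elim: j => [|j ih]; first exact: jet_eq_refl.
have ji := @jet_bound_id R.
have [C jb] := iterQ_bound j ji; have [C' jb'] := iterQ_bound j.+1 ji.
rewrite iterS; apply: jet_eq_trans (Qj_eq br ih) _.
exact: (Qj_lin br 1 (-1) jb' jb).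
Qed.

Let jD j := contraction j defect_bound defect_mass.

Lemma iter_defect_sum j : jet_eq (iter j Q jet_id) (Jet
  (fun y => y + series (fun i => jK (iter i Q jet_defect) y) j)
  (fun y => 1 + series (fun i => jk (iter i Q jet_defect) y) j)
  (fun y => series (fun i => jk1 (iter i Q jet_defect) y) j)).
Proof.
have S0 (f : nat -> R) : series f 0%N = 0 by rewrite /series/= big_geq.
have SS (f : nat -> R) i : series f i.+1 = series f i + f i.
  by rewrite /series/= big_nat_recr.
split => y y01; elim: j => [|j ih]; rewrite /= ?S0 ?addr0//.
- rewrite SS (je_K (iter_defect j))// addrA -[X in _ = X + _]ih [in RHS]/=; ring.
- rewrite SS (je_k (iter_defect j))// addrA -[X in _ = X + _]ih [in RHS]/=; ring.
- rewrite SS (je_k1 (iter_defect j))// -[X in _ = X + _]ih [in RHS]/=; ring.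
Qed.

Lemma defect_K0 j : jK (iter j Q jet_defect) 0 = 0.
Proof.
case: j => [|j]; last by rewrite iterS /= QK_0.
by rewrite /= QK_0; ring.
Qed.

Lemma defect_K j y : 0 <= y <= 1 ->
  `|jK (iter j Q jet_defect) y| <= Bq * (QN + 1) * rate ^+ j.
Proof.
move=> y01; have h0 : 0 <= (0 : R) <= 1 by rewrite lexx ler01.
have := jb_lip (jD j) h0 y01; rewrite defect_K0 !subr0 => /le_trans; apply.
rewrite ler_piMr ?(jet_bound_ge0 (jD j))// ger0_norm; lra.
Qed.

Lemma invU_cvg : jet_cvg (fun j => iter j Q jet_id) invU.
Proof.
split => y y01 /=.
- under eq_fun do rewrite (je_K (iter_defect_sum _))//=.
  apply: cvgD; first exact: cvg_cst.
  by apply: cvg_dom rate_summable _ => j; exact: defect_K.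
- under eq_fun do rewrite (je_k (iter_defect_sum _))//=.
  apply: cvgD; first exact: cvg_cst.
  by apply: cvg_dom rate_summable _ => j; exact: (jb_k (jD j)).
- under eq_fun do rewrite (je_k1 (iter_defect_sum _))//=.
  by apply: cvg_dom rate_summable _ => j; exact: (jb_k1 (jD j)).
Qed.

(** The cone is invariant because 8 / 2 + 2 <= 8. *)
Lemma iter_id_cone j : jet_cone 8 1 (iter j Q jet_id).
Proof.
elim: j => [|j ih].
  split => /=.
  - by exists 1; exact: jet_bound_id.
  - by [].
  - by move=> y _; rewrite normr0 mulr1.
  - by rewrite subr0.
have := Qj_cone br (ler0n _ 8) ih; rewrite -iterS => -[h1 h2 h3 h4]; split => //.
by move=> y y01; apply: le_trans (h3 _ y01) _; have := h2 _ y01; lra.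
Qed.

Definition CU : R := 8 * expR 8.

Lemma iter_id_bound j : jet_bound CU (iter j Q jet_id).
Proof. by have := cone_jet_bound (ler1n _ 8) (iter_id_cone j); rewrite mulr1. Qed.

Lemma invU_bound : jet_bound CU invU.
Proof.
have [cK ck ck1] := invU_cvg; split.
- move=> x y x01 y01.
  have h : `|jK (iter j Q jet_id) y - jK (iter j Q jet_id) x| @[j --> \oo] -->
      `|jK invU y - jK invU x|.
    by apply: cvg_norm; apply: cvgB; exact: cK.
  apply: (ler_cvg_to h (cvg_cst _)); apply: nearW => j.
  exact: jb_lip (iter_id_bound j) _ _ x01 y01.
- move=> y y01; rewrite -[X in is_derive _ _ _ X]/(1 + _).
  have h : is_derive y 1 (fun y => tsum (fun j => jK (iter j Q jet_defect) y))
      (tsum (fun j => jk (iter j Q jet_defect) y)).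
    apply: (@is_derive_tsum R _ (fun j => jk (iter j Q jet_defect)) 0 1
      (fun j => rate ^+ j) (Bq * (QN + 1)) (Bq * (QN + 1)) rate_summable) => // n z z01.
    + exact: jb_d (jD n) _ z01.
    + by apply: defect_K; lra.
    + exact: jb_k (jD n) _ z01.
  exact: is_deriveD.
- move=> y y01.
  have h : is_derive y 1 (fun y => tsum (fun j => jk (iter j Q jet_defect) y))
      (tsum (fun j => jk1 (iter j Q jet_defect) y)).
    apply: (@is_derive_tsum R _ (fun j => jk1 (iter j Q jet_defect)) 0 1
      (fun j => rate ^+ j) (Bq * (QN + 1)) (Bq * (QN + 1)) rate_summable) => // n z z01.
    + exact: jb_d1 (jD n) _ z01.
    + exact: jb_k (jD n) _ z01.
    + exact: jb_k1 (jD n) _ z01.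
  rewrite -[jk1 invU y]add0r; exact: is_deriveD.
- move=> y y01.
  apply: (ler_cvg_to (cvg_norm (ck y y01)) (cvg_cst _)); apply: nearW => j.
  exact: jb_k (iter_id_bound j) _ y01.
- move=> y y01.
  apply: (ler_cvg_to (cvg_norm (ck1 y y01)) (cvg_cst _)); apply: nearW => j.
  exact: jb_k1 (iter_id_bound j) _ y01.
Qed.

Lemma invU_fix : jet_eq (Q invU) invU.
Proof.
apply: jet_cvg_unique (Qj_cvg iter_id_bound invU_cvg) _.
have [cK ck ck1] := invU_cvg; split => y y01.
- by have := cK y y01; rewrite -(cvg_shiftS (fun j => jK (iter j Q jet_id) y)).
- by have := ck y y01; rewrite -(cvg_shiftS (fun j => jk (iter j Q jet_id) y)).
- by have := ck1 y y01; rewrite -(cvg_shiftS (fun j => jk1 (iter j Q jet_id) y)).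
Qed.

Lemma invU_0 : jK invU 0 = 0.
Proof. by rewrite -(je_K invU_fix) ?lexx ?ler01//= QK_0. Qed.

Lemma invU_1 : jK invU 1 = 1.
Proof.
have h01 : 0 <= (1 : R) <= 1 by rewrite lexx ler01.
have := jv_K invU_cvg h01.
have -> : (fun j => jK (iter j Q jet_id) 1) = (fun=> 1).
  apply/funext => j; have := jc_mass (iter_id_cone j).
  by case: j => [|j]; rewrite ?iterS /= ?QK_0 subr0.
move=> /cvg_unique; apply => //; exact: cvg_cst.
Qed.

End System.
End Contraction.

(** * Lipschitz regularity of the derivative of the invariant density *)

Section Regularity.
Context {R : realType}.
Implicit Types (J : @jet R) (C a m : R).

Lemma lip_of_k C C' J : jet_bound C' J ->
  (forall y, 0 < y < 1 -> `|jk J y| <= C) ->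
  forall x y, 0 <= x <= 1 -> 0 <= y <= 1 -> `|jK J y - jK J x| <= C * `|y - x|.
Proof.
move=> jb kle.
have lt x y : 0 <= x <= 1 -> 0 <= y <= 1 -> x < y ->
    `|jK J y - jK J x| <= C * `|y - x|.
  move=> x01 y01 xy.
  have [c cxy ->] : exists2 c, c \in `]x, y[%R & jK J y - jK J x = jk J c * (y - x).
    apply: MVT => // [z|].
      by rewrite in_itv/= => /andP[? ?]; apply: (jb_d jb); lra.
    apply: (continuous_subspaceW _ (lip_continuous (jb_lip jb))) => z /=.
    by rewrite !in_itv/=; lra.
  rewrite normrM ler_wpM2r// kle//; move: cxy; rewrite in_itv/=; lra.
move=> x y x01 y01; have [xy|yx|->] := ltgtP x y; first exact: lt.
  by rewrite distrC (distrC y); exact: lt.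
by rewrite !subrr normr0 mulr0.
Qed.

Lemma jet_bound_improve C C' J : jet_bound C' J ->
  (forall y, 0 < y < 1 -> `|jk J y| <= C) ->
  (forall y, 0 < y < 1 -> `|jk1 J y| <= C) -> jet_bound C J.
Proof.
move=> jb kle k1le; split => //; [|exact: jb_d jb|exact: jb_d1 jb].
exact: lip_of_k jb kle.
Qed.

(** Lipschitz condition on the derivative of the density, relative to the
    density like the cone condition, so that it adds up along the branches. *)
Definition lip2 (d : R) J := forall x y, 0 < x < 1 -> 0 < y < 1 ->
  `|jk1 J x - jk1 J y| <= d * `|x - y| * jk J y.

Section System.
Variables (M : nat -> R) (d2 : R) (b b1 b2 : nat -> R -> R).
Hypothesis br : branches M d2 b b1 b2.
Local Notation Q := (Qj b b1 b2).

(** The three terms are the contributions of b'', of k o b and of (b')^2 to the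
    increments of the derivative of the transformed density.  The constant
    2 d3h is stable under d |-> d3h + d / 4. *)
Definition d3h : R := d2 * expR 8 + 16 * expR 8 + 16 * expR 2 * expR 8.

Lemma d3h_ge0 : 0 <= d3h.
Proof.
by rewrite /d3h !addr_ge0// !mulr_ge0 ?expR_ge0//; exact: br_d2 br.
Qed.

(** The derivative of the transformed density is the sum of b'' (k o b) and
    (b')^2 (k' o b).  Only the increment of k' involves [d]; it carries b' and
    the contraction of b, each at most 1/2, hence the factor 1/4. *)
Lemma Qj_lip2 m d J : 0 <= d -> jet_cone 8 m J -> lip2 d J ->
  lip2 (d3h + d / 4) (Q J).
Proof.
move=> d0 jc l2 x y x01 y01; have [[C jb] k0 k1 _] := jc; have sM := brM br.
rewrite /= -tsumB; last 2 first.
- by apply: cvg_dom sM _ => n; exact: (Q1_term br n jb).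
- by apply: cvg_dom sM _ => n; exact: (Q1_term br n jb).
apply: tsum_norm => [|n].
  split; first by move=> n; rewrite mulr_ge0 ?(br_1ge0 br)// k0//; exact: (br_oo br).
  by apply: cvg_dom sM _ => n; exact: (Qk_term br n jb).
have bx := br_oo br n x01; have by_ := br_oo br n y01.
have kxy := loglip_le (ler0n _ 8) (jb_d1 jb) k0 k1 bx by_.
have klip := loglip_lip (ler0n _ 8) (jb_d1 jb) k0 k1 bx by_.
have dlip := loglip_lip (ler0n _ 2) (fun z h => br_d1 br n h) (fun z h => br_1ge0 br n h)
  (fun z h => br_2le br n h) x01 y01.
have k1lip := l2 _ _ bx by_.
have b2lip := br_2lip br n x01 y01.
have x01' : 0 <= x <= 1 by lra.
have y01' : 0 <= y <= 1 by lra.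
have blip := br_lip2 br n y01' x01'.
have kx0 := k0 _ bx; have ky0 := k0 _ by_; have k1x := k1 _ bx.
have b1x0 := br_1ge0 br n x01; have b1y0 := br_1ge0 br n y01.
have b1xh := br_1half br n x01; have b1yh := br_1half br n y01.
have b2y := br_2le br n y01.
move: kxy klip dlip k1lip b2lip blip kx0 ky0 k1x b1x0 b1y0 b1xh b1yh b2y.
move: (jk J (b n x)) (jk J (b n y)) (jk1 J (b n x)) (jk1 J (b n y)).
move: (b n x) (b n y) (b1 n x) (b1 n y) (b2 n x) (b2 n y) `|x - y| (normr_ge0 (x - y)).
move=> X Y p q P S D D0 kX kY gX gY kXY klip dlip glip Plip blip kX0 kY0 gXk p0 q0 ph qh Sq.
have e8 := expR_ge0 (8 : R); have e2 := expR_ge0 (2 : R).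
have hA : `|P - S| * kX <= (d2 * D * q) * (expR 8 * kY) by exact: ler_pM.
have klip' : `|kX - kY| <= 8 * expR 8 * (2^-1 * D) * kY.
  apply: le_trans klip _; rewrite ler_wpM2r// ler_wpM2l//; exact: mulr_ge0.
have hB : `|S| * `|kX - kY| <= (2 * q) * (8 * expR 8 * (2^-1 * D) * kY).
  by apply: ler_pM.
have gX8 : `|gX| <= 8 * (expR 8 * kY).
  by apply: le_trans gXk _; rewrite ler_wpM2l.
have hC : `|p ^+ 2 - q ^+ 2| * `|gX| <= (2 * expR 2 * D * q) * (8 * (expR 8 * kY)).
  apply: ler_pM => //; rewrite subr_sqr normrM; apply: le_trans dlip.
  rewrite ler_piMr// ger0_norm; lra.
have glip' : `|gX - gY| <= d * (2^-1 * D) * kY.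
  by apply: le_trans glip _; rewrite ler_wpM2r// ler_wpM2l.
have hD : `|q ^+ 2| * `|gX - gY| <= (q * 2^-1) * (d * (2^-1 * D) * kY).
  by apply: ler_pM => //; rewrite normrX ger0_norm// expr2 ler_wpM2l.
rewrite (_ : _ - _ = (P - S) * kX + S * (kX - kY) + (p ^+ 2 - q ^+ 2) * gX +
  q ^+ 2 * (gX - gY)); last by ring.
have h1 : `|(P - S) * kX| <= (d2 * D * q) * (expR 8 * kY).
  by rewrite normrM (ger0_norm kX0).
have h2 : `|S * (kX - kY)| <= (2 * q) * (8 * expR 8 * (2^-1 * D) * kY).
  by rewrite normrM.
have h3 : `|(p ^+ 2 - q ^+ 2) * gX| <= (2 * expR 2 * D * q) * (8 * (expR 8 * kY)).
  by rewrite normrM.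
have h4 : `|q ^+ 2 * (gX - gY)| <= (q * 2^-1) * (d * (2^-1 * D) * kY).
  by rewrite normrM.
apply: le_trans (ler_normD _ _) _; apply: le_trans (lerD (ler_normD _ _) h4) _.
apply: le_trans (lerD (lerD (ler_normD _ _) h3) (lexx _)) _.
apply: le_trans (lerD (lerD (lerD h1 h2) (lexx _)) (lexx _)) _.
have hp : 0 <= expR 8 * (D * (q * kY)) by rewrite !mulr_ge0.
rewrite -subr_ge0 /d3h (_ : _ - _ = 8 * (expR 8 * (D * (q * kY)))); last by field.
by rewrite mulr_ge0.
Qed.

Lemma iter_lip2 j : lip2 (2 * d3h) (iter j Q jet_id).
Proof.
have h0 := d3h_ge0.
elim: j => [|j ih].
  move=> x y _ _ /=; rewrite subrr normr0 mulr1 mulr_ge0// mulr_ge0//.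
move=> x y x01 y01; rewrite iterS.
have h20 : 0 <= 2 * d3h by rewrite mulr_ge0.
apply: le_trans (Qj_lip2 h20 (iter_id_cone br j) ih x01 y01) _.
have jc := Qj_cone br (ler0n _ 8) (iter_id_cone br j).
rewrite ler_wpM2r ?(jc_ge0 jc)// ler_wpM2r//; lra.
Qed.

(** The bound holds for all iterates of Lebesgue measure with the same constant,
    and passes to the limit.  It replaces a third derivative of [invU], and is
    what the perturbation of the operator consumes. *)
Lemma invU_lip2 x y : 0 < x < 1 -> 0 < y < 1 ->
  `|jk1 (invU b b1 b2) x - jk1 (invU b b1 b2) y| <= 2 * d3h * CU * `|x - y|.
Proof.
move=> x01 y01; have [_ _ ck1] := invU_cvg br.
have h : `|jk1 (iter j Q jet_id) x - jk1 (iter j Q jet_id) y| @[j --> \oo] -->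
    `|jk1 (invU b b1 b2) x - jk1 (invU b b1 b2) y|.
  by apply: cvg_norm; apply: cvgB; exact: ck1.
apply: (ler_cvg_to h (cvg_cst _)); apply: nearW => j.
apply: le_trans (iter_lip2 j x01 y01) _.
rewrite mulrAC ler_wpM2r// ler_wpM2l ?mulr_ge0 ?d3h_ge0//.
apply: le_trans (ler_norm _) _; exact: jb_k (iter_id_bound br j) _ y01.
Qed.

(** [invU] is fixed, so subtracting the multiple of [invU] of the same mass
    leaves a jet of mass zero, to which [contraction] applies. *)
Lemma fix_unique C J j : jet_bound C J ->
  jet_bound (Bq * (C + `|jK J 1 - jK J 0| * CU) * rate ^+ j)
   (iter j Q (jet_lin 1 J (- (jK J 1 - jK J 0)) (invU b b1 b2))).
Proof.
move=> jb; apply: (contraction br); last first.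
  move: (invU_0 br) (invU_1 br).
  by move: (invU b b1 b2) => U /= -> ->; ring.
have := jet_bound_lin 1 (- (jK J 1 - jK J 0)) jb (invU_bound br).
by rewrite normr1 mul1r normrN.
Qed.

End System.
End Regularity.

(** * Perturbation of the invariant distribution function *)

Section Response.
Context {R : realType}.
Variables (Th : set R) (M : nat -> R) (d2 : R) (b b1 b2 : R -> nat -> R -> R).
Hypothesis br : forall t, Th t -> branches M d2 (b t) (b1 t) (b2 t).
Hypothesis lipb : forall s t n y, Th s -> Th t -> 0 <= y <= 1 ->
  `|b s n y - b t n y| <= `|s - t| * M n.
Hypothesis lipb1 : forall s t n y, Th s -> Th t -> 0 < y < 1 ->
  `|b1 s n y - b1 t n y| <= `|s - t| * M n.
Hypothesis lipb2 : forall s t n y, Th s -> Th t -> 0 < y < 1 ->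
  `|b2 s n y - b2 t n y| <= `|s - t| * M n.

Local Notation Q t := (Qj (b t) (b1 t) (b2 t)).
Local Notation U t := (invU (b t) (b1 t) (b2 t)).

(** The source term: the change of operator applied to the invariant measure. *)
Definition jE s t := jet_lin 1 (Q s (U s)) (-1) (Q t (U s)).

Definition CE : R := (4 * CU + 2 * d3h d2 * CU) * tsum M.

Lemma jet_lip1 C (J : @jet R) x y : jet_bound C J -> 0 < x < 1 -> 0 < y < 1 ->
  `|jk J x - jk J y| <= C * `|x - y|.
Proof.
by move=> jb x01 y01; apply: (MVT_bound (jb_d1 jb) (jb_k1 jb)).
Qed.

(** The constant is of first order in [s - t]: the branches and two of their
    derivatives are Lipschitz in the parameter, and the composition with the
    invariant density loses one derivative, which [invU_lip2] supplies. *)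
Lemma jE_bound s t : Th s -> Th t -> jet_bound (CE * `|s - t|) (jE s t).
Proof.
move=> hs ht; have bs := br hs; have bt := br ht; have sM := brM bs.
have ub := invU_bound bs; have uL := invU_lip2 bs.
have M0 n : 0 <= M n by case: sM.
have tM := tsumM_ge0 bs.
have CU0 := jet_bound_ge0 ub.
have d0 := d3h_ge0 bs.
have jb := jet_bound_lin 1 (-1) (Qj_bound bs ub) (Qj_bound bt ub).
have e (x y : R) : 1 * x + -1 * y = x - y by ring.
rewrite /jE; move: (U s) ub uL jb => u ub uL jb.
have fin (x : R) : 0 <= x <= 4 * CU + 2 * d3h d2 * CU ->
    (x * `|s - t|) * tsum M <= CE * `|s - t|.
  by move=> /andP[x0 xle]; rewrite /CE mulrAC ler_wpM2r// ler_wpM2r.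
apply: (jet_bound_improve jb) => y y01.
- rewrite [jk _ _]/= e -tsumB; last 2 first.
  + by apply: cvg_dom sM _ => n; exact: (Qk_term bs n ub).
  + by apply: cvg_dom sM _ => n; exact: (Qk_term bt n ub).
  apply: le_trans (fin (2 * CU) _); last first.
    by rewrite mulr_ge0//= -subr_ge0 addrAC -mulrBl addr_ge0 ?mulr_ge0//; lra.
  apply: tsum_norm => // n.
  have bsn := br_oo bs n y01; have btn := br_oo bt n y01.
  have y01' : 0 <= y <= 1 by lra.
  rewrite (_ : _ - _ = (b1 s n y - b1 t n y) * jk u (b s n y) +
     b1 t n y * (jk u (b s n y) - jk u (b t n y))); last by ring.
  apply: le_trans (ler_normD _ _) _; rewrite !normrM.
  have h1 : `|b1 s n y - b1 t n y| * `|jk u (b s n y)| <= (`|s - t| * M n) * CU.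
    by apply: ler_pM => //; [exact: lipb1|exact: jb_k ub _ bsn].
  have h2 : `|b1 t n y| * `|jk u (b s n y) - jk u (b t n y)| <=
      1 * (CU * (`|s - t| * M n)).
    apply: ler_pM => //.
      by rewrite ger0_norm ?(br_1ge0 bt)//; have := br_1half bt n y01; lra.
    apply: le_trans (jet_lip1 ub bsn btn) _; rewrite ler_wpM2l//; exact: lipb.
  apply: le_trans (lerD h1 h2) _; lra.
- rewrite [jk1 _ _]/= e -tsumB; last 2 first.
  + by apply: cvg_dom sM _ => n; exact: (Q1_term bs n ub).
  + by apply: cvg_dom sM _ => n; exact: (Q1_term bt n ub).
  apply: le_trans (fin (4 * CU + 2 * d3h d2 * CU) _); last first.
    by rewrite lexx andbT addr_ge0 ?mulr_ge0.
  apply: tsum_norm => // n.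
  have bsn := br_oo bs n y01; have btn := br_oo bt n y01.
  have y01' : 0 <= y <= 1 by lra.
  have hb := lipb n hs ht y01'; have hb1 := lipb1 n hs ht y01.
  have hb2 := lipb2 n hs ht y01.
  have s0 := br_1ge0 bs n y01; have sh := br_1half bs n y01.
  have t0 := br_1ge0 bt n y01; have th := br_1half bt n y01.
  have t2 := br_2le bt n y01.
  have us := jb_k ub bsn; have us1 := jb_k1 ub bsn.
  have ul := jet_lip1 ub bsn btn; have ul1 := uL _ _ bsn btn.
  move: bsn btn hb hb1 hb2 s0 sh t0 th t2 us us1 ul ul1.
  set X := b s n y; set Y := b t n y; set p := b1 s n y; set q := b1 t n y.
  set P := b2 s n y; set S := b2 t n y; set L := `|s - t| * M n.
  set k := jk u; set g := jk1 u.
  move=> Xo Yo hb hb1 hb2 p0 ph q0 qh Sq kX gX kXY gXY.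
  have L0 : 0 <= L by exact: mulr_ge0.
  have h1 : `|(P - S) * k X| <= L * CU by rewrite normrM; exact: ler_pM.
  have h2 : `|S * (k X - k Y)| <= 1 * (CU * L).
    rewrite normrM; apply: ler_pM => //; first by apply: le_trans Sq _; lra.
    by apply: le_trans kXY _; rewrite ler_wpM2l.
  have h3 : `|(p ^+ 2 - q ^+ 2) * g X| <= L * CU.
    rewrite normrM; apply: ler_pM => //; rewrite subr_sqr normrM.
    apply: le_trans hb1; rewrite ler_piMr// ger0_norm; lra.
  have h4 : `|q ^+ 2 * (g X - g Y)| <= 1 * (2 * d3h d2 * CU * L).
    rewrite normrM; apply: ler_pM => //.
      by rewrite normrX ger0_norm// exprn_ile1//; lra.
    by apply: le_trans gXY _; rewrite ler_wpM2l// !mulr_ge0.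
  rewrite (_ : _ - _ = (P - S) * k X + S * (k X - k Y) + (p ^+ 2 - q ^+ 2) * g X +
    q ^+ 2 * (g X - g Y)); last by ring.
  apply: le_trans (ler_normD _ _) _; apply: le_trans (lerD (ler_normD _ _) h4) _.
  apply: le_trans (lerD (lerD (ler_normD _ _) h3) (lexx _)) _.
  apply: le_trans (lerD (lerD (lerD h1 h2) (lexx _)) (lexx _)) _.
  rewrite -[_ * `|s - t| * M n]mulrA -/L.
  have := mulr_ge0 CU0 L0; lra.
Qed.

Lemma jE_mass s t : Th s -> Th t -> jK (jE s t) 1 - jK (jE s t) 0 = 0.
Proof.
move=> hs ht; have ub := invU_bound (br hs).
have := Qj_mass (br hs) ub; have := Qj_mass (br ht) ub.
rewrite /jE; move: (Q s _) (Q t _) => A B; rewrite /=; lra.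
Qed.

Definition jD s t := jet_lin 1 (U s) (-1) (U t).

Lemma jD_bound s t : Th s -> Th t -> jet_bound (2 * CU) (jD s t).
Proof.
move=> hs ht.
have -> : 2 * CU = `|1| * CU + `|-1| * CU :> R by rewrite normrN normr1; ring.
exact: jet_bound_lin (invU_bound (br hs)) (invU_bound (br ht)).
Qed.

Lemma jD_mass s t : Th s -> Th t -> jK (jD s t) 1 - jK (jD s t) 0 = 0.
Proof.
move=> hs ht; move: (invU_0 (br hs)) (invU_1 (br hs)) (invU_0 (br ht)) (invU_1 (br ht)).
rewrite /jD; move: (U s) (U t) => A B /= -> -> -> ->; ring.
Qed.

(** U_s - U_t = Q_t (U_s - U_t) + (Q_s - Q_t) U_s, as both are fixed. *)
Lemma jD_step s t : Th s -> Th t ->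
  jet_eq (jD s t) (jet_lin 1 (Q t (jD s t)) 1 (jE s t)).
Proof.
move=> hs ht; have us := invU_bound (br hs); have ut := invU_bound (br ht).
have h := Qj_lin (br ht) 1 (-1) us ut.
have fs := invU_fix (br hs); have ft := invU_fix (br ht).
split => y y01.
- move: (je_K h y01) (je_K fs y01) (je_K ft y01) => /= e1 e2 e3.
  by rewrite e1 e2 e3; ring.
- move: (je_k h y01) (je_k fs y01) (je_k ft y01) => /= e1 e2 e3.
  by rewrite e1 e2 e3; ring.
- move: (je_k1 h y01) (je_k1 fs y01) (je_k1 ft y01) => /= e1 e2 e3.
  by rewrite e1 e2 e3; ring.
Qed.

Lemma jD_iter s t j : Th s -> Th t -> jet_eq (iter j (Q t) (jD s t))
  (jet_lin 1 (iter j.+1 (Q t) (jD s t)) 1 (iter j (Q t) (jE s t))).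
Proof.
move=> hs ht; elim: j => [|j ih]; first exact: jD_step.
rewrite iterS; apply: jet_eq_trans (Qj_eq (br ht) ih) _.
have [C1 h1] := iterQ_bound (br ht) j.+1 (jD_bound hs ht).
have [C2 h2] := iterQ_bound (br ht) j (jE_bound hs ht).
exact: (Qj_lin (br ht) 1 1 h1 h2).
Qed.

Lemma jE_iter_bound s t j : Th s -> Th t ->
  jet_bound (Bq * (CE * `|s - t|) * rate ^+ j) (iter j (Q t) (jE s t)).
Proof.
by move=> hs ht; apply: (contraction (br ht)); [exact: jE_bound|exact: jE_mass].
Qed.

Lemma jE_K0 s t j : Th s -> Th t -> jK (iter j (Q t) (jE s t)) 0 = 0.
Proof.
move=> hs ht; case: j => [|j]; last by rewrite iterS /= QK_0.
by rewrite /= !QK_0; ring.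
Qed.

Lemma jK_le C (J : @jet R) y : jet_bound C J -> jK J 0 = 0 -> 0 <= y <= 1 ->
  `|jK J y| <= C.
Proof.
move=> jb J0 y01; have h0 : 0 <= (0 : R) <= 1 by rewrite lexx ler01.
have := jb_lip jb h0 y01; rewrite J0 !subr0 => /le_trans; apply.
by rewrite ler_piMr ?(jet_bound_ge0 jb)// ger0_norm; lra.
Qed.

Lemma jK_le_id C (J : @jet R) y : jet_bound C J -> jK J 0 = 0 -> 0 <= y <= 1 ->
  `|jK J y| <= C * y.
Proof.
move=> jb J0 y01; have h0 : 0 <= (0 : R) <= 1 by rewrite lexx ler01.
have := jb_lip jb h0 y01; rewrite J0 !subr0 => /le_trans; apply.
by rewrite ger0_norm; lra.
Qed.

Lemma rate_cvg0 C : C * rate ^+ j @[j --> \oo] --> (0 : R).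
Proof.
rewrite -[X in _ --> X](mulr0 C); apply: cvgMr.
have := cvg_series_cvg_0 (@rate_summable R).2; exact.
Qed.

(** Summing a recursion r_j = r_(j+1) + e_j, whose remainder tends to 0. *)
Lemma series_rem (a r e : nat -> R) C :
  (forall j, r j = r j.+1 + e j) -> (forall j, `|r j| <= C * rate ^+ j) ->
  (forall j, `|e j| <= C * rate ^+ j) -> r 0%N = tsum e.
Proof.
move=> rS rC eC.
have S j : series e j = r 0%N - r j.
  elim: j => [|j ih]; first by rewrite /series/= big_geq// subrr.
  rewrite /series/= big_nat_recr//= -[X in X + _]/(series e j) ih [r j]rS; ring.
have r0 : r j @[j --> \oo] --> (0 : R).
  apply/cvgrPdist_lt => ep ep0; have := rate_cvg0 C => /cvgrPdist_lt/(_ _ ep0).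
  apply: filterS => j; rewrite !sub0r !normrN => h.
  exact: le_lt_trans (rC j) (le_lt_trans (ler_norm _) h).
apply/esym/(cvg_lim _) => //.
rewrite (_ : series e = (fun j => r 0%N - r j)); last exact/funext.
rewrite -[X in _ --> X]subr0; apply: cvgB r0; exact: cvg_cst.
Qed.

Lemma jD_K0 s t : Th s -> Th t -> jK (jD s t) 0 = 0.
Proof.
move=> hs ht; move: (invU_0 (br hs)) (invU_0 (br ht)).
by rewrite /jD; move: (U s) (U t) => A B /= -> ->; ring.
Qed.

Lemma jD_iter_K0 s t j : Th s -> Th t -> jK (iter j (Q t) (jD s t)) 0 = 0.
Proof.
move=> hs ht; case: j => [|j]; last by rewrite iterS /= QK_0.
exact: jD_K0.
Qed.

Let big (s t : R) : R := Bq * (2 * CU) + Bq * (CE * `|s - t|).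

Let bD s t j (hs : Th s) (ht : Th t) :=
  contraction (br ht) j (jD_bound hs ht) (jD_mass hs ht).

Lemma big_le s t j (x : R) : Th s -> Th t ->
  x <= Bq * (2 * CU) * rate ^+ j \/ x <= Bq * (CE * `|s - t|) * rate ^+ j ->
  x <= big s t * rate ^+ j.
Proof.
move=> hs ht; have r0 : 0 <= (rate : R) ^+ j by rewrite exprn_ge0 ?rate_ge0.
have B0 : 0 <= Bq :> R by rewrite /Bq mulr_ge0 ?expR_ge0.
have h1 : 0 <= Bq * (2 * CU) * (rate : R) ^+ j.
  by rewrite !mulr_ge0//; exact: (jet_bound_ge0 (invU_bound (br hs))).
have h2 : 0 <= Bq * (CE * `|s - t|) * rate ^+ j.
  by rewrite mulr_ge0// mulr_ge0//; exact: (jet_bound_ge0 (jE_bound hs ht)).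
by rewrite /big mulrDl => -[] h; apply: le_trans h _; lra.
Qed.

(** The resolvent identity: [jD_step] iterated, the remainder
    Q_t^j (U_s - U_t) being exponentially small by [contraction]. *)
Lemma jD_sumK s t y : Th s -> Th t -> 0 <= y <= 1 ->
  jK (jD s t) y = tsum (fun j => jK (iter j (Q t) (jE s t)) y).
Proof.
move=> hs ht y01.
apply: (@series_rem (fun=> 0) (fun j => jK (iter j (Q t) (jD s t)) y) _ (big s t)) => j.
- by rewrite (je_K (jD_iter j hs ht) y01) /=; ring.
- apply: big_le => //; left.
  exact: (jK_le (bD _ hs ht) (jD_iter_K0 j hs ht)).
- apply: big_le => //; right.
  exact: (jK_le (jE_iter_bound _ hs ht) (jE_K0 j hs ht)).
Qed.

Lemma jD_sumk s t y : Th s -> Th t -> 0 < y < 1 ->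
  jk (jD s t) y = tsum (fun j => jk (iter j (Q t) (jE s t)) y).
Proof.
move=> hs ht y01.
apply: (@series_rem (fun=> 0) (fun j => jk (iter j (Q t) (jD s t)) y) _ (big s t)) => j.
- by rewrite (je_k (jD_iter j hs ht) y01) /=; ring.
- by apply: big_le => //; left; exact: (jb_k (bD _ hs ht)).
- by apply: big_le => //; right; exact: (jb_k (jE_iter_bound _ hs ht)).
Qed.

Definition CD : R := Bq * CE * tsum (fun j => rate ^+ j).

Lemma jD_k s t y : Th s -> Th t -> 0 < y < 1 ->
  `|jk (jD s t) y| <= CD * `|s - t|.
Proof.
move=> hs ht y01; rewrite jD_sumk//.
apply: le_trans (tsum_norm rate_summable
  (fun j => jb_k (jE_iter_bound j hs ht) y01)) _.
by rewrite /CD mulrA -mulrA [_ * tsum _]mulrC mulrA.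
Qed.

Lemma jD_lip s t x y : Th s -> Th t -> 0 <= x <= 1 -> 0 <= y <= 1 ->
  `|jK (jD s t) y - jK (jD s t) x| <= CD * `|s - t| * `|y - x|.
Proof.
move=> hs ht x01 y01; apply: (lip_of_k (jD_bound hs ht)) => // z z01.
exact: jD_k.
Qed.

End Response.

(** * Linear response along pairs of parameter sequences *)

Section SeqResponse.
Context {R : realType}.
Variables (Th : set R) (M : nat -> R) (d2 : R) (b b1 b2 : R -> nat -> R -> R).
Hypothesis br : forall t, Th t -> branches M d2 (b t) (b1 t) (b2 t).
Hypothesis lipb : forall s t n y, Th s -> Th t -> 0 <= y <= 1 ->
  `|b s n y - b t n y| <= `|s - t| * M n.
Hypothesis lipb1 : forall s t n y, Th s -> Th t -> 0 < y < 1 ->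
  `|b1 s n y - b1 t n y| <= `|s - t| * M n.
Hypothesis lipb2 : forall s t n y, Th s -> Th t -> 0 < y < 1 ->
  `|b2 s n y - b2 t n y| <= `|s - t| * M n.

Local Notation Q t := (Qj (b t) (b1 t) (b2 t)).
Local Notation U t := (invU (b t) (b1 t) (b2 t)).
Local Notation E s t := (jE b b1 b2 s t).
Local Notation D s t := (jD b b1 b2 s t).

Variables (al : R) (be ga : nat -> R).
Hypotheses (hal : Th al) (hbe : forall m, Th (be m)) (hga : forall m, Th (ga m)).
Hypotheses (cbe : be m @[m --> \oo] --> al) (cga : ga m @[m --> \oo] --> al).
Hypothesis bega : forall m, be m != ga m.

Lemma squeeze0 (u v : nat -> R) (l : R) : (forall m, `|u m - l| <= v m) ->
  v m @[m --> \oo] --> (0 : R) -> u m @[m --> \oo] --> l.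
Proof.
move=> uv v0; apply/cvgrPdist_lt => e e0; move/cvgrPdist_lt : v0 => /(_ _ e0).
apply: filterS => m; rewrite sub0r normrN => h; rewrite distrC.
exact: le_lt_trans (uv m) (le_lt_trans (ler_norm _) h).
Qed.

Lemma cvg_dist0 (u : nat -> R) (l : R) C : u m @[m --> \oo] --> l ->
  C * `|u m - l| @[m --> \oo] --> (0 : R).
Proof.
move=> ul; have : C * `|u m - l| @[m --> \oo] --> C * `|l - l|.
  by apply: cvgMr; apply: cvg_norm; apply: cvgB => //; exact: cvg_cst.
by rewrite subrr normr0 mulr0.
Qed.

Lemma b_cvg (se : nat -> R) n y : (forall m, Th (se m)) -> se m @[m --> \oo] --> al ->
  0 <= y <= 1 -> b (se m) n y @[m --> \oo] --> b al n y.
Proof.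
move=> hse cse y01; apply: (squeeze0 (v := fun m => M n * `|se m - al|)).
  by move=> m; rewrite mulrC; exact: lipb.
exact: cvg_dist0.
Qed.

Let CD' : R := CD M d2.

(** The density of U_be converges pointwise by [jD_k], and the densities are
    equi-Lipschitz, which allows the argument to move. *)
Lemma u_cvg (x : nat -> R) (l : R) : (forall m, 0 < x m < 1) -> 0 < l < 1 ->
  x m @[m --> \oo] --> l ->
  jk (U (be m)) (x m) @[m --> \oo] --> jk (U al) l.
Proof.
move=> x01 l01 xl.
apply: (squeeze0 (v := fun m => CD' * `|be m - al| + CU * `|x m - l|)).
  move=> m; rewrite (_ : _ - _ = jk (D (be m) al) (x m) +
    (jk (U al) (x m) - jk (U al) l)); last by rewrite /jD [jk (jet_lin _ _ _ _) _]/jk/=; ring.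
  apply: le_trans (ler_normD _ _) _; apply: lerD.
    exact: (jD_k br lipb lipb1 lipb2).
  exact: (jet_lip1 (invU_bound (br hal))).
by rewrite -[X in _ --> X]addr0; apply: cvgD; exact: cvg_dist0.
Qed.

Lemma MVT_between (f df : R -> R) (x y : R) :
  (forall z, Num.min x y <= z <= Num.max x y -> is_derive z 1 f (df z)) ->
  exists z, [/\ Num.min x y <= z <= Num.max x y, `|z - y| <= `|x - y| &
    f x - f y = df z * (x - y)].
Proof.
move=> fd; have [xy|yx] := leP x y.
- rewrite min_l// max_r// in fd *.
  have [z||z zxy h] := @MVT_segment _ f df x y xy.
  + by rewrite in_itv/= => /andP[xz zy]; apply: fd; rewrite !ltW.
  + apply: derivable_within_continuous => z; rewrite in_itv/= => zxy.
    by have := fd z zxy; case.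
  move: zxy; rewrite in_itv/= => zxy; have /andP[xz zy] := zxy; exists z; split => //.
  + by rewrite !ler0_norm ?subr_le0// lerN2 lerD2r.
  + by rewrite -[LHS]opprB h; ring.
- rewrite min_r ?ltW// max_l ?ltW// in fd *.
  have [z||z zxy h] := @MVT_segment _ f df y x (ltW yx).
  + by rewrite in_itv/= => /andP[xz zy]; apply: fd; rewrite !ltW.
  + apply: derivable_within_continuous => z; rewrite in_itv/= => zxy.
    by have := fd z zxy; case.
  move: zxy; rewrite in_itv/= => zxy; have /andP[xz zy] := zxy; exists z; split => //.
  by rewrite !ger0_norm ?subr_ge0 ?lerD2r// ltW.
Qed.

(** Chain rule along a point x_t that moves with the parameter.  The
    alternative covers points that may sit at an end point of the interval,
    where the density is not controlled: such points do not move. *)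
Lemma U_quot (x : R -> R) dx :
  (forall t, Th t -> 0 < x t < 1) \/ (forall s t, Th s -> Th t -> x s = x t) ->
  x (be m) @[m --> \oo] --> x al -> x (ga m) @[m --> \oo] --> x al ->
  (x (be m) - x (ga m)) / (be m - ga m) @[m --> \oo] --> dx ->
  (jK (U (be m)) (x (be m)) - jK (U (be m)) (x (ga m))) / (be m - ga m)
    @[m --> \oo] --> jk (U al) (x al) * dx.
Proof.
move=> [x01|xc] xbe xga xd; last first.
  have xd0 : (x (be m) - x (ga m)) / (be m - ga m) @[m --> \oo] --> (0 : R).
    rewrite (_ : (fun m => _) = (fun=> 0)); first exact: cvg_cst.
    by apply/funext => m; rewrite (xc _ _ (hbe m) (hga m)) subrr mul0r.
  have -> : dx = 0 by exact: (cvg_unique _ xd xd0).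
  rewrite mulr0 (_ : (fun m => _) = (fun=> 0)); first exact: cvg_cst.
  by apply/funext => m; rewrite (xc _ _ (hbe m) (hga m)) subrr mul0r.
have /choice[z hz] : forall m, exists z, [/\ 0 < z < 1,
    `|z - x (ga m)| <= `|x (be m) - x (ga m)| &
    jK (U (be m)) (x (be m)) - jK (U (be m)) (x (ga m)) =
    jk (U (be m)) z * (x (be m) - x (ga m))].
  move=> m; have /andP[p1 p2] := x01 _ (hbe m); have /andP[p3 p4] := x01 _ (hga m).
  have in01 z : Num.min (x (be m)) (x (ga m)) <= z <= Num.max (x (be m)) (x (ga m)) ->
      0 < z < 1.
    move=> /andP[h1 h2]; apply/andP; split.
      by apply: lt_le_trans h1; rewrite lt_min p1 p3.
    by apply: le_lt_trans h2 _; rewrite gt_max p2 p4.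
  (* a mean value point between the two, so interior when they are *)
  have [z hz|z [z1 z2 z3]] := @MVT_between (jK (U (be m))) (jk (U (be m)))
      (x (be m)) (x (ga m)).
    exact: jb_d (invU_bound (br (hbe m))) _ (in01 z hz).
  by exists z; split => //; exact: in01.
have zal : z m @[m --> \oo] --> x al.
  apply: (squeeze0 (v := fun m => 1 * `|x (be m) - x al| + 2 * `|x (ga m) - x al|)).
    move=> m; have [_ h _] := hz m.
    have := ler_distD (x (ga m)) (z m) (x al).
    have := ler_distD (x al) (x (be m)) (x (ga m)).
    by rewrite (distrC (x al) (x (ga m))); lra.
  by rewrite -[X in _ --> X]addr0; apply: cvgD; exact: cvg_dist0.
rewrite (_ : (fun m => _) = (fun m => jk (U (be m)) (z m) *
  ((x (be m) - x (ga m)) / (be m - ga m)))); last first.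
  by apply/funext => m; have [_ _ ->] := hz m; rewrite mulrA.
apply: cvgM xd; apply: u_cvg zal; last exact: x01.
by move=> m; have [] := hz m.
Qed.

Lemma U_quot_le (x : R -> R) (C : R) m : (forall t, Th t -> 0 <= x t <= 1) ->
  (forall s t, Th s -> Th t -> `|x s - x t| <= `|s - t| * C) ->
  `|(jK (U (be m)) (x (be m)) - jK (U (be m)) (x (ga m))) / (be m - ga m)|
    <= CU * C.
Proof.
move=> x01 xC; rewrite normrM normfV ler_pdivrMr ?normr_gt0 ?subr_eq0//.
have ub := invU_bound (br (hbe m)).
apply: le_trans (jb_lip ub (x01 _ (hga m)) (x01 _ (hbe m))) _.
rewrite -(mulrA _ C) ler_wpM2l ?(jet_bound_ge0 ub)// mulrC; exact: xC.
Qed.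

Variable db : nat -> R -> R.
Hypothesis db_cvg : forall n y, 0 <= y <= 1 ->
  (b (be m) n y - b (ga m) n y) / (be m - ga m) @[m --> \oo] --> db n y.
Hypothesis b_int : forall n y, 0 <= y <= 1 -> (forall t, Th t -> 0 < b t n y < 1) \/
  (forall s t, Th s -> Th t -> b s n y = b t n y).

(** The derivative in the parameter of [QK (b t) U], for a fixed [U]. *)
Definition Fresp (y : R) : R := tsum (fun n =>
  jk (U al) (b al n y) * db n y - jk (U al) (b al n 0) * db n 0).

(** The derivative of [invU] in the parameter: (1 - Q)^(-1) [Fresp]. *)
Definition dU (y : R) : R := tsum (fun i => iter i (QK (b al)) Fresp y).

Let h0 : 0 <= (0 : R) <= 1. Proof. by rewrite lexx ler01. Qed.
Let sM : summable_ge0 M := brM (br hal).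

(** Dominated convergence over the branches; each term is the chain rule
    [U_quot] along t |-> b_t,n(y). *)
Lemma E_cvg y : 0 <= y <= 1 ->
  jK (E (be m) (ga m)) y / (be m - ga m) @[m --> \oo] --> Fresp y.
Proof.
move=> y01.
pose q m n z := (jK (U (be m)) (b (be m) n z) - jK (U (be m)) (b (ga m) n z)) /
  (be m - ga m).
have qle m n z : 0 <= z <= 1 -> `|q m n z| <= CU * M n.
  move=> z01; apply: (@U_quot_le (fun t => b t n z)) => [t ht|s t hs ht].
    exact: (br_cc (br ht)).
  exact: lipb.
have [|n|_] := @tannery R _ \oo _ (fun m n => q m n y - q m n 0)
   (fun n => jk (U al) (b al n y) * db n y - jk (U al) (b al n 0) * db n 0)
   M (2 * CU) sM.
- apply: nearW => m n; apply: le_trans (ler_normB _ _) _.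
  by have := qle m n y y01; have := qle m n 0 h0; lra.
- by apply: cvgB; apply: (@U_quot (fun t => b t n _)) => //; try exact: b_int;
    try exact: b_cvg; exact: db_cvg.
apply: cvg_trans; apply: near_eq_cvg; apply: nearW => m.
have ub := invU_bound (br (hbe m)).
rewrite /q.
have c1 : cvgn (series (fun n => jK (U (be m)) (b (be m) n y) - jK (U (be m)) (b (be m) n 0))).
  by apply: cvg_dom sM _ => n; apply: (QK_term (br (hbe m))) y01; exact: jb_lip ub.
have c2 : cvgn (series (fun n => jK (U (be m)) (b (ga m) n y) - jK (U (be m)) (b (ga m) n 0))).
  by apply: cvg_dom sM _ => n; apply: (QK_term (br (hga m))) y01; exact: jb_lip ub.
have -> : jK (E (be m) (ga m)) y = QK (b (be m)) (jK (U (be m))) y -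
    QK (b (ga m)) (jK (U (be m))) y.
  by rewrite /jE [jK (jet_lin _ _ _ _) _]/jK/=; ring.
rewrite /QK -tsumB// mulrC -tsumZ; last exact: (@is_cvg_seriesB R).
by congr tsum; apply/funext => n; ring.
Qed.

Lemma QK_seq_cvg C (fm : nat -> R -> R) (f : R -> R) y :
  (forall m x z, 0 <= x <= 1 -> 0 <= z <= 1 -> `|fm m z - fm m x| <= C * `|z - x|) ->
  (forall z, 0 <= z <= 1 -> fm m z @[m --> \oo] --> f z) -> 0 <= y <= 1 ->
  QK (b (ga m)) (fm m) y @[m --> \oo] --> QK (b al) f y.
Proof.
move=> fC fc y01; have [|n|_ //] := @tannery R _ \oo _
  (fun m n => fm m (b (ga m) n y) - fm m (b (ga m) n 0))
  (fun n => f (b al n y) - f (b al n 0)) M C sM.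
  by apply: nearW => m n; apply: (QK_term (br (hga m))) => // x z; exact: fC.
have key z : 0 <= z <= 1 -> fm m (b (ga m) n z) @[m --> \oo] --> f (b al n z).
  move=> z01; have zz := br_cc (br hal) n z01.
  apply: (squeeze0 (v := fun m => C * `|b (ga m) n z - b al n z| +
     1 * `|fm m (b al n z) - f (b al n z)|)).
    move=> m; apply: le_trans (ler_distD (fm m (b al n z)) _ _) _.
    rewrite mul1r lerD2r; apply: fC => //; exact: (br_cc (br (hga m))).
  rewrite -[X in _ --> X]addr0; apply: cvgD; apply: cvg_dist0; last exact: fc.
  exact: b_cvg.
by apply: cvgB; exact: key.
Qed.

(** The operators are those of the moving parameter [ga m]; they converge
    pointwise on equi-Lipschitz sequences. *)
Lemma E_iter_cvg i y : 0 <= y <= 1 ->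
  jK (iter i (Q (ga m)) (E (be m) (ga m))) y / (be m - ga m) @[m --> \oo] -->
  iter i (QK (b al)) Fresp y.
Proof.
elim: i y => [|i ih] y y01; first exact: E_cvg.
have jb m := jE_iter_bound br lipb lipb1 lipb2 i (hbe m) (hga m).
have nz m : be m - ga m != 0 by rewrite subr_eq0.
rewrite iterS; have := @QK_seq_cvg (Bq * CE M d2 * rate ^+ i) _ _ y _ ih y01.
have h : forall m x z, 0 <= x <= 1 -> 0 <= z <= 1 ->
   `|jK (iter i (Q (ga m)) (E (be m) (ga m))) z / (be m - ga m) -
     jK (iter i (Q (ga m)) (E (be m) (ga m))) x / (be m - ga m)| <=
   Bq * CE M d2 * rate ^+ i * `|z - x|.
  move=> m x z x01 z01; rewrite -mulrBl normrM normfV.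
  rewrite ler_pdivrMr ?normr_gt0//; apply: le_trans (jb_lip (jb m) x01 z01) _.
  by rewrite le_eqVlt; apply/orP; left; apply/eqP; ring.
move=> /(_ h); apply: cvg_trans; apply: near_eq_cvg; apply: nearW => m.
rewrite iterS /= /QK mulrC -tsumZ.
  by congr tsum; apply/funext => n; ring.
by apply: cvg_dom sM _ => n; apply: (QK_term (br (hga m))) y01; exact: jb_lip (jb m).
Qed.

(** Divide the resolvent identity [jD_sumK] by the increment of the parameter:
    the terms converge by [E_iter_cvg] and are dominated by a geometric series. *)
Lemma U_response y : 0 <= y <= 1 ->
  jK (D (be m) (ga m)) y / (be m - ga m) @[m --> \oo] --> dU y.
Proof.
move=> y01; have nz m : be m - ga m != 0 by rewrite subr_eq0.
have jb m i := jE_iter_bound br lipb lipb1 lipb2 i (hbe m) (hga m).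
have eb m i := jK_le (jb m i) (jE_K0 b b1 b2 i (hbe m) (hga m)) y01.
have [|i|_] := @tannery R _ \oo _
  (fun m i => jK (iter i (Q (ga m)) (E (be m) (ga m))) y / (be m - ga m))
  (fun i => iter i (QK (b al)) Fresp y) (fun i => rate ^+ i) (Bq * CE M d2) rate_summable.
- apply: nearW => m i; rewrite normrM normfV ler_pdivrMr ?normr_gt0//.
  apply: le_trans (eb m i) _.
  by rewrite le_eqVlt; apply/orP; left; apply/eqP; ring.
- exact: E_iter_cvg.
apply: cvg_trans; apply: near_eq_cvg; apply: nearW => m.
rewrite (jD_sumK br lipb lipb1 lipb2)// mulrC -tsumZ.
  by congr tsum; apply/funext => i; rewrite mulrC.
by apply: cvg_dom rate_summable _ => i; exact: (eb m i).
Qed.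

Variables (g : R -> nat -> R) (dg : nat -> R).
Hypothesis g01 : forall t n, Th t -> 0 <= g t n <= 1.
Hypothesis gM : forall t n, Th t -> g t n <= M n.
Hypothesis glip : forall s t n, Th s -> Th t -> `|g s n - g t n| <= `|s - t| * M n.
Hypothesis g_int : forall n, (forall t, Th t -> 0 < g t n < 1) \/
  (forall s t, Th s -> Th t -> g s n = g t n).
Hypothesis g_cvg : forall n,
  (g (be m) n - g (ga m) n) / (be m - ga m) @[m --> \oo] --> dg n.

(** With [g t n] the preimages of a point under the left branch, this is up to
    a constant factor the distribution function of the invariant measure of
    the original map. *)
Definition Hsum t := tsum (fun n => jK (U t) (g t n)).

Lemma Hsum_cvgn t : Th t -> cvgn (series (fun n => jK (U t) (g t n))).
Proof.
move=> ht; have ub := invU_bound (br ht); apply: (cvg_dom (C := CU) sM) => n.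
apply: le_trans (jK_le_id ub (invU_0 (br ht)) (g01 n ht)) _.
by rewrite ler_wpM2l ?(jet_bound_ge0 ub)// gM.
Qed.

Definition dH : R := tsum (fun n => jk (U al) (g al n) * dg n + dU (g al n)).

Definition CH : R := CU + CD'.

Let g_al (se : nat -> R) n : (forall m, Th (se m)) -> se m @[m --> \oo] --> al ->
  g (se m) n @[m --> \oo] --> g al n.
Proof.
move=> hse cse; apply: (squeeze0 (v := fun m => M n * `|se m - al|)).
  by move=> m; rewrite mulrC; exact: glip.
exact: cvg_dist0.
Qed.

(** Each increment splits into the motion of the point, treated by [U_quot], and
    the change of U at a fixed point, treated by [U_response]; both are
    dominated by [M]. *)
Lemma Hsum_response :
  (Hsum (be m) - Hsum (ga m)) / (be m - ga m) @[m --> \oo] --> dH.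
Proof.
have nz m : be m - ga m != 0 by rewrite subr_eq0.
have [|n|_] := @tannery R _ \oo _
  (fun m n => (jK (U (be m)) (g (be m) n) - jK (U (be m)) (g (ga m) n)) / (be m - ga m) +
     jK (D (be m) (ga m)) (g (ga m) n) / (be m - ga m))
  (fun n => jk (U al) (g al n) * dg n + dU (g al n)) M CH sM.
- apply: nearW => m n; apply: le_trans (ler_normD _ _) _; rewrite /CH [leRHS]mulrDl; apply: lerD.
    by apply: (@U_quot_le (fun t => g t n)) => [t ht|s t hs ht]; [exact: g01|exact: glip].
  rewrite normrM normfV ler_pdivrMr ?normr_gt0//.
  have := jD_lip br lipb lipb1 lipb2 (hbe m) (hga m) h0 (g01 n (hga m)).
  rewrite (jD_K0 br)// !subr0 (ger0_norm (proj1 (andP (g01 n (hga m))))).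
  move/le_trans; apply; rewrite -/CD' -!(mulrA CD').
  have C0 : 0 <= CD'.
    have h2 : 0 < (2^-1 : R) < 1 by lra.
    have := jD_k br lipb lipb1 lipb2 (hbe m) (hga m) h2 => /(le_trans (normr_ge0 _)).
    by rewrite pmulr_lge0 ?normr_gt0.
  by rewrite ler_wpM2l// mulrC ler_wpM2r// gM.
- apply: cvgD.
    by apply: (@U_quot (fun t => g t n)) => //; exact: g_al.
  apply: (squeeze0 (v := fun m => CD' * `|g (ga m) n - g al n| +
     1 * `|jK (D (be m) (ga m)) (g al n) / (be m - ga m) - dU (g al n)|)).
    move=> m; apply: le_trans (ler_distD (jK (D (be m) (ga m)) (g al n) / (be m - ga m)) _ _) _.
    rewrite mul1r lerD2r -mulrBl normrM normfV ler_pdivrMr ?normr_gt0//.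
    have := jD_lip br lipb lipb1 lipb2 (hbe m) (hga m) (g01 n hal) (g01 n (hga m)).
    by move/le_trans; apply; rewrite mulrAC.
  rewrite -[X in _ --> X]addr0; apply: cvgD; apply: cvg_dist0; first exact: g_al.
  by apply: U_response; exact: g01.
apply: cvg_trans; apply: near_eq_cvg; apply: nearW => m.
have cb := Hsum_cvgn (hbe m); have cg := Hsum_cvgn (hga m).
rewrite /Hsum -tsumB// mulrC -tsumZ; last exact: (@is_cvg_seriesB R).
congr tsum; apply/funext => n.
have -> : jK (D (be m) (ga m)) (g (ga m) n) = jK (U (be m)) (g (ga m) n) -
   jK (U (ga m)) (g (ga m) n) by rewrite /jD [jK (jet_lin _ _ _ _) _]/jK/=; ring.
ring.
Qed.

Lemma Hsum_lip s t : Th s -> Th t -> `|Hsum s - Hsum t| <= CH * `|s - t| * tsum M.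
Proof.
move=> hs ht; have cs := Hsum_cvgn hs; have ct := Hsum_cvgn ht.
have us := invU_bound (br hs).
rewrite /Hsum -tsumB//; apply: tsum_norm => // n.
rewrite (_ : _ - _ = (jK (U s) (g s n) - jK (U s) (g t n)) + jK (D s t) (g t n));
  last by rewrite /jD [jK (jet_lin _ _ _ _) _]/jK/=; ring.
apply: le_trans (ler_normD _ _) _; rewrite /CH mulrDl mulrDl; apply: lerD.
  apply: le_trans (jb_lip us (g01 n ht) (g01 n hs)) _.
  by rewrite -mulrA ler_wpM2l ?(jet_bound_ge0 us)// glip.
have := jD_lip br lipb lipb1 lipb2 hs ht h0 (g01 n ht).
rewrite (jD_K0 br)// !subr0 (ger0_norm (proj1 (andP (g01 n ht)))).
move/le_trans; apply; rewrite ler_wpM2l ?gM//.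
have h2 : 0 < (2^-1 : R) < 1 by lra.
exact: le_trans (normr_ge0 _) (jD_k br lipb lipb1 lipb2 hs ht h2).
Qed.

End SeqResponse.

(** * The left branch in logarithmic coordinates *)

(** The logistic function of [- w]. *)
HB.lock Definition sg {R : realType} (w : R) : R := (1 + expR w)^-1.
HB.lock Definition lg {R : realType} (w : R) : R := ln (1 + expR (- w)).

(** The left branch of the map in the coordinate x = exp(- z) / 2 on
    ]0, 1/2]. *)
Definition tau {R : realType} (t z : R) : R := z - lg (t * z).

(** The inverse of [tau t].  It is chosen by [xget], as [tau t] is an increasing
    bijection of the whole line for t >= 0. *)
HB.lock Definition gam {R : realType} (t z : R) : R :=
  xget 0 [set x | tau t x = z].

Section LogCoordinate.
Context {R : realType}.
Implicit Types (t w x y z : R).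

Let sgE w : sg w = (1 + expR w)^-1 :> R. Proof. by rewrite sg.unlock. Qed.
Let lgE w : lg w = ln (1 + expR (- w)) :> R. Proof. by rewrite lg.unlock. Qed.

Lemma sg_gt0 w : 0 < sg w.
Proof. by rewrite sgE invr_gt0 addr_gt0 ?expR_gt0. Qed.

Lemma sg_lt1 w : sg w < 1.
Proof. by rewrite sgE invf_lt1 ?addr_gt0 ?expR_gt0// ltrDl expR_gt0. Qed.

Lemma lg_gt0 w : 0 < lg w.
Proof. by rewrite lgE; apply: ln_gt0; rewrite ltrDl expR_gt0. Qed.

Lemma lg0 : lg (0 : R) = ln 2.
Proof. by rewrite lgE oppr0 expR0. Qed.

Lemma sg_le_lg w : sg w <= lg w.
Proof.
have e0 := expR_gt0 w.
have h : ln (1 + - sg w) <= - sg w by apply: le_ln1Dx; have := sg_lt1 w; lra.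
suff : ln (1 + - sg w) = - lg w by lra.
rewrite lgE -lnV ?posrE ?addr_gt0 ?expR_gt0//; congr ln.
rewrite sgE expRN; field; rewrite !lt0r_neq0//; lra.
Qed.

Lemma is_derive_lg w : is_derive w 1 lg (- sg w).
Proof.
have e0 := expR_gt0 (- w); have h : 0 < 1 + expR (- w) by lra.
have d1 : is_derive w 1 (fun w : R => 1 + expR (- w)) (- expR (- w)).
  by apply: is_derive_eq; rewrite /GRing.scale/=; ring.
have d2 := is_derive1_ln h.
have := @is_derive1_comp R (@ln R) (fun w => 1 + expR (- w)) w _ _ d2 d1.
rewrite /comp (_ : _ * _ = - sg w); first by rewrite lg.unlock.
rewrite sgE expRN; have := expR_gt0 w => ew; field; rewrite !lt0r_neq0//; lra.
Qed.

Lemma is_derive_sg w : is_derive w 1 sg (- (sg w * (1 - sg w))).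
Proof.
have e0 := expR_gt0 w; have h : 1 + expR w != 0 by rewrite lt0r_neq0//; lra.
have d1 : is_derive w 1 (fun w : R => 1 + expR w) (expR w).
  by apply: is_derive_eq; rewrite /GRing.scale/=; ring.
have h' := @is_deriveV R (fun w : R => 1 + expR w) w _ 1 h d1.
rewrite sgE [X in is_derive _ _ X](_ : _ = (fun w => (1 + expR w)^-1)); last by rewrite sg.unlock.
apply: (is_derive_eq h').
by rewrite /GRing.scale/=; field.
Qed.

Lemma lg_decr w w' : w <= w' -> lg w' <= lg w.
Proof.
move=> ww'; rewrite !lgE ler_ln ?posrE ?addr_gt0 ?expR_gt0//.
by rewrite lerD2l ler_expR lerN2.
Qed.

Lemma sg_decr w w' : w <= w' -> sg w' <= sg w.
Proof.
move=> ww'; rewrite !sgE lef_pV2 ?posrE ?addr_gt0 ?expR_gt0//.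
by rewrite lerD2l ler_expR.
Qed.

Lemma sg_diff w w' : w <= w' -> sg w - sg w' <= sg w * (w' - w).
Proof.
move=> ww'; have h1 := expR_ge1Dx (- (w' - w)).
have e1 := expR_gt0 w; have s0 := sg_gt0 w.
suff : sg w * expR (- (w' - w)) <= sg w'.
  by have := ler_wpM2l (ltW s0) h1; lra.
rewrite !sgE mulrC ler_pdivrMr ?addr_gt0 ?expR_gt0// mulrC ler_pdivlMr ?addr_gt0 ?expR_gt0//.
rewrite mulrDr mulr1 -expRD (_ : - (w' - w) + w' = w); last by ring.
by rewrite lerD2r -expR0 ler_expR; lra.
Qed.

Lemma sg_lim (u : nat -> R) w : u n @[n --> \oo] --> w ->
  sg (u n) @[n --> \oo] --> sg w.
Proof.
move=> uw; apply: (continuous_cvg _ _ uw).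
have [h _] := is_derive_sg w.
by apply: differentiable_continuous; apply/derivable1_diffP.
Qed.

Lemma is_derive_tau t z : is_derive z 1 (tau t) (1 + t * sg (t * z)).
Proof.
have d1 : is_derive z 1 (fun z => t * z) t.
  by apply: is_derive_eq; rewrite /GRing.scale/=; ring.
have d2 := is_derive_lg (t * z).
have d3 := @is_derive1_comp R lg (fun z => t * z) z _ _ d2 d1.
rewrite /comp in d3.
apply: is_derive_eq; rewrite /GRing.scale/=; ring.
Qed.

Lemma tau_cont t : continuous (tau t).
Proof.
move=> z; have [h _] := is_derive_tau t z.
by apply: differentiable_continuous; apply/derivable1_diffP.
Qed.

Lemma tau_lt t x y : 0 <= t -> x < y -> tau t x < tau t y.
Proof.
move=> t0 xy; apply: ltr_leB => //; apply: lg_decr.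
by apply: ler_wpM2l => //; exact: ltW.
Qed.

Lemma tau_le_iff t x y : 0 <= t -> (tau t x <= tau t y) = (x <= y).
Proof.
move=> t0; case: (leP x y) => [|yx]; last by rewrite leNgt tau_lt.
by rewrite le_eqVlt => /orP[/eqP -> |/(tau_lt t0)/ltW//]; rewrite lexx.
Qed.

Lemma ln2_le1 : ln 2 <= 1 :> R.
Proof.
have := @le_ln1Dx R 1; rewrite -[1 + 1]/(2%:R : R); apply; lra.
Qed.

Lemma gamK t z : 0 <= t -> tau t (gam t z) = z.
Proof.
move=> t0; rewrite gam.unlock; case: xgetP => [x _ //|]; move=> h; exfalso.
have nz := ler_norm z; have nz0 := normr_ge0 z.
have tl : tau t z <= z by rewrite /tau; have := lg_gt0 (t * z); lra.
have tr : z <= tau t (`|z| + 2).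
  have h1 : lg (t * (`|z| + 2)) <= ln 2.
    by rewrite -lg0; apply: lg_decr; rewrite mulr_ge0// addr_ge0.
  by rewrite /tau; have := ln2_le1; lra.
have [|//||x _ hx] := @IVT R (tau t) z (`|z| + 2) z.
- lra.
- by apply: continuous_subspaceT; exact: tau_cont.
- by rewrite ge_min le_max tl tr orbT.
exact: (h x).
Qed.

Lemma tauK t z : 0 <= t -> gam t (tau t z) = z.
Proof.
move=> t0; have := gamK (tau t z) t0; apply: contra_eq => /lt_total/orP[] h.
  by rewrite lt_eqF// tau_lt.
by rewrite gt_eqF// tau_lt.
Qed.

Lemma gam_eq t z : 0 <= t -> gam t z = z + lg (t * gam t z).
Proof. by move=> t0; have := gamK z t0; rewrite /tau => /eqP; rewrite subr_eq => /eqP. Qed.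

Lemma gam_gt t z : 0 <= t -> z < gam t z.
Proof. by move=> t0; rewrite [ltRHS]gam_eq// ltrDl lg_gt0. Qed.

Lemma gam_le t x y : 0 <= t -> x <= y -> gam t x <= gam t y.
Proof. by move=> t0 xy; rewrite -(tau_le_iff _ _ t0) !gamK. Qed.

Lemma gam_ln2 t : 0 <= t -> gam t (- ln 2) = 0.
Proof. by move=> t0; rewrite -(tauK 0 t0) /tau mulr0 lg0 sub0r. Qed.

Lemma gam_ge0 t z : 0 <= t -> - ln 2 <= z -> 0 <= gam t z.
Proof. by move=> t0 hz; rewrite -(gam_ln2 t0); exact: gam_le. Qed.

Lemma is_derive_gam t z : 0 <= t ->
  is_derive z 1 (gam t) (1 + t * sg (t * gam t z))^-1.
Proof.
move=> t0; rewrite -{1}(gamK z t0).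
apply: is_derive_inverse.
- by apply: filterE => x; exact: tauK.
- by apply: filterE => x; exact: tau_cont.
- exact: is_derive_tau.
- by rewrite lt0r_neq0// ltr_wpDr// mulr_ge0// ltW// sg_gt0.
Qed.

End LogCoordinate.

(** * Iterated inverse of the left branch *)

Section Iterates.
Context {R : realType}.
Variable t : R.
Hypothesis t01 : 0 < t <= 1.
Implicit Types (x y z : R) (n : nat).

Let t0 : 0 <= t. Proof. by case/andP: t01 => /ltW. Qed.

(** [Gam n z] is the coordinate of the [n]-fold preimage, under the left
    branch, of the point of coordinate [z]. *)
Definition Gam n z := iter n (gam t) z.

(** The increment of the logarithmic derivative of [pG], relative to [pG], from
    one iterate to the next. *)
Definition ct (u : R) : R := t ^+ 2 * u * (1 - u) / (1 + t * u).
(** The derivative of [ct]. *)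
Definition dct (u : R) : R :=
  t ^+ 2 * ((1 - 2 * u) * (1 + t * u) - t * u * (1 - u)) / (1 + t * u) ^+ 2.
Definition sG n z := sg (t * Gam n z).

(** The derivative of [Gam n]. *)
Fixpoint pG n z : R :=
  if n is n'.+1 then pG n' z / (1 + t * sG n z) else 1.

(** The logarithmic derivative of [pG n]. *)
Fixpoint qG n z : R :=
  if n is n'.+1 then qG n' z + ct (sG n z) * pG n z else 0.

(** The derivative of [qG n]. *)
Fixpoint q1G n z : R :=
  if n is n'.+1 then q1G n' z +
    (dct (sG n z) * (- (sG n z * (1 - sG n z)) * (t * pG n z)) * pG n z +
     ct (sG n z) * (pG n z * qG n z)) else 0.

Arguments pG : simpl never.
Arguments qG : simpl never.
Arguments q1G : simpl never.

Lemma Gam_0 z : Gam 0 z = z. Proof. by []. Qed.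
Lemma GamS n z : Gam n.+1 z = gam t (Gam n z). Proof. by []. Qed.
Lemma sGE n z : sG n z = sg (t * Gam n z). Proof. by []. Qed.
Lemma pG_0 z : pG 0 z = 1. Proof. by []. Qed.
Lemma qG_0 z : qG 0 z = 0. Proof. by []. Qed.

Lemma pG_S n z : pG n.+1 z = pG n z / (1 + t * sG n.+1 z).
Proof. by []. Qed.

Lemma qG_S n z : qG n.+1 z = qG n z + ct (sG n.+1 z) * pG n.+1 z.
Proof. by []. Qed.

Lemma q1G_S n z : q1G n.+1 z = q1G n z +
  (dct (sG n.+1 z) * (- (sG n.+1 z * (1 - sG n.+1 z)) * (t * pG n.+1 z)) * pG n.+1 z +
   ct (sG n.+1 z) * (pG n.+1 z * qG n.+1 z)).
Proof. by []. Qed.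

Lemma Gam_S n z : Gam n.+1 z = Gam n z + lg (t * Gam n.+1 z).
Proof. by rewrite {1 3}/Gam iterS -gam_eq. Qed.

Lemma Gam_lt n z : Gam n z < Gam n.+1 z.
Proof. exact: gam_gt. Qed.

Lemma Gam_ge n z : z <= Gam n z.
Proof. by elim: n => [|n ih]; [exact: lexx|apply: le_trans ih (ltW (Gam_lt n z))]. Qed.

Lemma Gam_le n x y : x <= y -> Gam n x <= Gam n y.
Proof. by move=> xy; elim: n => //= n ih; exact: gam_le. Qed.

Lemma Gam_ge0 n z : - ln 2 <= z -> 0 <= Gam n.+1 z.
Proof.
move=> hz; apply: gam_ge0 => //; exact: le_trans hz (Gam_ge n z).
Qed.

Let e_gt0 (u : R) : 0 < u -> 0 < 1 + t * u.
Proof. by move=> u0; rewrite ltr_wpDr// mulr_ge0// ltW. Qed.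

Lemma sG_gt0 n z : 0 < sG n z. Proof. exact: sg_gt0. Qed.
Lemma sG_lt1 n z : sG n z < 1. Proof. exact: sg_lt1. Qed.

Lemma pG_diff n z : pG n z - pG n.+1 z = t * sG n.+1 z * pG n.+1 z.
Proof. by have := e_gt0 (sG_gt0 n.+1 z) => e0; rewrite pG_S; field; rewrite lt0r_neq0. Qed.

Lemma pG_gt0 n z : 0 < pG n z.
Proof. by elim: n => [|n ih]; [exact: ltr01|]; rewrite pG_S divr_gt0// e_gt0// sG_gt0. Qed.

Lemma pG_decr n z : pG n.+1 z <= pG n z.
Proof.
rewrite -subr_ge0 pG_diff; apply: mulr_ge0; last exact: ltW (pG_gt0 _ _).
by apply: mulr_ge0 => //; exact: ltW (sG_gt0 _ _).
Qed.

Lemma pG_le1 n z : pG n z <= 1.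
Proof. by elim: n => [|n ih]; [exact: lexx|exact: le_trans (pG_decr n z) ih]. Qed.

Lemma ct_le (u : R) : 0 < u < 1 -> 0 <= ct u <= t * u.
Proof.
move=> /andP[u0 u1]; have e0 := e_gt0 u0; have tu : 0 <= t * u by rewrite mulr_ge0// ltW.
have h : 0 <= t ^+ 2 * u * (1 - u).
  have u1' : 0 <= 1 - u by lra.
  by rewrite !mulr_ge0 ?exprn_ge0// ltW.
rewrite /ct divr_ge0 ?(ltW e0)//=.
rewrite ler_pdivrMr//; apply: (@le_trans _ _ (t * u)).
  rewrite (_ : _ * _ * _ = (t * u) * (t * (1 - u))); last by ring.
  by case/andP: t01 => _ t1; rewrite ler_piMr// mulr_ile1//; lra.
by rewrite ler_peMr//; lra.
Qed.

Lemma dct_le (u : R) : 0 < u < 1 -> `|dct u| <= 1.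
Proof.
move=> /andP[u0 u1]; have e0 := e_gt0 u0; have tu : 0 <= t * u by rewrite mulr_ge0// ltW.
have [t0' t1] := andP t01.
rewrite /dct normrM normfV ler_pdivrMr ?normr_gt0 ?lt0r_neq0 ?exprn_gt0// mul1r.
rewrite normrM (ger0_norm (exprn_ge0 2 t0)).
apply: (@le_trans _ _ `|(1 - 2 * u) * (1 + t * u) - t * u * (1 - u)|).
  by rewrite ler_piMl// exprn_ile1.
have e0' := ltW e0; rewrite [leRHS]ger0_norm ?exprn_ge0//.
rewrite [X in _ <= X](_ : _ = 1 + 2 * (t * u) + (t * u) ^+ 2); last by ring.
rewrite real_ler_norml ?num_real//; apply/andP; split; nra.
Qed.

(** The increments of [qG] are at most [t] times those of [- pG], which
    telescope: the distortion is bounded uniformly in [n]. *)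
Lemma qG_bounds n z : 0 <= qG n z <= t * (1 - pG n z).
Proof.
elim: n => [|n /andP[ih1 ih2]]; first by rewrite /pG subrr mulr0 lexx.
have su : 0 < sG n.+1 z < 1 by rewrite sG_gt0 sG_lt1.
have /andP[c0 cle] := ct_le su.
have p0 := ltW (pG_gt0 n.+1 z); have pd := pG_diff n z.
rewrite qG_S.
have h : ct (sG n.+1 z) * pG n.+1 z <= t * (pG n z - pG n.+1 z).
  rewrite pd; apply: (@le_trans _ _ (t ^+ 2 * sG n.+1 z * pG n.+1 z)).
    rewrite ler_wpM2r// /ct.
    rewrite ler_pdivrMr ?e_gt0 ?sG_gt0//.
    have s0 := ltW (sG_gt0 n.+1 z); have s1 := sG_lt1 n.+1 z.
    apply: ler_pM => //; first by rewrite mulr_ge0 ?exprn_ge0.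
      lra.
    by have := mulr_ge0 t0 s0; lra.
  by rewrite expr2 !mulrA.
have cp0 := mulr_ge0 c0 p0.
apply/andP; split; first exact: addr_ge0.
apply: le_trans (lerD ih2 h) _.
by rewrite -mulrDr ler_wpM2l// addrA subrK.
Qed.

Lemma qG_le1 n z : 0 <= qG n z <= 1.
Proof.
have /andP[-> h] := qG_bounds n z; rewrite (le_trans h)//.
have := pG_gt0 n z; have := pG_le1 n z; have [_ t1] := andP t01 => p1 p0.
by apply: mulr_ile1 => //; lra.
Qed.

(** As for [qG_bounds], the increments are dominated by those of [- pG], which
    telescope. *)
Lemma q1G_bound n z : `|q1G n z| <= 2 * (1 - pG n z).
Proof.
elim: n => [|n ih]; first by rewrite /q1G /pG normr0 subrr mulr0.
rewrite q1G_S.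
have su : 0 < sG n.+1 z < 1 by rewrite sG_gt0 sG_lt1.
have /andP[c0 cle] := ct_le su; have dle := dct_le su.
have p0 := ltW (pG_gt0 n.+1 z); have pd := pG_diff n z.
have p1 := pG_le1 n.+1 z; have /andP[q0 q1] := qG_le1 n.+1 z.
move: su => /andP[s0 s1].
set s := sG n.+1 z in s0 s1 c0 cle dle pd *; set p := pG n.+1 z in p0 p1 pd *.
set q := qG n.+1 z in q0 q1 *.
clearbody s p q.
have s1' : 0 <= 1 - s by rewrite subr_ge0 ltW.
have s0' := ltW s0; have tsp : 0 <= t * s * p by exact: mulr_ge0 (mulr_ge0 t0 s0') p0.
have h1 : `|dct s * (- (s * (1 - s)) * (t * p)) * p| <= t * s * p.
  rewrite normrM normrM [`|p|]ger0_norm// mulNr normrN.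
  rewrite [`|s * (1 - s) * (t * p)|]ger0_norm; last first.
    by exact: mulr_ge0 (mulr_ge0 s0' s1') (mulr_ge0 t0 p0).
  apply: (@le_trans _ _ (1 * (s * (1 - s) * (t * p)) * p)).
    rewrite ler_wpM2r// ler_wpM2r//; exact: mulr_ge0 (mulr_ge0 s0' s1') (mulr_ge0 t0 p0).
  rewrite mul1r (_ : s * (1 - s) * (t * p) * p = (t * s * p) * ((1 - s) * p)); last by ring.
  by rewrite ler_piMr// mulr_ile1//; lra.
have h2 : `|ct s * (p * q)| <= t * s * p.
  rewrite ger0_norm; last exact: mulr_ge0 c0 (mulr_ge0 p0 q0).
  apply: le_trans (ler_wpM2r (mulr_ge0 p0 q0) cle) _.
  rewrite (_ : t * s * (p * q) = t * s * p * q); last by ring.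
  exact: ler_piMr.
apply: le_trans (ler_normD _ _) _; apply: le_trans (lerD ih (ler_normD _ _)) _.
by apply: le_trans (lerD (lexx _) (lerD h1 h2)) _; lra.
Qed.

Lemma q1G_le2 n z : `|q1G n z| <= 2.
Proof. by have := q1G_bound n z; have := pG_gt0 n z; lra. Qed.

Lemma is_derive_Gam n z : is_derive z 1 (Gam n) (pG n z).
Proof.
elim: n => [|n ih]; first exact: is_derive_id.
have d := is_derive_gam (Gam n z) t0.
have := @is_derive1_comp R (gam t) (Gam n) z _ _ d ih.
by rewrite mulrC.
Qed.

Lemma is_derive_sG n z :
  is_derive z 1 (sG n) (- (sG n z * (1 - sG n z)) * (t * pG n z)).
Proof.
have d0 := is_derive_Gam n z.
have d1 : is_derive z 1 (fun z => t * Gam n z) (t * pG n z).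
  by apply: is_derive_eq; rewrite /GRing.scale/=; ring.
exact: (@is_derive1_comp R sg (fun z => t * Gam n z) z _ _ (is_derive_sg _) d1).
Qed.

Lemma is_derive_ct (u : R) : 0 < u -> is_derive u 1 ct (dct u).
Proof.
move=> u0; have e0 : 1 + t * u != 0 by rewrite lt0r_neq0// e_gt0.
have d1 : is_derive u 1 (fun u : R => 1 + t * u) t.
  by apply: is_derive_eq; rewrite /GRing.scale/=; ring.
have d2 := @is_deriveV R (fun u : R => 1 + t * u) u _ 1 e0 d1.
have d3 : is_derive u 1 (fun u : R => t ^+ 2 * u * (1 - u)) (t ^+ 2 * (1 - 2 * u)).
  by apply: is_derive_eq; rewrite /GRing.scale/=; ring.
apply: (is_derive_eq (is_deriveM d3 d2)).
by rewrite /dct /GRing.scale/=; field.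
Qed.

Lemma is_derive_pG n z : is_derive z 1 (pG n) (pG n z * qG n z).
Proof.
elim: n => [|n ih]; first by rewrite mulr0; exact: is_derive_cst.
have e0 : 1 + t * sG n.+1 z != 0 by rewrite lt0r_neq0// e_gt0// sG_gt0.
have ds := is_derive_sG n.+1 z.
have d1 : is_derive z 1 (fun z => 1 + t * sG n.+1 z)
    (t * (- (sG n.+1 z * (1 - sG n.+1 z)) * (t * pG n.+1 z))).
  by apply: is_derive_eq; rewrite /GRing.scale/=; ring.
have d2 := @is_deriveV R (fun z => 1 + t * sG n.+1 z) z _ 1 e0 d1.
apply: (is_derive_eq (is_deriveM ih d2)).
rewrite qG_S !pG_S /ct /GRing.scale/=.
by field.
Qed.

Lemma is_derive_qG n z : is_derive z 1 (qG n) (q1G n z).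
Proof.
elim: n => [|n ih]; first exact: is_derive_cst.
have dp := is_derive_pG n.+1 z.
have dc := @is_derive1_comp R ct (sG n.+1) z _ _
  (is_derive_ct (sG_gt0 n.+1 z)) (is_derive_sG n.+1 z).
apply: (is_derive_eq (is_deriveD ih (is_deriveM dc dp))).
rewrite q1G_S /GRing.scale/=.
by ring.
Qed.

Lemma cvg_series_shift1 (f : nat -> R) :
  cvgn (series (fun n => f n.+1)) -> cvgn (series f).
Proof.
move=> cf; apply/cvg_ex; exists (f 0%N + tsum (fun n => f n.+1)).
rewrite -(cvg_shiftS (series f)).
rewrite (_ : (fun n => series f n.+1) = (fun n => f 0%N + series (fun n => f n.+1) n)).
  by apply: cvgD => //; exact: cvg_cst.
by apply/funext => n; rewrite /series/= big_nat_recl.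
Qed.

(** The increment of [Gam] is ln (1 + exp(- t Gam)), of the order of
    exp(- t Gam).  Multiplied by exp(- m Gam) it is thus dominated by the
    increment of - exp(- m Gam) / m, which telescopes. *)
Lemma Gam_sum (m z : R) : 0 < m -> - ln 2 <= z ->
  cvgn (series (fun n => expR (- ((m + t) * Gam n z)))).
Proof.
move=> m0 hz; apply: cvg_series_shift1.
pose a n := expR (- (m * Gam n z)).
have step n : expR (- ((m + t) * Gam n.+1 z)) <= 2 / m * (a n - a n.+1).
  rewrite /a; have hS := Gam_S n z; have g0 := Gam_ge0 n hz.
  set G := Gam n.+1 z in hS g0 *.
  have w0 : 0 <= t * G by rewrite mulr_ge0.
  have h1 : Gam n z = G - lg (t * G) by lra.
  rewrite h1 (_ : - ((m + t) * G) = - (m * G) + - (t * G)); last by ring.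
  rewrite (_ : - (m * (G - _)) = - (m * G) + m * lg (t * G)); last by ring.
  rewrite !expRD; have e0 := expR_gt0 (- (m * G)).
  have e1 := expR_ge1Dx (m * lg (t * G)); have l1 := sg_le_lg (t * G).
  have s1 : expR (- (t * G)) <= 2 * sg (t * G).
    have ew := expR_gt0 (t * G).
    have ew1 : 1 <= expR (t * G) by rewrite -expR0 ler_expR.
    rewrite expRN sg.unlock ler_pdivlMr ?addr_gt0// mulrC ler_pdivrMr//.
    lra.
  set A := expR (- (m * G)); set B := expR (m * lg _) in e1 *.
  rewrite (_ : 2 / m * _ = A * (2 / m * (B - 1))); last by ring.
  rewrite ler_wpM2l ?(ltW e0)// mulrAC ler_pdivlMr//.
  have := ler_wpM2l (ltW m0) s1; have := ler_wpM2l (ltW m0) l1; lra.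
have a_decr : nonincreasing_seq a.
  apply/nonincreasing_seqP => n; rewrite /a ler_expR lerN2 ler_wpM2l ?(ltW m0)//.
  exact: ltW (Gam_lt n z).
have ca : cvgn a.
  apply: nonincreasing_is_cvgn => //; exists 0 => _ [n _ <-]; exact: expR_ge0.
have c1 : cvgn (series (fun n => 2 / m * (a n - a n.+1))).
  apply: (@is_cvg_seriesZ R); apply/cvg_ex; exists (a 0%N - limn a).
  exact: tsum_telescope.
apply: (series_le_cvg _ _ step c1) => n; first exact: expR_ge0.
exact: le_trans (expR_ge0 _) (step n).
Qed.

End Iterates.

(** * Monotonicity in the parameter *)

Section ParameterMonotone.
Context {R : realType}.
Implicit Types (s t z x y X Y : R) (n : nat).

Lemma gam_anti s t x y : 0 < s -> s <= t -> y <= x -> - ln 2 <= x ->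
  gam t y <= gam s x.
Proof.
move=> s0 st yx hx; have t0 : 0 <= t by lra.
have s0' := ltW s0.
rewrite leNgt; apply/negP => h.
have g0 := gam_ge0 s0' hx.
have hl : lg (t * gam t y) <= lg (s * gam s x).
  by apply: lg_decr; apply: ler_pM => //; exact: ltW.
by have := gam_eq y t0; have := gam_eq x s0'; lra.
Qed.

Lemma Gam_anti s t n z : 0 < s -> s <= t -> - ln 2 <= z -> Gam t n z <= Gam s n z.
Proof.
move=> s0 st hz; elim: n => [|n ih]; first exact: lexx.
have [s1 /ltW s0'] : s <= t /\ 0 < s by [].
rewrite /Gam !iterS; apply: gam_anti => //.
elim: (n) => //= k ihk; apply: le_trans ihk _.
by apply: ltW; apply: gam_gt; exact: ltW.
Qed.

(** If t y' < s x' for x' = gam s x and y' = gam t y, then [lg], being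
    decreasing, gives y' the larger increment: a contradiction.  The
    alternative is the start of the induction in [Gam_weight]. *)
Lemma gam_weight s t x y : 0 < s -> s <= t -> - ln 2 <= x ->
  (y = x \/ s * x <= t * y) -> s * gam s x <= t * gam t y.
Proof.
move=> s0 st hx hxy; have t0 : 0 <= t by lra.
have s0' := ltW s0; rewrite leNgt; apply/negP => h.
have g0 := gam_ge0 s0' hx.
have hl : lg (s * gam s x) <= lg (t * gam t y) by apply: lg_decr; exact: ltW.
have e1 := gam_eq y t0; have e2 := gam_eq x s0'.
case: hxy => hxy.
- have h1 : gam s x <= gam t y.
    by rewrite hxy in e1 hl *; rewrite [leLHS]e2 [leRHS]e1; apply: lerD.
  by have := ler_pM s0' g0 st h1; lra.
- have l0 := ltW (lg_gt0 (s * gam s x)).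
  have := ler_pM s0' l0 st hl.
  have := congr1 (fun u => t * u) e1; have := congr1 (fun u => s * u) e2.
  by rewrite /= !mulrDr; lra.
Qed.

Lemma Gam_weight s t n z : 0 < s -> s <= t -> - ln 2 <= z ->
  s * Gam s n.+1 z <= t * Gam t n.+1 z.
Proof.
move=> s0 st hz; elim: n => [|n ih]; first by apply: gam_weight => //; left.
rewrite [Gam s n.+2 z]iterS [Gam t n.+2 z]iterS; apply: gam_weight => //.
  have : forall k, z <= iter k (gam s) z.
    elim=> //= k ihk; apply: le_trans ihk _.
    by apply: ltW; apply: gam_gt; exact: ltW.
  by move/(_ n.+1); apply: le_trans.
by right.
Qed.

Section Pair.
Variables (s t z : R).
Hypotheses (s0 : 0 < s) (st : s <= t) (t1 : t <= 1) (hz : - ln 2 <= z).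

Let s01 : 0 < s <= 1. Proof. by rewrite s0 (le_trans st t1). Qed.
Let t01 : 0 < t <= 1. Proof. by rewrite t1 (lt_le_trans s0 st). Qed.
Let z1 : - 1 <= z. Proof. by apply: le_trans hz; rewrite lerN2 ln2_le1. Qed.

(** [Gam] decreases in the parameter [t] while [t * Gam] increases; so the
    relative variation of [Gam] is at most that of [t]. *)
Lemma Gam_pair n : [/\ 0 <= Gam t n.+1 z, Gam t n.+1 z <= Gam s n.+1 z,
  s * Gam s n.+1 z <= t * Gam t n.+1 z &
  s * (Gam s n.+1 z - Gam t n.+1 z) <= (t - s) * Gam t n.+1 z].
Proof.
move: (s0) (st) (t1) (z1) => s0' st' t1' z1'.
have h1 := Gam_weight n s0 st hz; split => //.
- exact: Gam_ge0.
- exact: Gam_anti.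
- lra.
Qed.

(** [Gam_pair] through the logistic function, whose logarithmic derivative is at
    most 1 in absolute value. *)
Lemma sG_pair n : [/\ sG t n.+1 z <= sG s n.+1 z,
  sG s n.+1 z - sG t n.+1 z <= (t - s) * Gam s n.+1 z * sG s n.+1 z &
  `|t * sG t n.+1 z - s * sG s n.+1 z| <=
    (t - s) * (1 + Gam s n.+1 z) * sG s n.+1 z].
Proof.
move: (s0) (st) (t1) (z1) => s0' st' t1' z1'.
have [X0 XY w wd] := Gam_pair n.
have h1 : sG t n.+1 z <= sG s n.+1 z by rewrite !sGE; exact: sg_decr.
have h2 := sg_diff w.
have u0 := ltW (sG_gt0 t n.+1 z); have v0 := ltW (sG_gt0 s n.+1 z).
rewrite -!sGE in h2.
have st0 : 0 <= t - s by lra.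
have h3 : t * Gam t n.+1 z - s * Gam s n.+1 z <= (t - s) * Gam s n.+1 z.
  by have := ler_wpM2l (ltW (lt_le_trans s0 st)) XY; lra.
have h4 : sG s n.+1 z - sG t n.+1 z <= (t - s) * Gam s n.+1 z * sG s n.+1 z.
  by apply: le_trans h2 _; rewrite mulrC ler_wpM2r.
split => //.
have h5 := ler_wpM2l st0 h1; have h6 := ler_wpM2l st0 u0.
have h8 : s * (sG s n.+1 z - sG t n.+1 z) <= (t - s) * Gam s n.+1 z * sG s n.+1 z.
  by apply: le_trans h4; rewrite ler_piMl; lra.
have h9 : 0 <= s * (sG s n.+1 z - sG t n.+1 z) by apply: mulr_ge0; lra.
have h10 : 0 <= (t - s) * sG s n.+1 z by exact: mulr_ge0.
by rewrite ler_norml; apply/andP; split; lra.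
Qed.

(** The quantity [sG] is a lower bound for the increment of [Gam]; sums of
    [sG] therefore telescope in the estimates that follow. *)
Lemma sG_le_diff n : sG s n.+1 z <= Gam s n.+1 z - Gam s n z.
Proof.
move: (s0) (st) (t1) (z1) => s0' st' t1' z1'.
have := Gam_S s01 n z; have := sg_le_lg (s * Gam s n.+1 z); rewrite -sGE.
by lra.
Qed.

(** [pG] is a product of factors 1 / (1 + t sG); the variations of the factors
    are summed by [sG_le_diff]. *)
Lemma pG_pair n : `|pG t n z - pG s n z| <=
  (t - s) * (1 + Gam s n z) * (Gam s n z - z).
Proof.
move: (s0) (st) (t1) (z1) => s0' st' t1' z1'.
elim: n => [|n ih]; first by rewrite !pG_0 Gam_0 !subrr normr0 mulr0.
have [X0 XY w wd] := Gam_pair n; have [a1 a2 a3] := sG_pair n.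
have dS := sG_le_diff n.
have G1 := ltW (Gam_lt s01 n z); have G0 := Gam_ge s01 n z.
have pt0 := ltW (pG_gt0 t01 n z); have ps0 := ltW (pG_gt0 s01 n z).
have ps1 := pG_le1 s01 n z.
have u0 := sG_gt0 t n.+1 z; have v0 := sG_gt0 s n.+1 z.
rewrite !pG_S; set e := 1 + t * _; set e' := 1 + s * _.
have e1 : 1 <= e by rewrite lerDl mulr_ge0// ?(ltW u0)//; lra.
have e'1 : 1 <= e' by rewrite lerDl mulr_ge0// ?(ltW v0)// ltW.
rewrite (_ : _ - _ = (pG t n z - pG s n z) / e + pG s n z * (e' - e) / (e * e'));
  last by field; rewrite !lt0r_neq0//; lra.
have st0 : 0 <= t - s by lra.
have hA : `|(pG t n z - pG s n z) / e| <= `|pG t n z - pG s n z|.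
  rewrite normrM normfV ler_pdivrMr ?normr_gt0 ?lt0r_neq0//; last lra.
  by rewrite ler_peMr// ger0_norm; lra.
have hB : `|pG s n z * (e' - e) / (e * e')| <= `|t * sG t n.+1 z - s * sG s n.+1 z|.
  rewrite normrM normfV ler_pdivrMr ?normr_gt0 ?lt0r_neq0//; last first.
    by apply: mulr_gt0; lra.
  rewrite normrM (ger0_norm ps0) (_ : e' - e = - (t * sG t n.+1 z - s * sG s n.+1 z));
    last by rewrite /e /e'; ring.
  rewrite normrN mulrC; apply: ler_pM => //.
  rewrite ger0_norm ?mulr_ge0//; last lra; last lra.
  by apply: le_trans ps1 _; rewrite -[leLHS]mulr1; apply: ler_pM.
apply: le_trans (ler_normD _ _) _; apply: le_trans (lerD hA hB) _.
apply: le_trans (lerD ih a3) _.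
rewrite -!mulrA -mulrDr ler_wpM2l//.
have h : (1 + Gam s n.+1 z) * sG s n.+1 z <=
   (1 + Gam s n.+1 z) * (Gam s n.+1 z - Gam s n z).
  by apply: ler_wpM2l => //; lra.
have h' : (1 + Gam s n z) * (Gam s n z - z) <= (1 + Gam s n.+1 z) * (Gam s n z - z).
  by apply: ler_wpM2r; lra.
by apply: le_trans (lerD h' h) _; lra.
Qed.

Lemma pG_pair2 n : `|pG t n.+1 z - pG s n.+1 z| <= (t - s) * (1 + Gam s n.+1 z) ^+ 2.
Proof.
move: (s0) (st) (t1) (z1) => s0' st' t1' z1'.
apply: le_trans (pG_pair n.+1) _; rewrite expr2 -mulrA ler_wpM2l//; first by lra.
have [X0 XY w wd] := Gam_pair n.
by apply: ler_wpM2l; have := z1; lra.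
Qed.

Lemma ct_pair n : `|ct t (sG t n.+1 z) - ct s (sG s n.+1 z)| <=
  (t - s) * (2 * (1 + Gam s n.+1 z)) * sG s n.+1 z.
Proof.
move: (s0) (st) (t1) (z1) => s0' st' t1' z1'.
have [X0 XY w wd] := Gam_pair n; have [a1 a2 a3] := sG_pair n.
have u0 := sG_gt0 t n.+1 z; have v0 := sG_gt0 s n.+1 z.
have u1 := sG_lt1 t n.+1 z; have v1 := sG_lt1 s n.+1 z.
rewrite /ct; set u := sG t _ _ in a1 a2 a3 u0 u1 *.
set v := sG s _ _ in a1 a2 a3 v0 v1 *.
set Y := Gam s _ _ in XY w wd a2 a3 *; clearbody u v Y.
set a := t * u; set b := s * v.
have a0 : 0 <= a by rewrite mulr_ge0 ?(ltW u0)//; lra.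
have b0 : 0 <= b by rewrite mulr_ge0 ?(ltW v0)//; lra.
have st0 : 0 <= t - s by lra.
have ea : 0 < 1 + a by lra. have eb : 0 < 1 + b by lra.
have av : a <= v.
  by apply: le_trans a1; rewrite ler_piMl// ltW.
have b1 : b <= 1 by apply: mulr_ile1; lra.
have Yv : 0 <= (t - s) * Y * v by rewrite mulr_ge0 ?(ltW v0)// mulr_ge0//; lra.
have fa : 0 <= a / (1 + a) <= a.
  by rewrite divr_ge0 ?(ltW ea)//= ler_pdivrMr// ler_peMr//; lra.
have fd : `|a / (1 + a) - b / (1 + b)| <= `|a - b|.
  rewrite (_ : _ - _ = (a - b) / ((1 + a) * (1 + b))); last by field; rewrite !lt0r_neq0.
  rewrite normrM normfV ler_pdivrMr ?normr_gt0 ?lt0r_neq0 ?mulr_gt0//.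
  rewrite ler_peMr// ger0_norm ?mulr_ge0 ?(ltW ea) ?(ltW eb)//.
  by have := mulr_ge0 a0 b0; lra.
rewrite (_ : t ^+ 2 * u * (1 - u) / (1 + a) = t * (1 - u) * (a / (1 + a))); last first.
  by rewrite /a; field; rewrite lt0r_neq0.
rewrite (_ : s ^+ 2 * v * (1 - v) / (1 + b) = s * (1 - v) * (b / (1 + b))); last first.
  by rewrite /b; field; rewrite lt0r_neq0.
move: fa fd; set f := a / _; set g := b / _ => /andP[f0 fa] fd.
rewrite -/a -/b in a3; clearbody f g a b.
rewrite (_ : _ - _ = (t - s) * (1 - u) * f + s * (v - u) * f + s * (1 - v) * (f - g)); last by ring.
have u1' : 0 <= 1 - u by lra.
have v1' : 0 <= 1 - v by lra.
have vu : 0 <= v - u by lra.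
have s0n := ltW s0'.
have h1 : `|(t - s) * (1 - u) * f| <= (t - s) * 1 * v.
  rewrite ger0_norm; last exact: mulr_ge0 (mulr_ge0 st0 u1') f0.
  apply: ler_pM => //; [exact: mulr_ge0|apply: ler_wpM2l => //; lra|lra].
have h2 : `|s * (v - u) * f| <= 1 * ((t - s) * Y * v) * 1.
  rewrite ger0_norm; last exact: mulr_ge0 (mulr_ge0 s0n vu) f0.
  apply: ler_pM => //; [exact: mulr_ge0|apply: ler_pM => //; lra|lra].
have h3 : `|s * (1 - v) * (f - g)| <= 1 * ((t - s) * (1 + Y) * v).
  rewrite normrM; apply: ler_pM => //; last exact: le_trans fd _.
  by rewrite ger0_norm ?mulr_ge0//; apply: mulr_ile1; lra.
apply: le_trans (ler_normD _ _) _; apply: le_trans (lerD (ler_normD _ _) h3) _.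
by apply: le_trans (lerD (lerD h1 h2) (lexx _)) _; lra.
Qed.

Lemma qG_pair n : `|qG t n z - qG s n z| <=
  (t - s) * (3 * (1 + Gam s n z) ^+ 2) * (Gam s n z - z).
Proof.
move: (s0) (st) (t1) (z1) => s0' st' t1' z1'.
elim: n => [|n ih]; first by rewrite !qG_0 Gam_0 !subrr normr0 mulr0.
have [X0 XY w wd] := Gam_pair n.
have dS := sG_le_diff n; have cd := ct_pair n; have pd := pG_pair2 n.
have G1 := ltW (Gam_lt s01 n z); have G0 := Gam_ge s01 n z.
have pt0 := ltW (pG_gt0 t01 n.+1 z); have ps0 := ltW (pG_gt0 s01 n.+1 z).
have ps1 := pG_le1 s01 n.+1 z.
have v0 := sG_gt0 s n.+1 z; have [a1 _ _] := sG_pair n.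
have tu : 0 < sG t n.+1 z < 1 by rewrite sG_gt0 sG_lt1.
have /andP[c0 cle] := ct_le t01 tu.
have st0 : 0 <= t - s by lra.
have ctv : ct t (sG t n.+1 z) <= sG s n.+1 z.
  apply: le_trans cle _; apply: le_trans a1; rewrite ler_piMl//; lra.
rewrite !qG_S; move: pt0 ps0 ps1 v0 c0 ctv cd pd dS G1 G0 ih X0 XY z1.
set p := pG t _ _; set p' := pG s _ _; set c := ct t _; set c' := ct s _.
set v := sG s _ _; set Y := Gam s n.+1 z; set Y0 := Gam s n z.
set Q := qG t n z; set Q' := qG s n z; clearbody p p' c c' v Y Y0 Q Q'.
move=> pt0 ps0 ps1 v0 c0 ctv cd pd dS G1 G0 ih X0 XY z1''.
rewrite (_ : _ - _ = (Q - Q') + (c - c') * p' + c * (p - p')); last by ring.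
have h1 : `|(c - c') * p'| <= (t - s) * (2 * (1 + Y)) * v.
  by rewrite normrM (ger0_norm ps0); apply: le_trans cd; rewrite ler_piMr.
have h2 : `|c * (p - p')| <= v * ((t - s) * (1 + Y) ^+ 2).
  by rewrite normrM (ger0_norm c0); apply: ler_pM.
apply: le_trans (ler_normD _ _) _; apply: le_trans (lerD (ler_normD _ _) h2) _.
apply: le_trans (lerD (lerD ih h1) (lexx _)) _.
have Y0' : 0 <= Y by lra.
have k1 : (1 + Y) <= (1 + Y) ^+ 2 by rewrite expr2 ler_peMr; lra.
have k2 : (t - s) * (2 * (1 + Y)) * v + v * ((t - s) * (1 + Y) ^+ 2) <=
    (t - s) * (3 * (1 + Y) ^+ 2) * v.
  have := ler_wpM2l (mulr_ge0 st0 (ltW v0)) k1; lra.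
have k3 : (t - s) * (3 * (1 + Y) ^+ 2) * v <= (t - s) * (3 * (1 + Y) ^+ 2) * (Y - Y0).
  apply: ler_wpM2l => //; apply: mulr_ge0 => //; apply: mulr_ge0 => //.
  exact: sqr_ge0.
have k4 : (t - s) * (3 * (1 + Y0) ^+ 2) * (Y0 - z) <= (t - s) * (3 * (1 + Y) ^+ 2) * (Y0 - z).
  rewrite ler_wpM2r//; first lra.
  apply: ler_wpM2l => //; apply: ler_wpM2l => //.
  by rewrite -subr_ge0 subr_sqr; apply: mulr_ge0; lra.
lra.
Qed.

Lemma qG_pair3 n : `|qG t n.+1 z - qG s n.+1 z| <= (t - s) * (3 * (1 + Gam s n.+1 z) ^+ 3).
Proof.
move: (s0) (st) (t1) (z1) => s0' st' t1' z1'.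
apply: le_trans (qG_pair n.+1) _; rewrite -mulrA ler_wpM2l//; first by lra.
have [X0 XY w wd] := Gam_pair n; rewrite -mulrA ler_wpM2l//.
rewrite [leRHS]exprSr; apply: ler_wpM2l; last by have := z1; lra.
by rewrite exprn_ge0//; lra.
Qed.

End Pair.
End ParameterMonotone.

(** * Inverse branches of the first return map *)

Section LSVBranches.
Context {R : realType}.
Variables (a0 a1 : R).
Hypotheses (a00 : 0 < a0) (a01 : a0 <= a1) (a11 : a1 < 1).
Implicit Types (s t z y : R) (n : nat).

Definition Th : set R := [set t | a0 <= t <= a1].

(** The point of coordinate [Gam t n z]. *)
Definition Gb t n z : R := expR (- Gam t n z) / 2.
(** The coordinate of the point (1 + y) / 2 of ]1/2, 1]. *)
Definition zt y : R := - ln (1 + y).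
(** The inverse branches of the first return map to ]1/2, 1], read in the
    coordinate y.  The last step of an excursion, through the right branch
    2 x - 1, is absorbed by the coordinate, so that the branches are the
    iterated preimages of (1 + y) / 2. *)
Definition bb t n y : R := Gb t n (zt y).
Definition bb1 t n y : R := bb t n y * pG t n (zt y) / (1 + y).
Definition bb2 t n y : R := bb1 t n y * ((pG t n (zt y) - qG t n (zt y) - 1) / (1 + y)).

(** An exponent strictly between [a1], above which the series of [Gam_sum]
    converges, and 1, the decay of the branches: the room up to 1 absorbs the
    polynomial factors that come from differentiation in the parameter. *)
Definition kap : R := (1 + a1) / 2.
(** Chosen so that 1 + X / a0 is at most [Kc] times exp(((1 - a1) / 6) X): the
    cube then costs half of 1 - a1 in the exponent. *)
Definition Kc : R := 1 + 6 / (a0 * (1 - a1)).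
Definition MM n : R := 8 * Kc ^+ 3 * expR (- (kap * Gam a1 n (- ln 2))).

Let Th01 t : Th t -> 0 < t <= 1.
Proof.
move=> /andP[h1 h2]; apply/andP; split; first exact: lt_le_trans a00 h1.
exact: le_trans h2 (ltW a11).
Qed.

Let a1_01 : 0 < a1 <= 1.
Proof. by apply: Th01; rewrite /Th/= lexx a01. Qed.

Lemma Kc_ge1 : 1 <= Kc.
Proof.
rewrite lerDl divr_ge0// mulr_ge0//; first exact: ltW.
by rewrite subr_ge0 ltW.
Qed.

Lemma poly_exp (X : R) : 0 <= X ->
  8 * (1 + X / a0) ^+ 3 * expR (- X) <= 8 * Kc ^+ 3 * expR (- (kap * X)).
Proof.
move=> X0; have a1' : 0 < 1 - a1 by rewrite subr_gt0.
have h1 : 1 + X / a0 <= Kc * expR ((1 - a1) / 6 * X).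
  have h := expR_ge1Dx ((1 - a1) / 6 * X).
  apply: (@le_trans _ _ (Kc * (1 + (1 - a1) / 6 * X))); last first.
    by rewrite ler_wpM2l//; have := Kc_ge1; lra.
  have -> : X / a0 = 6 / (a0 * (1 - a1)) * ((1 - a1) / 6 * X).
    by field; rewrite !lt0r_neq0.
  rewrite /Kc; have c0 : 0 <= 6 / (a0 * (1 - a1)).
    by rewrite divr_ge0// mulr_ge0//; exact: ltW.
  have d0 : 0 <= (1 - a1) / 6 * X by rewrite mulr_ge0// divr_ge0//; exact: ltW.
  by have := mulr_ge0 c0 d0; lra.
have h2 : (1 + X / a0) ^+ 3 <= (Kc * expR ((1 - a1) / 6 * X)) ^+ 3.
  have W0 : 0 <= 1 + X / a0 by rewrite addr_ge0// divr_ge0//; exact: ltW.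
  by apply: lerXn2r => //; rewrite nnegrE//; exact: le_trans h1.
have e0 := expR_gt0 (- X).
rewrite -[leLHS]mulrA -[leRHS]mulrA; apply: ler_wpM2l => //.
apply: le_trans (ler_wpM2r (ltW e0) h2) _.
rewrite exprMn -expRM_natl -[leLHS]mulrA -expRD (_ : _ + - X = - (kap * X))//.
by rewrite /kap; field.
Qed.

Lemma Gam_a1 t n z : Th t -> - ln 2 <= z ->
  Gam a1 n (- ln 2) <= Gam t n z.
Proof.
move=> /[dup] tT /andP[_ t1] hz; have /andP[t0 _] := Th01 tT.
by apply: le_trans (Gam_anti n t0 t1 hz); exact: Gam_le.
Qed.

(** The parameter [a1] and the point [- ln 2] minimize [Gam], by
    monotonicity. *)
Lemma MM_bound t n z : Th t -> - ln 2 <= z ->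
  8 * (1 + Gam t n.+1 z / a0) ^+ 3 * expR (- Gam t n.+1 z) <= MM n.+1.
Proof.
move=> tT hz; have X0 := Gam_ge0 (Th01 tT) n hz.
apply: le_trans (poly_exp X0) _; rewrite /MM ler_wpM2l//.
  by rewrite mulr_ge0// exprn_ge0//; have := Kc_ge1; lra.
have k0 : 0 <= kap by rewrite /kap divr_ge0// addr_ge0//; case/andP: a1_01 => /ltW.
by rewrite ler_expR lerN2 ler_wpM2l//; exact: Gam_a1.
Qed.

Lemma MM_summable : summable_ge0 MM.
Proof.
split; first by move=> n; rewrite mulr_ge0 ?expR_ge0// mulr_ge0// exprn_ge0//;
  have := Kc_ge1; lra.
have m0 : 0 < (1 - a1) / 2 by rewrite divr_gt0// subr_gt0.
have := @Gam_sum R a1 a1_01 _ (- ln 2) m0 (lexx _).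
have -> : (1 - a1) / 2 + a1 = kap by rewrite /kap; field.
by move=> h; exact: (@is_cvg_seriesZ R _ _ h).
Qed.

Lemma MM_ge0 n : 0 <= MM n. Proof. by case: MM_summable. Qed.

Lemma MM0_ge1 : 1 <= MM 0.
Proof.
rewrite /MM Gam_0 mulrN opprK.
have K1 := Kc_ge1.
have K3 : 1 <= Kc ^+ 3 by rewrite exprn_ege1.
have e1 : 1 <= expR (kap * ln 2).
  rewrite -[leLHS]expR0 ler_expR; apply: mulr_ge0; last by apply: ln_ge0; lra.
  by rewrite /kap divr_ge0// addr_ge0//; case/andP: a1_01 => /ltW.
rewrite -[leLHS]mulr1; apply: ler_pM => //; lra.
Qed.

Lemma Gb_gt0 t n z : 0 < Gb t n z.
Proof. by rewrite divr_gt0// expR_gt0. Qed.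

Lemma Gb_half t n z : Th t -> - ln 2 <= z -> Gb t n.+1 z <= 2^-1.
Proof.
move=> tT hz; have X0 := Gam_ge0 (Th01 tT) n hz.
rewrite /Gb -[leRHS]mul1r ler_wpM2r ?invr_ge0//.
by rewrite -expR0 ler_expR oppr_le0.
Qed.

Lemma Gb_M t n z : Th t -> - ln 2 <= z -> Gb t n z <= MM n.
Proof.
move=> tT hz; case: n => [|n].
  apply: le_trans MM0_ge1; rewrite /Gb Gam_0 ler_pdivrMr// mul1r.
  have -> : (2 : R) = expR (ln 2) by rewrite lnK// posrE.
  by rewrite ler_expR; lra.
apply: le_trans (MM_bound n tT hz).
have X0 := Gam_ge0 (Th01 tT) n hz; have e0 := expR_gt0 (- Gam t n.+1 z).
have W1 : 1 <= (1 + Gam t n.+1 z / a0) ^+ 3.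
  by rewrite exprn_ege1// lerDl divr_ge0//; exact: ltW.
rewrite /Gb mulrC ler_wpM2r ?(ltW e0)//; lra.
Qed.

Lemma is_derive_add1 y : is_derive y 1 (fun y : R => 1 + y) 1.
Proof.
have h := @is_deriveD R R^o R^o (cst 1) id y 1 0 1 (is_derive_cst _ _ _) (is_derive_id _ _).
by rewrite add0r in h.
Qed.

Lemma zt_bounds y : 0 <= y <= 1 -> - ln 2 <= zt y <= 0.
Proof.
move=> /andP[y0 y1]; rewrite /zt lerN2 oppr_le0 ln_ge0 ?andbT; last lra.
by rewrite ler_ln ?posrE//; lra.
Qed.

Lemma zt_decr x y : 0 <= x -> x <= y -> zt y <= zt x.
Proof. by move=> x0 xy; rewrite /zt lerN2 ler_ln ?posrE//; lra. Qed.

Lemma bb_0 t y : 0 <= y -> bb t 0 y = (1 + y) / 2.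
Proof.
by move=> y0; rewrite /bb /Gb Gam_0 /zt opprK lnK// posrE; lra.
Qed.

Lemma is_derive_zt y : 0 <= y -> is_derive y 1 zt (- (1 + y)^-1).
Proof.
move=> y0; have h : 0 < 1 + y by lra.
have d1 := is_derive_add1 y.
have d2 := @is_derive1_comp R (@ln R) (fun y : R => 1 + y) y _ _ (is_derive1_ln h) d1.
apply: (is_derive_eq (is_deriveN d2)).
by rewrite mulr1.
Qed.

Lemma is_derive_bb t n y : Th t -> 0 <= y -> is_derive y 1 (bb t n) (bb1 t n y).
Proof.
move=> tT y0; have dz := is_derive_zt y0.
have dG := @is_derive1_comp R (Gam t n) zt y _ _ (is_derive_Gam (Th01 tT) n (zt y)) dz.
have de := @is_derive1_comp R expR (fun y => - Gam t n (zt y)) y _ _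
  (is_derive_expR _) (is_deriveN dG).
have dm := @is_deriveM R R^o (fun y => expR (- Gam t n (zt y))) (cst 2^-1) y 1 _ _
  de (is_derive_cst _ _ _).
apply: (is_derive_eq dm).
rewrite /bb1 /bb /Gb /GRing.scale/=; ring.
Qed.

Let dcomp y (f : R -> R) (d : R) : 0 <= y -> is_derive (zt y) 1 f d ->
  is_derive y 1 (fun y => f (zt y)) (- (d / (1 + y))).
Proof.
move=> y0 fd; have := @is_derive1_comp R f zt y _ _ fd (is_derive_zt y0).
by rewrite mulrN.
Qed.

Let dinv y : 0 <= y -> is_derive y 1 (fun y : R => (1 + y)^-1) (- (1 + y) ^- 2).
Proof.
move=> y0; have h : 1 + y != 0 by rewrite lt0r_neq0//; lra.
have d1 := is_derive_add1 y.
apply: (is_derive_eq (@is_deriveV R (fun y : R => 1 + y) y _ 1 h d1)).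
by rewrite /GRing.scale/= mulr1.
Qed.

Lemma is_derive_bb1 t n y : Th t -> 0 <= y -> is_derive y 1 (bb1 t n) (bb2 t n y).
Proof.
move=> tT y0; have db := is_derive_bb n tT y0.
have dp := dcomp y0 (is_derive_pG (Th01 tT) n (zt y)).
have h : 1 + y != 0 by rewrite lt0r_neq0//; lra.
apply: (is_derive_eq (is_deriveM (is_deriveM db dp) (dinv y0))).
by rewrite !fctE /bb2 /bb1 /GRing.scale/=; field.
Qed.

(** The logarithmic derivative of [bb1]. *)
Definition Db t n y := (pG t n (zt y) - qG t n (zt y) - 1) / (1 + y).
(** The derivative of [Db]. *)
Definition Db1 t n y := - (pG t n (zt y) * qG t n (zt y) - q1G t n (zt y)) / (1 + y) ^+ 2
   - Db t n y / (1 + y).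
Definition bb3 t n y := bb1 t n y * (Db t n y ^+ 2 + Db1 t n y).

Lemma is_derive_bb2 t n y : Th t -> 0 <= y -> is_derive y 1 (bb2 t n) (bb3 t n y).
Proof.
move=> tT y0; have db := is_derive_bb1 n tT y0.
have dp := dcomp y0 (is_derive_pG (Th01 tT) n (zt y)).
have dq := dcomp y0 (is_derive_qG (Th01 tT) n (zt y)).
have h : 1 + y != 0 by rewrite lt0r_neq0//; lra.
have dD : is_derive y 1 (fun y => pG t n (zt y) - qG t n (zt y) - 1)
   (- ((pG t n (zt y) * qG t n (zt y) - q1G t n (zt y)) / (1 + y))).
  by apply: (is_derive_eq (is_deriveB (is_deriveB dp dq) (@is_derive_cst R R^o R^o 1 y 1))); ring.
apply: (is_derive_eq (is_deriveM db (is_deriveM dD (dinv y0)))).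
by rewrite !fctE /bb3 /Db1 /Db /bb2 /GRing.scale/=; field.
Qed.

Lemma Db_le t n y : Th t -> 0 <= y -> `|Db t n y| <= 2.
Proof.
move=> tT y0; have tt := Th01 tT.
have := pG_gt0 tt n (zt y); have := pG_le1 tt n (zt y).
have /andP[] := qG_le1 tt n (zt y) => q0 q1 p1 p0.
have h : 1 <= 1 + y by lra.
rewrite /Db normrM normfV ler_pdivrMr ?normr_gt0 ?lt0r_neq0//; last lra.
apply: (@le_trans _ _ 2); first by rewrite ler_norml; lra.
by rewrite ler_peMr// ger0_norm//; lra.
Qed.

Lemma Db1_le t n y : Th t -> 0 <= y -> `|Db1 t n y| <= 5.
Proof.
move=> tT y0; have tt := Th01 tT.
have := pG_gt0 tt n (zt y); have := pG_le1 tt n (zt y).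
have /andP[] := qG_le1 tt n (zt y) => q0 q1 p1 p0; have q2 := q1G_le2 tt n (zt y).
have h : 1 <= 1 + y by lra.
have dD := Db_le n tT y0.
have h1 : `|- (pG t n (zt y) * qG t n (zt y) - q1G t n (zt y)) / (1 + y) ^+ 2| <= 3.
  have h2 : 1 <= (1 + y) ^+ 2 by rewrite exprn_ege1.
  rewrite normrM normfV ler_pdivrMr ?normr_gt0 ?lt0r_neq0//; last lra.
  rewrite normrN; apply: (@le_trans _ _ 3).
    apply: le_trans (ler_normB _ _) _.
    have : `|pG t n (zt y) * qG t n (zt y)| <= 1.
      by rewrite ger0_norm ?mulr_ge0 ?(ltW p0)// mulr_ile1// ltW.
    lra.
  by rewrite ler_peMr// ger0_norm//; lra.
have h3 : `|Db t n y / (1 + y)| <= 2.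
  rewrite normrM normfV ler_pdivrMr ?normr_gt0 ?lt0r_neq0//; last lra.
  by apply: le_trans dD _; rewrite ler_peMr// ger0_norm//; lra.
by apply: le_trans (ler_normB _ _) _; lra.
Qed.

Lemma bb1_gt0 t n y : Th t -> 0 <= y -> 0 < bb1 t n y.
Proof.
move=> tT y0; rewrite /bb1 divr_gt0//; last lra.
by rewrite mulr_gt0 ?Gb_gt0 ?(pG_gt0 (Th01 tT)).
Qed.

Lemma bb1_le_bb t n y : Th t -> 0 <= y -> bb1 t n y <= bb t n y.
Proof.
move=> tT y0; have p1 := pG_le1 (Th01 tT) n (zt y).
have p0 := ltW (pG_gt0 (Th01 tT) n (zt y)); have b0 := ltW (Gb_gt0 t n (zt y)).
rewrite /bb1 /bb ler_pdivrMr; last lra.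
by apply: ler_pM => //; lra.
Qed.

Lemma bb2_le t n y : Th t -> 0 <= y -> `|bb2 t n y| <= 2 * bb1 t n y.
Proof.
move=> tT y0; have b0 := ltW (bb1_gt0 n tT y0).
rewrite /bb2 -/(Db t n y) normrM (ger0_norm b0) mulrC ler_wpM2r//.
exact: Db_le.
Qed.

Lemma bb3_le t n y : Th t -> 0 <= y -> `|bb3 t n y| <= 9 * bb1 t n y.
Proof.
move=> tT y0; have b0 := ltW (bb1_gt0 n tT y0).
rewrite /bb3 normrM (ger0_norm b0) mulrC ler_wpM2r//.
apply: le_trans (ler_normD _ _) _; have h1 := Db1_le n tT y0; have h2 := Db_le n tT y0.
have : `|Db t n y ^+ 2| <= 4.
  rewrite normrX expr2 (_ : 4 = 2 * 2); last by ring.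
  exact: ler_pM.
lra.
Qed.

Lemma bb1_half t n y : Th t -> 0 <= y <= 1 -> bb1 t n y <= 2^-1.
Proof.
move=> tT /[dup] y01 /andP[y0 y1]; case: n => [|n].
  rewrite /bb1 bb_0// pG_0 mulr1 mulrAC divff ?mul1r//.
  by rewrite lt0r_neq0//; lra.
apply: le_trans (bb1_le_bb n.+1 tT y0) _.
by apply: Gb_half => //; have /andP[] := zt_bounds y01.
Qed.

(** All bounds are uniform in the parameter: the logarithmic derivatives of the
    branches and of their derivatives are bounded by absolute constants, since
    [pG], [qG] and [q1G] are. *)
Lemma bb_branches t : Th t -> branches MM (9 * expR 2) (bb t) (bb1 t) (bb2 t).
Proof.
move=> tT; have tt := Th01 tT.
have cc n y : 0 <= y <= 1 -> 0 <= bb t n y <= 1.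
  move=> /[dup] y01 /andP[y0 y1]; rewrite ltW ?Gb_gt0//=; case: n => [|n].
    by rewrite bb_0//; lra.
  have /andP[z1 _] := zt_bounds y01.
  by have := Gb_half n tT z1; rewrite -/(bb _ _ _); lra.
have wk y : 0 < y < 1 -> 0 <= y <= 1 by lra.
have w0 y : 0 < y < 1 -> 0 <= y by lra.
have b1M n y : 0 < y < 1 -> `|bb1 t n y| <= MM n.
  move=> y01; rewrite ger0_norm; last exact: ltW (bb1_gt0 n tT (w0 _ y01)).
  apply: le_trans (bb1_le_bb n tT (w0 _ y01)) _.
  by apply: Gb_M => //; have /andP[] := zt_bounds (wk _ y01).
have b1h n y : 0 < y < 1 -> `|bb1 t n y| <= 2^-1.
  move=> y01; rewrite ger0_norm; last exact: ltW (bb1_gt0 n tT (w0 _ y01)).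
  exact: bb1_half (wk _ y01).
split.
- exact: MM_summable.
- by rewrite mulr_ge0// expR_ge0.
- exact: cc.
- move=> n y y01; rewrite Gb_gt0/=; case: n => [|n].
    by rewrite bb_0; lra.
  have /andP[z1 _] := zt_bounds (wk _ y01).
  by have := Gb_half n tT z1; rewrite -/(bb _ _ _); lra.
- move=> n x y x0 xy y1; rewrite /bb /Gb ler_wpM2r ?invr_ge0// ler_expR lerN2.
  by apply: Gam_le => //; exact: zt_decr.
- move=> n; apply: (@lip_closed _ _ (bb1 t n)) => [y /andP[y0 _]|y y01]; last exact: b1M.
  exact: is_derive_bb.
- move=> n; apply: (@lip_closed _ _ (bb1 t n)) => [y /andP[y0 _]|y y01]; last exact: b1h.
  exact: is_derive_bb.
- by move=> n y y01; apply: is_derive_bb => //; exact: w0.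
- by move=> n y y01; apply: is_derive_bb1 => //; exact: w0.
- by move=> n y y01; apply/ltW/bb1_gt0 => //; exact: w0.
- by move=> n y y01; exact: le_trans (ler_norm _) (b1h _ _ y01).
- by move=> n y y01; exact: le_trans (ler_norm _) (b1M _ _ y01).
- by move=> n y y01; apply: bb2_le => //; exact: w0.
- move=> n x y x01 y01.
  rewrite mulrAC; apply: (@MVT_bound _ (bb2 t n) (bb3 t n) 0 1) => // z z01.
    by apply: is_derive_bb2 => //; exact: w0.
  apply: le_trans (bb3_le n tT (w0 _ z01)) _; rewrite -mulrA ler_wpM2l//.
  apply: (@loglip_le _ (bb1 t n) (bb2 t n)) => // u u01.
  + by apply: is_derive_bb1 => //; exact: w0.
  + by apply/ltW/bb1_gt0 => //; exact: w0.
  + by apply: bb2_le => //; exact: w0.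
- by rewrite bb_0//; lra.
- move=> n; rewrite /bb /Gb /zt addr0 ln1 oppr0 (_ : 1 + 1 = 2)//.
  by rewrite /Gam iterSr gam_ln2//; case/andP: tt => /ltW.
- apply: (squeeze0 (v := MM)) => [n|].
    have h0 : 0 <= (0 : R) <= 1 by lra.
    rewrite subr0 ger0_norm; last exact: ltW (Gb_gt0 _ _ _).
    by apply: Gb_M => //; have /andP[] := zt_bounds h0.
  exact: cvg_series_cvg_0 MM_summable.2.
Qed.

End LSVBranches.

(** * Dependence of the inverse branches on the parameter *)

Section ParameterLipschitz.
Context {R : realType}.
Variables (a0 a1 : R).
Hypotheses (a00 : 0 < a0) (a01 : a0 <= a1) (a11 : a1 < 1).
Implicit Types (s t z y : R) (n : nat).
Local Notation Th := (Th a0 a1).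
Local Notation MM := (MM a0 a1).

Let Th01 t : Th t -> 0 < t <= 1.
Proof.
move=> /andP[h1 h2]; apply/andP; split; first exact: lt_le_trans a00 h1.
exact: le_trans h2 (ltW a11).
Qed.

(** Each differentiation in the parameter costs one factor of this size, in view
    of [Gam_pair]. *)
Definition Wt t n z : R := 1 + Gam t n z / a0.

Lemma Gam_lip s t n z : Th s -> Th t -> s <= t -> - ln 2 <= z ->
  [/\ 0 <= Gam t n.+1 z, 1 + Gam s n.+1 z <= Wt t n.+1 z &
    0 <= Gam s n.+1 z - Gam t n.+1 z <= (t - s) * (Gam t n.+1 z / a0)].
Proof.
move=> sT tT st hz; have /andP[s0 _] := Th01 sT; have /andP[_ t1] := Th01 tT.
have [X0 XY w wd] := Gam_pair s0 st t1 hz n.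
have a0s : a0 <= s by case/andP: sT.
have Y0 : 0 <= Gam s n.+1 z by exact: le_trans XY.
split => //.
- rewrite /Wt lerD2l ler_pdivlMr//.
  apply: (@le_trans _ _ (s * Gam s n.+1 z)).
    by rewrite mulrC; exact: ler_wpM2r.
  by apply: le_trans w _; rewrite ler_piMl.
- rewrite subr_ge0 XY/= mulrA ler_pdivlMr// mulrC; apply: le_trans wd.
  by apply: ler_wpM2r => //; rewrite subr_ge0.
Qed.

Lemma Gb_diff s t n z : Th s -> Th t -> s <= t -> - ln 2 <= z ->
  `|Gb t n.+1 z - Gb s n.+1 z| <=
    (t - s) * (2^-1 * Wt t n.+1 z * expR (- Gam t n.+1 z)).
Proof.
move=> sT tT st hz; have [X0 W /andP[d0 dd]] := Gam_lip n sT tT st hz.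
have e0 := expR_gt0 (- Gam t n.+1 z).
rewrite /Gb -mulrBl normrM [`|2^-1|]ger0_norm ?invr_ge0//.
have h1 := expR_ge1Dx (- (Gam s n.+1 z - Gam t n.+1 z)).
have h2 : expR (- Gam s n.+1 z) = expR (- Gam t n.+1 z) *
    expR (- (Gam s n.+1 z - Gam t n.+1 z)) by rewrite -expRD; congr expR; ring.
have h3 : expR (- (Gam s n.+1 z - Gam t n.+1 z)) <= 1.
  by rewrite -[leRHS]expR0 ler_expR oppr_le0.
rewrite ger0_norm; last by rewrite subr_ge0 h2 ler_piMr// ltW.
have st0 : 0 <= t - s by rewrite subr_ge0.
have h4 : expR (- Gam t n.+1 z) - expR (- Gam s n.+1 z) <=
    expR (- Gam t n.+1 z) * (Gam s n.+1 z - Gam t n.+1 z).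
  by rewrite h2; have := ler_wpM2l (ltW e0) h1; lra.
have h5 : Gam s n.+1 z - Gam t n.+1 z <= (t - s) * Wt t n.+1 z.
  by apply: le_trans dd _; rewrite ler_wpM2l// /Wt lerDr.
have := ler_wpM2l (ltW e0) h5; lra.
Qed.

Lemma Wt_ge1 t n z : Th t -> - ln 2 <= z -> 1 <= Wt t n.+1 z.
Proof.
move=> tT hz; rewrite /Wt lerDl divr_ge0//; last exact: ltW.
exact: (Gam_ge0 (Th01 tT)).
Qed.

Lemma W_pow t n z : Th t -> - ln 2 <= z ->
  [/\ Wt t n.+1 z <= Wt t n.+1 z ^+ 2, Wt t n.+1 z ^+ 2 <= Wt t n.+1 z ^+ 3,
   1 <= Wt t n.+1 z & 1 <= Wt t n.+1 z ^+ 3].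
Proof.
move=> tT hz; have W1 := Wt_ge1 n tT hz; split => //.
- by rewrite expr2 ler_peMr//; lra.
- by rewrite [leRHS]exprSr ler_peMr// exprn_ge0//; lra.
- by rewrite exprn_ege1.
Qed.

(** The parameter estimates compare an ordered pair; this makes them
    symmetric. *)
Lemma symm_lip (f : R -> R) (C : R) :
  (forall s t, Th s -> Th t -> s <= t -> `|f t - f s| <= (t - s) * C) ->
  forall s t, Th s -> Th t -> `|f s - f t| <= `|s - t| * C.
Proof.
move=> h s t sT tT; have [st|ts] := leP s t.
- by rewrite distrC (distrC s) [`|t - s|]ger0_norm ?subr_ge0//; exact: h.
- rewrite [`|s - t|]ger0_norm; last by rewrite subr_ge0 ltW.
  by apply: h => //; exact: ltW.
Qed.

Lemma Gb_lip s t n z : Th s -> Th t -> - ln 2 <= z ->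
  `|Gb s n z - Gb t n z| <= `|s - t| * MM n.
Proof.
move=> sT tT hz; move: s t sT tT; apply: symm_lip => s t sT tT st.
have st0 : 0 <= t - s by rewrite subr_ge0.
case: n => [|n].
  by rewrite /Gb !Gam_0 subrr normr0 mulr_ge0// (MM_ge0 a00 a01 a11).
apply: le_trans (Gb_diff n sT tT st hz) _; rewrite ler_wpM2l//.
apply: le_trans (MM_bound a00 a01 a11 n tT hz); rewrite -/(Wt _ _ _).
have [w2 w3 w1 w4] := W_pow n tT hz.
rewrite ler_wpM2r ?expR_ge0//; lra.
Qed.

Lemma bb_lip s t n y : Th s -> Th t -> 0 <= y <= 1 ->
  `|bb s n y - bb t n y| <= `|s - t| * MM n.
Proof. by move=> sT tT y01; apply: Gb_lip => //; case/andP: (zt_bounds y01). Qed.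

Lemma pq_lip s t n z : Th s -> Th t -> s <= t -> - ln 2 <= z ->
  `|pG t n.+1 z - pG s n.+1 z| <= (t - s) * Wt t n.+1 z ^+ 2 /\
  `|qG t n.+1 z - qG s n.+1 z| <= (t - s) * (3 * Wt t n.+1 z ^+ 3).
Proof.
move=> sT tT st hz; have [X0 W /andP[d0 dd]] := Gam_lip n sT tT st hz.
have /andP[s0 _] := Th01 sT; have /andP[_ t1] := Th01 tT.
have st0 : 0 <= t - s by rewrite subr_ge0.
have Y0 : 0 <= 1 + Gam s n.+1 z by lra.
split.
- apply: le_trans (pG_pair2 s0 st t1 hz n) _; rewrite ler_wpM2l//.
  by apply: lerXn2r => //; rewrite nnegrE; lra.
- apply: le_trans (qG_pair3 s0 st t1 hz n) _; rewrite ler_wpM2l// ler_wpM2l//.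
  by apply: lerXn2r => //; rewrite nnegrE; lra.
Qed.

Lemma bb1_diff s t n y : Th s -> Th t -> s <= t -> 0 < y < 1 ->
  `|bb1 t n.+1 y - bb1 s n.+1 y| <=
   (t - s) * (Wt t n.+1 (zt y) ^+ 2 * expR (- Gam t n.+1 (zt y))).
Proof.
move=> sT tT st y01; have y01' : 0 <= y <= 1 by lra.
have /andP[hz _] := zt_bounds y01'.
have hb := Gb_diff n sT tT st hz; have [hp hq] := pq_lip n sT tT st hz.
have pt0 := pG_gt0 (Th01 tT) n.+1 (zt y); have pt1 := pG_le1 (Th01 tT) n.+1 (zt y).
have [X0 W /andP[d0 dd]] := Gam_lip n sT tT st hz.
have [w2 w3 w1 w4] := W_pow n tT hz.
have st0 : 0 <= t - s by rewrite subr_ge0.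
have e0 := expR_gt0 (- Gam t n.+1 (zt y)).
have bs : 0 < Gb s n.+1 (zt y) <= 2^-1 * expR (- Gam t n.+1 (zt y)).
  apply/andP; split; first exact: Gb_gt0.
  rewrite /Gb mulrC; apply: ler_wpM2l; first by rewrite invr_ge0.
  by rewrite ler_expR; lra.
rewrite /bb1 /bb; move: hb hp pt0 pt1 bs e0 w2 w1.
move: (Gb t _ _) (Gb s _ _) (pG t _ _) (pG s _ _) (Wt _ _ _) (expR _) => B B' p p' w e.
move=> hb hp p0 p1 /andP[b0 be] e0 w2 w1.
rewrite -mulrBl normrM normfV ler_pdivrMr ?normr_gt0 ?lt0r_neq0//; last lra.
apply: (@le_trans _ _ ((t - s) * (w ^+ 2 * e))); last first.
  have we : 0 <= w ^+ 2 * e by rewrite mulr_ge0 ?exprn_ge0 ?ltW//; lra.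
  have h0 := mulr_ge0 st0 we; apply: ler_peMr => //; rewrite ger0_norm; lra.
rewrite (_ : _ - _ = (B - B') * p + B' * (p - p')); last by ring.
have h1 : `|(B - B') * p| <= (t - s) * (2^-1 * w * e) * 1.
  by rewrite normrM (ger0_norm (ltW p0)); apply: ler_pM => //; exact: ltW.
have h2 : `|B' * (p - p')| <= (2^-1 * e) * ((t - s) * w ^+ 2).
  by rewrite normrM (gtr0_norm b0); apply: ler_pM => //; exact: ltW.
apply: le_trans (ler_normD _ _) _; apply: le_trans (lerD h1 h2) _.
have := ler_wpM2l (mulr_ge0 st0 (ltW e0)) w2; lra.
Qed.

Lemma bb1_lip s t n y : Th s -> Th t -> 0 < y < 1 ->
  `|bb1 s n y - bb1 t n y| <= `|s - t| * MM n.
Proof.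
move=> sT tT y01; move: s t sT tT; apply: symm_lip => s t sT tT st.
have y01' : 0 <= y <= 1 by lra.
have /andP[hz _] := zt_bounds y01'.
have st0 : 0 <= t - s by rewrite subr_ge0.
case: n => [|n].
  rewrite /bb1 /bb /Gb !Gam_0 !pG_0 subrr normr0 mulr_ge0//.
  exact: (MM_ge0 a00 a01 a11).
apply: le_trans (bb1_diff n sT tT st y01) _; rewrite ler_wpM2l//.
apply: le_trans (MM_bound a00 a01 a11 n tT hz); rewrite -/(Wt _ _ _).
have [w2 w3 w1 w4] := W_pow n tT hz.
rewrite ler_wpM2r ?expR_ge0//; lra.
Qed.

Lemma bb2_lip s t n y : Th s -> Th t -> 0 < y < 1 ->
  `|bb2 s n y - bb2 t n y| <= `|s - t| * MM n.
Proof.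
move=> sT tT y01; move: s t sT tT; apply: symm_lip => s t sT tT st.
have y01' : 0 <= y <= 1 by lra.
have y0 : 0 <= y by lra.
have /andP[hz _] := zt_bounds y01'.
have st0 : 0 <= t - s by rewrite subr_ge0.
case: n => [|n].
  rewrite /bb2 /bb1 /bb /Gb !Gam_0 !pG_0 !qG_0 subrr normr0 mulr_ge0//.
  exact: (MM_ge0 a00 a01 a11).
have hb := bb1_diff n sT tT st y01; have [hp hq] := pq_lip n sT tT st hz.
have [w2 w3 w1 w4] := W_pow n tT hz.
have [X0 W /andP[d0 dd]] := Gam_lip n sT tT st hz.
apply: (@le_trans _ _ ((t - s) * (8 * Wt t n.+1 (zt y) ^+ 3 * expR (- Gam t n.+1 (zt y)))));
  last by rewrite ler_wpM2l// (MM_bound a00 a01 a11 n tT hz).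
have e0 := expR_gt0 (- Gam t n.+1 (zt y)).
have bs : bb1 s n.+1 y <= 2^-1 * expR (- Gam t n.+1 (zt y)).
  apply: le_trans (bb1_le_bb a00 a11 n.+1 sT y0) _.
  rewrite /bb /Gb mulrC; apply: ler_wpM2l; first by rewrite invr_ge0.
  by rewrite ler_expR; lra.
have bs0 := bb1_gt0 a00 a11 n.+1 sT y0.
have Dt := Db_le a00 a11 n.+1 tT y0.
rewrite /bb2 -!/(Db _ _ _).
have dD : `|Db t n.+1 y - Db s n.+1 y| <= (t - s) * (4 * Wt t n.+1 (zt y) ^+ 3).
  rewrite /Db -mulrBl normrM normfV ler_pdivrMr ?normr_gt0 ?lt0r_neq0//; last lra.
  apply: (@le_trans _ _ ((t - s) * (4 * Wt t n.+1 (zt y) ^+ 3))); last first.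
    have h0 : 0 <= (t - s) * (4 * Wt t n.+1 (zt y) ^+ 3).
      by rewrite mulr_ge0// mulr_ge0//; lra.
    by rewrite ler_peMr// ger0_norm; lra.
  rewrite (_ : _ - _ = (pG t n.+1 (zt y) - pG s n.+1 (zt y)) -
    (qG t n.+1 (zt y) - qG s n.+1 (zt y))); last by ring.
  apply: le_trans (ler_normB _ _) _; apply: le_trans (lerD hp hq) _.
  have := ler_wpM2l st0 w3; lra.
move: hb bs bs0 Dt dD e0 w2 w3 w1.
move: (bb1 t _ _) (bb1 s _ _) (Db t _ _) (Db s _ _) (Wt _ _ _) (expR _) => B B' D D' w e.
move=> hb bs bs0 Dt dD e0 w2 w3 w1.
rewrite (_ : _ - _ = (B - B') * D + B' * (D - D')); last by ring.
have h1 : `|(B - B') * D| <= (t - s) * (w ^+ 2 * e) * 2.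
  by rewrite normrM; apply: ler_pM.
have h2 : `|B' * (D - D')| <= (2^-1 * e) * ((t - s) * (4 * w ^+ 3)).
  by rewrite normrM (gtr0_norm bs0); apply: ler_pM => //; exact: ltW.
apply: le_trans (ler_normD _ _) _; apply: le_trans (lerD h1 h2) _.
have h3 := ler_wpM2l (mulr_ge0 st0 (ltW e0)) w3.
have h4 : 0 <= (t - s) * e * w ^+ 3.
  by apply: mulr_ge0 (mulr_ge0 st0 (ltW e0)) _; apply: exprn_ge0; lra.
lra.
Qed.

Section Sequences.
Variables (al : R) (be ga : nat -> R).
Hypotheses (hal : Th al) (hbe : forall m, Th (be m)) (hga : forall m, Th (ga m)).
Hypotheses (cbe : be m @[m --> \oo] --> al) (cga : ga m @[m --> \oo] --> al).
Hypothesis bega : forall m, be m != ga m.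

(** The derivative of [Gam t n z] in [t], at the parameter [al]. *)
Fixpoint VG n z : R :=
  if n is n'.+1 then (VG n' z - sG al n z * Gam al n z) / (1 + al * sG al n z) else 0.

Lemma Gam_cvg (se : nat -> R) n z : (forall m, Th (se m)) ->
  se m @[m --> \oo] --> al -> - ln 2 <= z ->
  Gam (se m) n z @[m --> \oo] --> Gam al n z.
Proof.
move=> hse cse hz; case: n => [|n].
  rewrite Gam_0 (_ : (fun m => _) = (fun=> z)); first exact: cvg_cst.
  by apply/funext => m; rewrite Gam_0.
have T0 : Th a0 by rewrite /Th/= lexx a01.
apply: (squeeze0 (v := fun m => (Gam a0 n.+1 z / a0) * `|se m - al|)); last exact: cvg_dist0.
move=> m; rewrite mulrC.
move: (se m) al (hse m) hal; apply: symm_lip => s t sT tT st.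
have [X0 W /andP[d0 dd]] := Gam_lip n sT tT st hz.
rewrite distrC ger0_norm//; apply: le_trans dd _.
rewrite ler_wpM2l ?subr_ge0// ler_wpM2r ?invr_ge0 ?(ltW a00)//.
by apply: Gam_anti => //; case/andP: tT.
Qed.

Lemma quot_comp (f df : R -> R) (u w : nat -> R) (l : R) :
  (forall z, is_derive z 1 f (df z)) ->
  (forall v : nat -> R, v m @[m --> \oo] --> l -> df (v m) @[m --> \oo] --> df l) ->
  u m @[m --> \oo] --> l -> w m @[m --> \oo] --> l ->
  exists xi : nat -> R, xi m @[m --> \oo] --> l /\
    forall m, f (u m) - f (w m) = df (xi m) * (u m - w m).
Proof.
move=> fd dfc ul wl.
have /choice[z hz] : forall m, exists z, `|z - w m| <= `|u m - w m| /\
    f (u m) - f (w m) = df z * (u m - w m).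
  move=> m; have [z [_ z2 z3]] := @MVT_between R f df (u m) (w m) (fun z _ => fd z).
  by exists z.
exists z; split; last by move=> m; case: (hz m).
apply: (squeeze0 (v := fun m => 1 * `|u m - l| + 2 * `|w m - l|)).
  move=> m; have [h _] := hz m.
  have := ler_distD (w m) (z m) l; have := ler_distD l (u m) (w m).
  by rewrite (distrC l (w m)); lra.
by rewrite -[X in _ --> X]addr0; apply: cvgD; exact: cvg_dist0.
Qed.

(** Implicit differentiation of Gam_(n+1) = Gam_n + lg (t Gam_(n+1)), along
    a pair of sequences. *)
Lemma Gam_quot n z : - ln 2 <= z ->
  (Gam (be m) n z - Gam (ga m) n z) / (be m - ga m) @[m --> \oo] --> VG n z.
Proof.
move=> hz; have nz m : be m - ga m != 0 by rewrite subr_eq0.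
elim: n => [|n ih].
  rewrite (_ : (fun m => _) = (fun=> 0)); first exact: cvg_cst.
  by apply/funext => m; rewrite !Gam_0 subrr mul0r.
have cX := Gam_cvg (n := n.+1) hbe cbe hz; have cY := Gam_cvg (n := n.+1) hga cga hz.
have [xi [xil hxi]] := @quot_comp lg (fun w => - sg w)
  (fun m => be m * Gam (be m) n.+1 z) (fun m => ga m * Gam (ga m) n.+1 z)
  (al * Gam al n.+1 z) is_derive_lg (fun v hv => cvgN (sg_lim hv))
  (cvgM cbe cX) (cvgM cga cY).
have sxi := sg_lim xil; rewrite -sGE in sxi.
have al0 : 0 < al by case/andP: (Th01 hal).
rewrite (_ : (fun m => _) = (fun m =>
  ((Gam (be m) n z - Gam (ga m) n z) / (be m - ga m) - sg (xi m) * Gam (ga m) n.+1 z) /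
  (1 + be m * sg (xi m)))); last first.
  apply/funext => m; have h := hxi m.
  have b0 : 0 < be m by case/andP: (Th01 (hbe m)).
  have e0 : 1 + be m * sg (xi m) != 0.
    by rewrite lt0r_neq0// ltr_wpDr// mulr_ge0// ltW// sg_gt0.
  have hX := Gam_S (Th01 (hbe m)) n z; have hY := Gam_S (Th01 (hga m)) n z.
  have key : (Gam (be m) n.+1 z - Gam (ga m) n.+1 z) * (1 + be m * sg (xi m)) =
     (Gam (be m) n z - Gam (ga m) n z) - sg (xi m) * Gam (ga m) n.+1 z * (be m - ga m).
    move: h hX hY; move: (lg _) (lg _) => l2 l1 h hX hY.
    have -> : Gam (be m) n z = Gam (be m) n.+1 z - l1 by lra.
    have -> : Gam (ga m) n z = Gam (ga m) n.+1 z - l2 by lra.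
    have -> : l1 = l2 + - sg (xi m) * (be m * Gam (be m) n.+1 z - ga m * Gam (ga m) n.+1 z).
      by rewrite -h; ring.
    ring.
  apply: (mulIf e0); rewrite [RHS]divfK// mulrAC key.
  by rewrite mulrBl mulfK.
apply: cvgM.
  by apply: cvgB => //; exact: cvgM.
apply: cvgV; last first.
  by apply: cvgD; [exact: cvg_cst|exact: cvgM].
by rewrite lt0r_neq0// ltr_wpDr// mulr_ge0 ?ltW// sG_gt0.
Qed.

Lemma Gb_quot n z : - ln 2 <= z ->
  (Gb (be m) n z - Gb (ga m) n z) / (be m - ga m) @[m --> \oo] -->
    - Gb al n z * VG n z.
Proof.
move=> hz.
have cX := Gam_cvg (n := n) hbe cbe hz; have cY := Gam_cvg (n := n) hga cga hz.
have ec (v : nat -> R) (l : R) : v m @[m --> \oo] --> l ->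
    expR (v m) @[m --> \oo] --> expR l.
  by move=> vl; apply: (continuous_cvg _ _ vl); exact: continuous_expR.
have [xi [xil hxi]] := @quot_comp expR expR
  (fun m => - Gam (be m) n z) (fun m => - Gam (ga m) n z)
  (- Gam al n z) (@is_derive_expR R) (fun v hv => ec v _ hv)
  (cvgN cX) (cvgN cY).
rewrite (_ : (fun m => _) = (fun m => - (expR (xi m) / 2) *
  ((Gam (be m) n z - Gam (ga m) n z) / (be m - ga m)))); last first.
  by apply/funext => m; rewrite /Gb -mulrBl (hxi m); ring.
apply: cvgM; last exact: Gam_quot.
by apply: cvgN; apply: cvgMl; exact: ec.
Qed.

End Sequences.

(** Only for n = 0 may the point be 1, and then it does not depend on the
    parameter: the alternative required by [U_quot]. *)
Lemma Gb_int n z : - ln 2 <= z -> (forall t, Th t -> 0 < Gb t n z < 1) \/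
  (forall s t, Th s -> Th t -> Gb s n z = Gb t n z).
Proof.
move=> hz; case: n => [|n]; [right|left].
  by move=> s t _ _; rewrite /Gb !Gam_0.
by move=> t tT; rewrite Gb_gt0/=; have := Gb_half a00 a11 n tT hz; lra.
Qed.

Lemma Gb_01 t n z : Th t -> - ln 2 <= z -> 0 <= Gb t n z <= 1.
Proof.
move=> tT hz; rewrite ltW ?Gb_gt0//=; case: n => [|n].
  rewrite /Gb Gam_0 ler_pdivrMr// mul1r.
  have -> : (2 : R) = expR (ln 2) by rewrite lnK// posrE.
  by rewrite ler_expR; lra.
by have := Gb_half a00 a11 n tT hz; lra.
Qed.

End ParameterLipschitz.

(** * Uniqueness among absolutely continuous fixed points *)

Section Dominated.
Context {R : realType}.

(** The total variation of [D] is dominated by the increments of [V].  This is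
    how a bound in L^1 of a density is expressed on distribution functions;
    it forces [V] to be nondecreasing on [0, 1]. *)
Definition increments_le (D V : R -> R) := forall x y, 0 <= x -> x <= y -> y <= 1 ->
  `|D y - D x| <= V y - V x.

Variables (M : nat -> R) (d2 : R) (b b1 b2 : nat -> R -> R).
Hypothesis br : branches M d2 b b1 b2.

Let Q := Qj b b1 b2.
Let U := invU b b1 b2.

Lemma increments_mono D V x y : increments_le D V -> 0 <= x -> x <= y -> y <= 1 -> V x <= V y.
Proof. by move=> dDV x0 xy y1; rewrite -subr_ge0; apply: le_trans (dDV x y _ _ _). Qed.

(** The intervals [b_n 0, b_n 1] tile ]0, 1], so the partial sums telescope
    to V 1 - V (b_N 1), and [V] is nondecreasing. *)
Lemma variation_summable D V : increments_le D V ->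
  summable_ge0 (fun n => V (b n 1) - V (b n 0)) /\
  tsum (fun n => V (b n 1) - V (b n 0)) <= V 1 - V 0.
Proof.
move=> dDV; have i1 : 0 <= (1 : R) <= 1 by rewrite lexx ler01.
have c0 n := br_cc0 br n; have c1 n := br_cc br n i1.
have t0 n : 0 <= V (b n 1) - V (b n 0).
  rewrite subr_ge0; apply: (increments_mono dDV); [by case/andP: (c0 n)| |by case/andP: (c1 n)].
  by apply: (br_ndecr br) => //; exact: ler01.
have sE N : series (fun n => V (b n 1) - V (b n 0)) N = V 1 - V (b N 1).
  rewrite seriesEnat/=; elim: N => [|N ih]; first by rewrite big_geq// (br_top br) subrr.
  by rewrite big_nat_recr//= ih (br_adj br); ring.
have sle N : series (fun n => V (b n 1) - V (b n 0)) N <= V 1 - V 0.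
  rewrite sE lerB//; apply: (increments_mono dDV) => //; by case/andP: (c1 N).
have cv : cvgn (series (fun n => V (b n 1) - V (b n 0))).
  apply: nondecreasing_is_cvgn; first exact: nondecreasing_series.
  by exists (V 1 - V 0) => _ [N _ <-].
by split => //; apply: limr_le => //; apply: nearW.
Qed.

Lemma increments_term D V x y n : increments_le D V -> 0 <= x -> x <= y -> y <= 1 ->
  `|D (b n y) - D (b n x)| <= 1 * (V (b n 1) - V (b n 0)).
Proof.
move=> dDV x0 xy y1; rewrite mul1r.
have cc z : 0 <= z -> z <= 1 -> 0 <= b n z <= 1 by move=> *; apply: (br_cc br); lra.
have x1 := le_trans xy y1; have y0 := le_trans x0 xy.
apply: le_trans (dDV _ _ _ _ _) _; first by case/andP: (cc x x0 x1).
- exact: (br_ndecr br).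
- by case/andP: (cc y y0 y1).
- apply: lerB; apply: (increments_mono dDV); try exact: (br_ndecr br).
  + by case/andP: (cc y y0 y1).
  + by case/andP: (cc 1 ler01 (lexx _)).
  + by case/andP: (cc 0 (lexx _) ler01).
  + by case/andP: (cc x x0 x1).
Qed.

Lemma increments_cvg D V y : increments_le D V -> 0 <= y <= 1 ->
  cvgn (series (fun n => D (b n y) - D (b n 0))).
Proof.
move=> dDV /andP[y0 y1]; have [sV _] := variation_summable dDV.
by apply: cvg_dom sV _ => n; apply: (increments_term n dDV).
Qed.

(** The transfer operator does not increase total variation. *)
Lemma increments_QK D V : increments_le D V ->
  increments_le (QK b D) (QK b V) /\ QK b V 1 - QK b V 0 <= V 1 - V 0.
Proof.
move=> dDV; have [sV tV] := variation_summable dDV.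
have dVV : increments_le V V.
  move=> x y x0 xy y1; rewrite ger0_norm// subr_ge0; exact: (increments_mono dDV).
have cc z n : 0 <= z -> z <= 1 -> 0 <= b n z <= 1 by move=> *; apply: (br_cc br); lra.
split; last by rewrite QK_0 subr0.
move=> x y x0 xy y1; have y0 := le_trans x0 xy; have x1 := le_trans xy y1.
rewrite /QK -!tsumB.
- set f := (fun n => _ - _ - _); set g := (fun n => _ - _ - _).
  have fg n : `|f n| <= g n.
    rewrite /f /g (_ : D _ - _ - _ = D (b n y) - D (b n x)); last by ring.
    rewrite (_ : V _ - _ - _ = V (b n y) - V (b n x)); last by ring.
    apply: dDV; last by case/andP: (cc y n y0 y1).
      by case/andP: (cc x n x0 x1).
    exact: (br_ndecr br).
  rewrite -[tsum g]mul1r; apply: tsum_norm; last by move=> n; rewrite mul1r.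
  split; first by move=> n; exact: le_trans (fg n).
  apply: cvg_dom sV _ => n.
  rewrite /g (_ : V _ - _ - _ = V (b n y) - V (b n x)); last by ring.
  exact: increments_term.
- by apply: (increments_cvg dVV); rewrite y0.
- by apply: (increments_cvg dVV); rewrite x0.
- by apply: (increments_cvg dDV); rewrite y0.
- by apply: (increments_cvg dDV); rewrite x0.
Qed.

Lemma jet_series_cvg C (J : @jet R) y : jet_bound C J -> 0 <= y <= 1 ->
  cvgn (series (fun n => jK J (b n y) - jK J (b n 0))).
Proof.
move=> jb y01; apply: cvg_dom (brM br) _ => n; apply: (QK_term br) y01; exact: jb_lip jb.
Qed.

Lemma fixed_series_cvg C (J : @jet R) V K y : jet_bound C J ->
  increments_le (fun y => K y - jK J y) V -> 0 <= y <= 1 ->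
  cvgn (series (fun n => K (b n y) - K (b n 0))).
Proof.
move=> jb dKV y01.
have := is_cvg_seriesD (increments_cvg dKV y01) (jet_series_cvg jb y01).
rewrite (_ : _ + _ = fun n => K (b n y) - K (b n 0))//.
by apply/funext => n; rewrite fctE/=; ring.
Qed.

Lemma increments_step C (J : @jet R) V K :
  (forall y : R, 0 <= y <= 1 -> K y = QK b K y) -> jet_bound C J ->
  increments_le (fun y => K y - jK J y) V ->
  increments_le (fun y => K y - jK (Q J) y) (QK b V) /\
  QK b V 1 - QK b V 0 <= V 1 - V 0.
Proof.
move=> fK jb dKV; have [h1 h2] := increments_QK dKV; split => //.
have e z : 0 <= z <= 1 -> K z - jK (Q J) z = QK b (fun y => K y - jK J y) z.
  move=> z01; rewrite [in LHS]fK//= /QK -tsumB.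
  - by congr tsum; apply/funext => n; ring.
  - exact: fixed_series_cvg jb dKV z01.
  - exact: jet_series_cvg jb z01.
move=> x y x0 xy y1; rewrite !e; first exact: h1.
- by rewrite x0 (le_trans xy).
- by rewrite (le_trans x0).
Qed.

Lemma increments_iter C (J : @jet R) V K j :
  (forall y : R, 0 <= y <= 1 -> K y = QK b K y) -> jet_bound C J ->
  increments_le (fun y => K y - jK J y) V ->
  exists2 W, increments_le (fun y => K y - jK (iter j Q J) y) W & W 1 - W 0 <= V 1 - V 0.
Proof.
move=> fK jb dKV; elim: j => [|j [W dW WV]]; first by exists V.
have [C' jb'] := iterQ_bound br j jb.
have [h1 h2] := increments_step fK jb' dW.
by exists (QK b W) => //; exact: le_trans h2 WV.
Qed.

(** Compare [K] to the iterates of a nearby jet [J]: being fixed, [K] stays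
    within the initial variation, while the iterates of [J] approach the
    multiple of [invU] with the mass of [J]. *)
Lemma fixed_near_invU C (J : @jet R) V K (y : R) :
  (forall y : R, 0 <= y <= 1 -> K y = QK b K y) -> jet_bound C J ->
  increments_le (fun y => K y - jK J y) V -> 0 <= y <= 1 ->
  `|K y - (jK J 1 - jK J 0) * jK U y| <= V 1 - V 0.
Proof.
move=> fK jb dKV y01; set m := jK J 1 - jK J 0.
(* subtract the multiple of the fixed point, to work with mass zero *)
set E := jet_lin 1 J (- m) U.
have i0 : 0 <= (0 : R) <= 1 by rewrite lexx ler01.
have jbE : jet_bound (`|1| * C + `|- m| * @CU R) E by exact: jet_bound_lin (invU_bound br).
have fK' z : 0 <= z <= 1 -> K z - m * jK U z = QK b (fun y => K y - m * jK U y) z.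
  move=> z01; rewrite {1}fK// -(je_K (invU_fix br) z01) /= /QK -tsumZ.
    rewrite -tsumB.
    - by congr tsum; apply/funext => n; rewrite /U; ring.
    - exact: fixed_series_cvg jb dKV z01.
    - exact: (@is_cvg_seriesZ R _ m (jet_series_cvg (invU_bound br) z01)).
  exact: jet_series_cvg (invU_bound br) z01.
have dE : increments_le (fun y => (K y - m * jK U y) - jK E y) V.
  move=> x z x0 xz z1; rewrite /E /=.
  rewrite (_ : _ - _ = K z - jK J z - (K x - jK J x)); last by ring.
  exact: dKV.
have K00 : K 0 - m * jK U 0 = 0 by rewrite fK'// QK_0.
set B := Bq * (C + `|m| * CU).
have h : B * rate ^+ j @[j --> \oo] --> B * (0 : R).
  apply: cvgMr; apply: cvg_expr.
  rewrite ger0_norm ?rate_ge0// /rate; have := @gap_gt0 R; lra.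
have h' : V 1 - V 0 + B * rate ^+ j @[j --> \oo] --> V 1 - V 0.
  rewrite -[X in _ --> X]addr0 -[X in _ --> _ + X](mulr0 B).
  by apply: cvgD => //; exact: cvg_cst.
apply: (ler_cvg_to (cvg_cst _) h'); apply: nearW => j.
have [W dW WV] := increments_iter j fK' jbE dE.
have bj := @fix_unique _ _ _ _ _ _ br C J j jb.
case/andP: (y01) => y0 y1.
have := dW 0 y (lexx _) y0 y1; have := jb_lip bj i0 y01.
rewrite K00 subr0 -/m -/U -/E -/B.
have Bj : 0 <= B * rate ^+ j.
  by apply: le_trans (jb_k bj (_ : 0 < (2^-1 : R) < 1)); [exact: normr_ge0|lra].
have : W y - W 0 <= W 1 - W 0 by apply: lerB => //; exact: (increments_mono dW).
have : B * rate ^+ j * `|y| <= B * rate ^+ j by rewrite ler_piMr// ger0_norm.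
rewrite !ler_norml; move: WV; rewrite -/Q.
move: (iter j Q E) => G; lra.
Qed.

(** In L^1 terms: a fixed density that is a limit of smooth ones is a multiple
    of the smooth fixed density. *)
Lemma fixed_unique (K : R -> R) :
  (forall y : R, 0 <= y <= 1 -> K y = QK b K y) ->
  (forall e : R, 0 < e -> exists C (J : @jet R) V,
    [/\ jet_bound C J, increments_le (fun y => K y - jK J y) V & V 1 - V 0 <= e]) ->
  forall y : R, 0 <= y <= 1 -> K y = K 1 * jK U y.
Proof.
move=> fK app y y01; apply/eqP; rewrite -subr_eq0 -normr_le0.
apply/ler_addgt0Pr => e e0; rewrite add0r.
have i1 : 0 <= (1 : R) <= 1 by rewrite lexx ler01.
have i0 : 0 <= (0 : R) <= 1 by rewrite lexx ler01.
have CU0 : 0 <= @CU R by rewrite /CU mulr_ge0 ?expR_ge0.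
have e'0 : 0 < e / (1 + CU) by rewrite divr_gt0//; lra.
have [C [J [V [jb dKV Ve]]]] := app _ e'0.
have h1 := le_trans (fixed_near_invU fK jb dKV i1) Ve.
have h2 := le_trans (fixed_near_invU fK jb dKV y01) Ve.
rewrite (invU_1 br) mulr1 in h1; set m := jK J 1 - _ in h1 h2.
have Uy : `|jK U y| <= CU.
  have := jb_lip (invU_bound br) i0 y01; rewrite (invU_0 br) !subr0 => h.
  apply: le_trans h _; rewrite ler_piMr// ger0_norm; lra.
rewrite (_ : _ - _ = (K y - m * jK U y) - (K 1 - m) * jK U y); last by ring.
apply: le_trans (ler_normB _ _) _; rewrite normrM.
have -> : e = e / (1 + CU) + e / (1 + CU) * CU.
  field; apply: lt0r_neq0; lra.
by apply: lerD => //; apply: ler_pM.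
Qed.

End Dominated.

(** * Approximation of an integral by a smooth primitive *)

Section Primitive.
Context {R : realType}.
Local Notation leb := (@lebesgue_measure R).

(** Compactness of the segment, in the form of near covering: the admissible
    steps [h] at a point remain admissible nearby. *)
Lemma unif_cont (phi : R -> R) (a b e : R) : continuous phi -> 0 < e ->
  exists2 h : R, 0 < h & forall x k : R, a <= x <= b -> 0 <= k <= h ->
    `|phi (x + k) - phi x| <= e.
Proof.
move=> cphi e0.
have /compact_near_coveringP/(_ _ (0 : R)^'+
  (fun h x => forall k : R, 0 <= k <= h -> `|phi (x + k) - phi x| <= e) _) cov :=
  @segment_compact R a b.
have : \forall h \near (0 : R)^'+, `[a, b] `<=`
    (fun x => forall k : R, 0 <= k <= h -> `|phi (x + k) - phi x| <= e).
  apply: cov => x _.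
  have e2 : 0 < e / 2 by rewrite divr_gt0.
  have /cvgrPdist_lt/(_ _ e2)/nbhs_ballP[d d0 hd] := cphi x.
  have d2 : 0 < d / 2 by rewrite divr_gt0.
  near=> x' h => k /= /andP[k0 kh].
  have hh : h < d / 2 by near: h; exact: nbhs_right_lt.
  have hx : ball x (d / 2) x' by near: x'; exact: nbhsx_ballx.
  rewrite /ball/= in hx.
  have h1 : `|phi x - phi x'| < e / 2 by apply: hd; rewrite /ball/=; lra.
  have h2 : `|phi x - phi (x' + k)| < e / 2.
    apply: hd; rewrite /ball/=; move: hx; rewrite !ltr_norml; lra.
  move: h1 h2; rewrite !ltr_norml ler_norml; lra.
move=> H; near (0 : R)^'+ => h; exists h; first by near: h; exact: nbhs_right_gt.
suff hs : `[a, b] `<=` (fun x => forall k : R, 0 <= k <= h -> `|phi (x + k) - phi x| <= e).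
  by move=> x k xab; apply: hs; rewrite /= in_itv.
by near: h.
Unshelve. all: by end_near. Qed.

Lemma is_derive_primitive (phi : R -> R) (a x : R) :
  (forall z : R, a <= z -> {for z, continuous phi}) -> a < x ->
  is_derive x 1 (fun z => \int[leb]_(t in `[a, z]) phi t)%R (phi x).
Proof.
move=> cphi ax; have xx1 : x < x + 1 by rewrite ltrDl.
have [] := @continuous_FTC1_closed R phi a x (x + 1) xx1 _ ax _.
- apply: continuous_compact_integrable; first exact: segment_compact.
  apply: continuous_in_subspaceT => z; rewrite inE/= in_itv/= => /andP[az _].
  exact: cphi.
- by apply: cphi; exact: ltW.
- move=> d dE; split; first exact: d.
  by rewrite -derive1E; exact: dE.
Qed.

Lemma is_derive_cont (f : R -> R) (x d : R) : is_derive x 1 f d -> {for x, continuous f}.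
Proof. by case=> h _; apply: differentiable_continuous; apply/derivable1_diffP. Qed.

Lemma is_derive_quot_shift (f : R -> R) (h x d d' : R) :
  is_derive x 1 f d -> is_derive (x + h) 1 f d' ->
  is_derive x 1 (fun x => (f (x + h) - f x) / h) ((d' - d) / h).
Proof.
move=> d1 d2.
have d3 : is_derive x 1 (fun x => x + h) 1.
  by apply: is_derive_eq; rewrite addr0.
have d4 := @is_derive1_comp R f (fun x => x + h) x _ _ d2 d3.
have d5 : is_derive x 1 (fun x => f (x + h)) (d' * 1) by exact: d4.
apply: is_derive_eq; rewrite /GRing.scale/=; ring.
Qed.

(** Averages of the primitive over windows of length [h] have a derivative that
    is itself an average of [phi], hence close to [phi] by uniform continuity;
    this derivative has a bounded derivative, as a difference quotient.  The
    primitives start to the left of 0 so that 0 is an interior point. *)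
Lemma smoothing (phi : R -> R) (e : R) : continuous phi -> 0 < e ->
  exists (C : R) (A a a1 : R -> R),
   [/\ forall x : R, 0 <= x <= 1 -> is_derive x 1 A (a x) /\ is_derive x 1 a (a1 x),
       forall x : R, 0 <= x <= 1 -> `|a x| <= C /\ `|a1 x| <= C &
       forall x y : R, 0 <= x -> x <= y -> y <= 1 ->
        `|\int[leb]_(t in `]x, y]) phi t - (A y - A x)| <= e * (y - x)]%R.
Proof.
move=> cphi e0.
have [h h0 hu] := unif_cont (-1) 2 cphi e0.
pose Phi z := (\int[leb]_(t in `[-1, z]) phi t)%R.
have dPhi (x : R) : -1 < x -> is_derive x 1 Phi (phi x).
  by move=> x1; apply: is_derive_primitive => // z _; exact: cphi.
pose P z := (\int[leb]_(t in `[- 2^-1, z]) Phi t)%R.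
have dP (x : R) : - 2^-1 < x -> is_derive x 1 P (Phi x).
  move=> x1; apply: is_derive_primitive => // z z1.
  by apply: (is_derive_cont (dPhi _ _)); lra.
pose A x := (P (x + h) - P x) / h; pose a x := (Phi (x + h) - Phi x) / h.
pose a1 x := (phi (x + h) - phi x) / h.
have dA (x : R) : - 2^-1 < x -> is_derive x 1 A (a x).
  by move=> x1; apply: is_derive_quot_shift; apply: dP; lra.
have da (x : R) : - 2^-1 < x -> is_derive x 1 a (a1 x).
  by move=> x1; apply: is_derive_quot_shift; apply: dPhi; lra.
have close (x : R) : - 2^-1 < x < 2 -> `|phi x - a x| <= e.
  move=> /andP[x1 x2].
  have xh : x <= x + h by rewrite lerDl ltW.
  have [z||z zx] := @MVT_segment _ Phi phi x (x + h) xh.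
  - rewrite in_itv/= => /andP[xz zy]; apply: dPhi; lra.
  - apply: derivable_within_continuous => z; rewrite in_itv/= => /andP[xz zy].
    by case: (dPhi z _) => //; lra.
  rewrite /a => ->; rewrite addrAC subrr add0r mulfK ?lt0r_neq0// distrC.
  move: zx; rewrite in_itv/= => /andP[xz zh].
  have -> : z = x + (z - x) by ring.
  by apply: hu; lra.
have cb (x : R) : 0 <= x <= 1 -> {for x, continuous (fun x => `|phi x|)}.
  by move=> _; apply: (continuous_comp (cphi x)); exact: norm_continuous.
have [c _ phic] : exists2 c, c \in `[0, 1]%R & forall t, t \in `[0, 1]%R -> `|phi t| <= `|phi c|.
  apply: (@EVT_max R (fun x => `|phi x|) 0 1) => //.
  apply: continuous_in_subspaceT => z; rewrite inE/= in_itv/=; exact: cb.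
have phi0 := normr_ge0 (phi c).
exists (`|phi c| + e + e / h), A, a, a1; split.
- by move=> x /andP[x0 _]; split; [apply: dA|apply: da]; lra.
- have eh : 0 < e / h by rewrite divr_gt0.
  move=> x /[dup] x01 /andP[x0 x1]; split.
    have hx : - 2^-1 < x < 2 by lra.
    have := close x hx; have := phic x; rewrite in_itv/= => /(_ x01).
    by rewrite !ler_norml; lra.
  rewrite /a1 normrM normfV (gtr0_norm h0).
  have : `|phi (x + h) - phi x| / h <= e / h.
    by rewrite ler_wpM2r ?invr_ge0 ?(ltW h0)//; apply: hu; lra.
  lra.
- move=> x y x0 xy y1.
  have -> : (\int[leb]_(t in `]x, y]) phi t = Phi y - Phi x)%R.
    rewrite /Phi Rintegral_itvB//.
    + apply: continuous_compact_integrable; first exact: segment_compact.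
      exact: continuous_subspaceT.
    + by rewrite bnd_simp; lra.
  rewrite (_ : _ - _ = (Phi y - A y) - (Phi x - A x)); last by ring.
  rewrite -[in leRHS](ger0_norm (_ : 0 <= y - x)); last by lra.
  apply: (@MVT_bound _ (fun z => Phi z - A z) (fun z => phi z - a z) (- 2^-1) 2); try lra.
  + move=> z z12; have := dA z; have := dPhi z => d1 d2.
    by apply: is_deriveB; [apply: d1|apply: d2]; lra.
  + exact: close.
Qed.

(** Continuous functions are dense in L^1, and [smoothing] applies to
    these. *)
Lemma integral_near_smooth (f : R -> R) (e : R) : leb.-integrable `[0, 1] (EFin \o f) -> 0 < e ->
  exists (C : R) (A a a1 V : R -> R),
   [/\ forall x : R, 0 <= x <= 1 -> is_derive x 1 A (a x) /\ is_derive x 1 a (a1 x),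
       forall x : R, 0 <= x <= 1 -> `|a x| <= C /\ `|a1 x| <= C,
       increments_le (fun y => \int[leb]_(t in `[0, y]) f t - A y)%R V &
       V 1 - V 0 <= e].
Proof.
move=> fi e0; have e2 : 0 < e / 2 by rewrite divr_gt0.
have [||g [cg gi gl]] := @approximation_continuous_integrable R `[0, 1] f _ _ fi.
- exact: measurable_itv.
- exact/compact_finite_measure/segment_compact.
have [n hn] : exists n, (\int[leb]_(z in `[0%R, 1%R]) `|(f z - g n z)%:E| <= (e / 2)%:E)%E.
  have /fine_cvgP[gf] := gl; move/cvgrPdist_le => /(_ _ e2) gd.
  near \oo => n; exists n.
  have h1 : (\int[leb]_(z in `[0%R, 1%R]) `|(f z - g n z)%:E| \is a fin_num)%E by near: n.
  have : `|0 - fine (\int[leb]_(z in `[0%R, 1%R]) `|(f z - g n z)%:E|)%E| <= e / 2.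
    by near: n.
  rewrite sub0r normrN -(fineK h1) lee_fin; apply: le_trans; exact: ler_norm.
have [C [A [a [a1 [dA bA hA]]]]] := smoothing (cg n) e2.
pose d t : R := `|f t - g n t|.
have fgi : leb.-integrable `[0, 1] (EFin \o (fun t => f t - g n t)).
  by have h := integrableB _ fi (gi n); apply: h; exact: measurable_itv.
have di : leb.-integrable `[0, 1] (EFin \o d).
  exact: (integrable_norm fgi).
exists C, A, a, a1, (fun y => \int[leb]_(t in `[0, y]) d t + e / 2 * y)%R; split => //.
- move=> x y x0 xy y1.
  have sub1 : (`[0, y]%classic : set R) `<=` `[0, 1]%classic.
    by move=> z; rewrite /= !in_itv/= => /andP[-> /le_trans ->].
  have sub2 : (`]x, y]%classic : set R) `<=` `[0, 1]%classic.
    by move=> z; rewrite /= !in_itv/= => /andP[xz zy]; lra.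
  have i1 h : leb.-integrable `[0, 1] (EFin \o h) -> leb.-integrable `[0, y] (EFin \o h).
    by apply: integrableS => //; exact: measurable_itv.
  have i2 h : leb.-integrable `[0, 1] (EFin \o h) -> leb.-integrable `]x, y] (EFin \o h).
    by apply: integrableS => //; exact: measurable_itv.
  rewrite (_ : _ - _ - _ = (\int[leb]_(t in `[0, y]) f t - \int[leb]_(t in `[0, x]) f t)
     - (A y - A x))%R; last by ring.
  rewrite [leRHS](_ : _ = (\int[leb]_(t in `[0, y]) d t - \int[leb]_(t in `[0, x]) d t)
     + e / 2 * (y - x))%R; last by ring.
  rewrite !Rintegral_itvB ?bnd_simp//; [|exact: i1..].
  have := hA x y x0 xy y1; have := le_normr_Rintegral _ (i2 _ fgi).
  rewrite RintegralB//; [|exact: i2..].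
  move=> /(_ (measurable_itv _)).
  move: (\int[leb]_(t in `]x, y]) f t)%R (\int[leb]_(t in `]x, y]) g n t)%R => p q.
  rewrite !ler_norml => h1 h2; rewrite /d in h1 *.
  move: h1; move: (\int[_]_(t in _) _)%R => D; lra.
- rewrite set_itv1 Rintegral_set1 mulr0 addr0 subr0 mulr1.
  have : (\int[leb]_(t in `[0, 1]) d t <= e / 2)%R.
    rewrite /Rintegral -lee_fin fineK//.
    exact: integrable_fin_num.
  lra.
Unshelve. all: by end_near. Qed.

End Primitive.

(** * Distribution function of the invariant measure *)

Section MapConjugacy.
Context {R : realType}.
Implicit Types (t z w x y : R) (n : nat).

(** [tau] is the left branch of the map in the coordinate x = exp(- w) / 2. *)
Lemma T_map_expR t w : 0 <= w -> T_map t (expR (- w) / 2) = expR (- tau t w) / 2.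
Proof.
move=> w0; have e0 := expR_gt0 (- w).
have e1 : expR (- w) <= 1 by rewrite -expR0 ler_expR oppr_le0.
rewrite /T_map ifT; last by rewrite -[leRHS]mul1r ler_wpM2r ?invr_ge0.
have -> : 2 `^ t * (expR (- w) / 2) `^ t = expR (- (t * w)).
  rewrite -powRM//.
  by rewrite mulrC divfK// -expRM mulNr [w * t]mulrC.
rewrite /tau opprB addrC lg.unlock -[in RHS](opprK w) expRD lnK; last first.
  by rewrite posrE addr_gt0// expR_gt0.
rewrite opprK; ring.
Qed.

(** The left branch contributes the interval up to the next iterate of [Gb], and
    the right branch 2 x - 1 the interval on the right. *)
Lemma T_map_preimage t n z : 0 < t -> - ln 2 <= z -> Gb t n z <= 1 -> Gb t n.+1 z <= 2^-1 ->
  `[0, 1]%classic `&` T_map t @^-1` `[0, Gb t n z]%classic =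
  `[0, Gb t n.+1 z]%classic `|` `]2^-1, ((1 + Gb t n z) / 2)]%classic.
Proof.
move=> t0 hz y1 g2; have y0 := Gb_gt0 t n z; have g0 := Gb_gt0 t n.+1 z.
have low x : 0 < x <= 2^-1 -> 0 <= T_map t x /\ (T_map t x <= Gb t n z) = (x <= Gb t n.+1 z).
  move=> /andP[x0 x2]; have [w w0 ->] : exists2 w, 0 <= w & x = expR (- w) / 2.
    exists (- ln (2 * x)); last by rewrite opprK lnK ?posrE; [field|lra].
    by rewrite oppr_ge0; apply: ln_le0; lra.
  rewrite T_map_expR//; split; first by rewrite divr_ge0// expR_ge0.
  rewrite /Gb !ler_pM2r ?invr_gt0// !ler_expR !lerN2 GamS.
  by rewrite -[X in X <= tau _ _](gamK (Gam t n z) (ltW t0)) tau_le_iff// ltW.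
apply/seteqP; split => x /=; rewrite !in_itv/=.
- move=> [/andP[x0 x1] /andP[Tx0 Tx]]; have [x2|x2] := leP x 2^-1; last first.
    right; move: Tx; rewrite /T_map ifF; last by apply/negbTE; rewrite -ltNge.
    by move=> ?; rewrite ler_pdivlMr//=; lra.
  left; rewrite x0/=; have /orP[/eqP <-|x0'] : (0 == x) || (0 < x) by rewrite -le_eqVlt.
    exact: ltW.
  by rewrite -(low x _).2 ?x0'.
- move=> [/andP[x0 xg]|/andP[x2 xy]].
  + have x1 : x <= 1 by lra.
    rewrite x0 x1; split => //; have /orP[/eqP <-|x0'] : (0 == x) || (0 < x) by rewrite -le_eqVlt.
      by rewrite /T_map ifT ?invr_ge0// mul0r lexx ltW.
    have x2 : 0 < x <= 2^-1 by rewrite x0'/=; lra.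
    by have [-> ->] := low x x2.
  + move: xy; rewrite ler_pdivlMr// => xy.
    rewrite /T_map ifF; last by apply/negbTE; rewrite -ltNge.
    by split; lra.
Qed.
End MapConjugacy.

Section Cdf.
Context {R : realType}.
Local Notation leb := (@lebesgue_measure R).
Variable mu : probability (measurableTypeR R) R.
Implicit Types (t x y z : R) (n : nat).

(** The distribution function on [0, 1]; points to the left of 0 are not counted,
    and have no mass in the cases of interest. *)
Definition cdf0 (y : R) : R := fine (mu `[0, y]%classic).

Lemma mu_fin (A : set (measurableTypeR R)) : measurable A -> mu A \is a fin_num.
Proof. move=> mA; exact: fin_num_measure. Qed.

Lemma cdf0_diff x y : 0 <= x -> x <= y -> cdf0 y = cdf0 x + fine (mu `]x, y]%classic).
Proof.
move=> x0 xy; rewrite /cdf0 -fineD; [|exact: mu_fin (measurable_itv _)..].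
rewrite -measureU; [|exact: measurable_itv..|].
  congr (fine (mu _)); apply/seteqP; split => z /=; rewrite !in_itv/=.
    by have [zx|xz] := leP z x => /andP[z0 zy]; [left|right]; rewrite ?z0.
  by move=> [/andP[z0 zx]|/andP[xz zy]]; lra.
by apply/seteqP; split => z //=; rewrite !in_itv/=; lra.
Qed.

Lemma cdf0_density : mu `<< leb -> exists f : R -> R,
  leb.-integrable `[0, 1] (EFin \o f) /\
  forall y, cdf0 y = (\int[leb]_(t in `[0, y]) f t)%R.
Proof.
move=> ac; pose f x := fine (Radon_Nikodym_SigmaFinite.f mu leb x).
have fE : Radon_Nikodym_SigmaFinite.f mu leb = EFin \o f.
  by apply/funext => x; rewrite /f/= fineK//; exact: Radon_Nikodym_SigmaFinite.f_fin_num ac x.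
exists f; split.
  have := Radon_Nikodym_SigmaFinite.f_integrable ac.
  by rewrite fE; apply: integrableS => //; exact: measurable_itv.
move=> y; rewrite /cdf0 (Radon_Nikodym_SigmaFinite.f_integral ac)//.
by rewrite fE.
Qed.

End Cdf.

Section InvariantCdf.
Context {R : realType}.
Local Notation leb := (@lebesgue_measure R).
Variables (a0 a1 : R).
Hypotheses (a00 : 0 < a0) (a01 : a0 <= a1) (a11 : a1 < 1).
Variables (t : R) (mu : probability (measurableTypeR R) R).
Hypotheses (tT : Th a0 a1 t) (acip : is_acip t mu).
Implicit Types (x y z : R) (n : nat).

Local Notation F := (cdf0 mu).
Let br := bb_branches a00 a01 a11 tT.

Let t_gt0 : 0 < t.
Proof. by case/andP: tT => h _; exact: lt_le_trans a00 h. Qed.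

(** The distribution function of the restriction of the measure to ]1/2, 1], in
    the coordinate y. *)
Definition induced y := F ((1 + y) / 2) - F 2^-1.

(** Invariance of the measure, applied to the interval [0, Gb t n z]. *)
Lemma cdf0_step n z : - ln 2 <= z ->
  F (Gb t n z) - F (Gb t n.+1 z) = induced (Gb t n z).
Proof.
move=> hz; have /andP[g0 g1] := Gb_01 a00 a11 n tT hz.
have g2 := Gb_half a00 a11 n tT hz; have y0 := Gb_gt0 t n.+1 z.
case: acip => _ _ inv.
have sub : (`[0, Gb t n z]%classic : set R) `<=` `[0, 1]%classic.
  by move=> x; rewrite /= !in_itv/= => /andP[-> /le_trans ->].
have := inv `[0, Gb t n z]%classic (measurable_itv _) sub.
rewrite T_map_preimage//.
rewrite measureU; [|exact: measurable_itv..|]; last first.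
  by apply/seteqP; split => x //=; rewrite !in_itv/=; lra.
have h20 : 0 <= (2^-1 : R) by rewrite invr_ge0.
have h21 : 2^-1 <= (1 + Gb t n z) / 2 by rewrite -[leLHS]mul1r ler_wpM2r// lerDl.
move=> h; rewrite /induced (cdf0_diff mu h20 h21).
rewrite /cdf0 -h fineD; [|exact: mu_fin (measurable_itv _)..].
ring.
Qed.

Lemma cdf0_0 : F 0 = 0.
Proof.
case: acip => _ /cdf0_density[f [_ ->]] _.
by rewrite set_itv1 Rintegral_set1.
Qed.

Lemma cdf0_1 : F 1 = 1.
Proof. by case: acip; rewrite /cdf0 => ->. Qed.

Lemma cdf0_Gb_cvg z : - ln 2 <= z -> F (Gb t n z) @[n --> \oo] --> 0.
Proof.
move=> hz; case: acip => _ /cdf0_density[f [fi FE]] _.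
have g0 : Gb t n z @[n --> \oo] --> 0.
  apply: (@squeeze_cvgr _ _ _ _ (fun=> 0) (MM a0 a1)); last 2 first.
  - exact: cvg_cst.
  - by apply: cvg_series_cvg_0; case: (MM_summable a00 a01 a11).
  by apply: nearW => n; rewrite ltW ?Gb_gt0//=; exact: Gb_M.
apply/cvgrPdist_lt => e e0.
have h := @parameterized_integral_near_left R 0 1 e f ltr01 e0 fi.
have : \forall n \near \oo, 0 <= Gb t n z -> `|parameterized_integral leb 0 (Gb t n z) f| < e.
  exact: (g0 _ h).
apply: filterS => n /(_ (ltW (Gb_gt0 _ _ _))).
by rewrite sub0r normrN FE.
Qed.

(** [cdf0_step] telescopes, as the measure has no atom at 0. *)
Lemma induced_sum z : - ln 2 <= z ->
  series (fun n => induced (Gb t n z)) @ \oo --> F (Gb t 0 z).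
Proof.
move=> hz; have := tsum_telescope (cdf0_Gb_cvg hz); rewrite subr0.
by under eq_fun do rewrite cdf0_step//.
Qed.

(** The restriction of the measure to ]1/2, 1] is invariant under the return map:
    [induced_sum] at the points (1 + y) / 2 and 1/2. *)
Lemma induced_fix y : 0 <= y <= 1 -> induced y = QK (bb t) induced y.
Proof.
move=> /[dup] y01 /andP[y0 y1]; have i0 : 0 <= (0 : R) <= 1 by rewrite lexx ler01.
have h1 := induced_sum (proj1 (andP (zt_bounds y01))).
have h0 := induced_sum (proj1 (andP (zt_bounds i0))).
rewrite -[Gb t 0 (zt y)]/(bb t 0 y) bb_0// in h1.
rewrite -[Gb t 0 (zt 0)]/(bb t 0 0) bb_0// addr0 mul1r in h0.
rewrite /QK tsumB.
- by rewrite {1}/induced -(cvg_lim _ h1)// -(cvg_lim _ h0).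
- by apply/cvg_ex; eexists; exact: h1.
- by apply/cvg_ex; eexists; exact: h0.
Qed.

(** The density of the measure is integrable; [integral_near_smooth]. *)
Lemma induced_approx (e : R) : 0 < e -> exists C (J : @jet R) V,
  [/\ jet_bound C J, increments_le (fun y => induced y - jK J y) V & V 1 - V 0 <= e].
Proof.
move=> e0; case: acip => _ /cdf0_density[f [fi FE]] _.
have [C [A [a [a1' [V [dA bA hA VE]]]]]] := integral_near_smooth fi e0.
pose c (y : R) := (1 + y) / 2.
have c01 (y : R) : 0 <= y <= 1 -> 0 <= c y <= 1 by rewrite /c; lra.
have dc (y : R) : is_derive y 1 c 2^-1.
  by apply: is_derive_eq; rewrite /GRing.scale/=; ring.
have dA' (y : R) : 0 <= y <= 1 -> is_derive y 1 (fun y => A (c y)) (a (c y) / 2).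
  move=> y01; have [d _] := dA _ (c01 y y01).
  have := @is_derive1_comp R A c y _ _ d (dc y); exact.
have da' (y : R) : 0 <= y <= 1 -> is_derive y 1 (fun y => a (c y) / 2) (a1' (c y) / 4).
  move=> y01; have [_ d] := dA _ (c01 y y01).
  have := @is_derive1_comp R a c y _ _ d (dc y) => d'.
  by apply: is_derive_eq; rewrite /GRing.scale/=; field.
exists C, (Jet (fun y => A (c y)) (fun y => a (c y) / 2) (fun y => a1' (c y) / 4)),
  (fun y => V (c y)); split.
- split => /=.
  + apply: lip_closed dA' _ => y y01; have := (bA (c y) (c01 y ltac:(lra))).1.
    rewrite normrM [`|2^-1|]ger0_norm ?invr_ge0//; have := normr_ge0 (a (c y)); lra.
  + by move=> y y01; apply: dA'; lra.
  + by move=> y y01; apply: da'; lra.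
  + move=> y y01; have := (bA (c y) (c01 y ltac:(lra))).1.
    rewrite normrM [`|2^-1|]ger0_norm ?invr_ge0//; have := normr_ge0 (a (c y)); lra.
  + move=> y y01; have := (bA (c y) (c01 y ltac:(lra))).2.
    rewrite normrM [`|4^-1|]ger0_norm ?invr_ge0//; have := normr_ge0 (a1' (c y)); lra.
- move=> x y x0 xy y1 /=; rewrite /induced -/(c x) -/(c y).
  have := hA (c x) (c y); rewrite -!FE => /(_ ltac:(rewrite /c; lra)).
  move=> /(_ ltac:(rewrite /c; lra)) /(_ ltac:(rewrite /c; lra)).
  by rewrite (_ : _ - _ - _ = F (c y) - F 2^-1 - A (c y) - (F (c x) - F 2^-1 - A (c x)))//; ring.
- have m01 : increments_le (fun y => F y - A y) V.
    by move=> x y x0 xy y1; rewrite !FE; exact: hA.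
  have : V 0 <= V (c 0) by apply: (increments_mono m01); rewrite /c; lra.
  rewrite (_ : c 1 = 1); last by rewrite /c; field.
  lra.
Qed.

Lemma cdf0_E z : - ln 2 <= z ->
  F (Gb t 0 z) = induced 1 * Hsum bb bb1 bb2 (fun t n => Gb t n z) t.
Proof.
move=> hz; rewrite -(cvg_lim _ (induced_sum hz))// /Hsum -tsumZ; last first.
  apply: (cvg_dom (C := CU) (brM br)) => n.
  have i0 : 0 <= (0 : R) <= 1 by rewrite lexx ler01.
  have g01 := Gb_01 a00 a11 n tT hz.
  have := jb_lip (invU_bound br) i0 g01; rewrite (invU_0 br) !subr0 => h.
  apply: le_trans h _; rewrite ler_wpM2l//; first by rewrite /CU mulr_ge0 ?expR_ge0.
  rewrite ger0_norm; last by case/andP: g01.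
  exact: Gb_M.
congr (limn (series _)); apply/funext => n.
apply: (fixed_unique br induced_fix induced_approx); exact: (Gb_01 a00 a11).
Qed.

(** The distribution function of the invariant measure at [x], before
    normalization. *)
Definition Hcdf (x s : R) := Hsum bb bb1 bb2 (fun t n => Gb t n (- ln (2 * x))) s.

Lemma Gb0_ln (x : R) : 0 < x -> Gb t 0 (- ln (2 * x)) = x.
Proof. by move=> x0; rewrite /Gb Gam_0 opprK lnK ?posrE; [field|lra]. Qed.

Lemma cdf0_Hcdf (x : R) : 0 < x <= 1 -> F x = induced 1 * Hcdf x t.
Proof.
move=> /andP[x0 x1].
have hz : - ln 2 <= - ln (2 * x) by rewrite lerN2 ler_ln ?posrE//; lra.
by rewrite -{1}(Gb0_ln x0) (cdf0_E hz).
Qed.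

(** The constant factor between [cdf0] and [Hcdf] is determined by the total
    mass. *)
Lemma cdf0_quot (x : R) : 0 < x <= 1 -> F x * Hcdf 1 t = Hcdf x t.
Proof.
move=> x01; have i1 : 0 < (1 : R) <= 1 by rewrite ltr01 lexx.
have := cdf0_Hcdf i1; rewrite cdf0_1 (cdf0_Hcdf x01).
move: (induced 1) (Hcdf x t) (Hcdf 1 t) => k p q h.
by rewrite mulrAC -h mul1r.
Qed.

Lemma cdf0_ge0 (x : R) : 0 <= F x.
Proof. by rewrite /cdf0 fine_ge0. Qed.

Lemma cdf0_le1 (x : R) : 0 <= x <= 1 -> F x <= 1.
Proof.
move=> /andP[x0 x1]; rewrite -cdf0_1 (cdf0_diff mu x0 x1) lerDl fine_ge0//.
Qed.

(** The factor [induced 1] between [Hcdf] and [cdf0] is the mass of ]1/2, 1],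
    at most 1. *)
Lemma Hcdf1_ge1 : 1 <= Hcdf 1 t.
Proof.
have i1 : 0 < (1 : R) <= 1 by rewrite ltr01 lexx.
have := cdf0_Hcdf i1; rewrite cdf0_1.
rewrite {1}/induced (_ : (1 + 1) / 2 = 1); last by field.
rewrite cdf0_1; have f0 := cdf0_ge0 2^-1.
have f1 : F 2^-1 <= 1 by apply: cdf0_le1; lra.
move: (F 2^-1) (Hcdf 1 t) f0 f1 => p q p0 p1 pq.
rewrite leNgt; apply/negP => q1.
have [q0|q0] := leP q 0; first by have := mulr_ge0_le0 (_ : 0 <= 1 - p) q0; rewrite -pq; lra.
have : (1 - p) * q <= 1 * q by rewrite ler_wpM2r ?(ltW q0)//; lra.
lra.
Qed.

Lemma cdf0_cont : {within `[0, 1], continuous F}.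
Proof.
case: acip => _ /cdf0_density[f [fi FE]] _.
rewrite (_ : F = fun x => parameterized_integral leb 0 x f); last by apply/funext => x; rewrite FE.
exact: parameterized_integral_continuous.
Qed.

End InvariantCdf.

(** * Strict differentiability, and calculus for functions on the unit interval *)

Section StrictC1.
Context {R : realType}.

(** If strict differentiability failed at some [e], pairs of counterexamples
    tending to [al] could be chosen. *)
Lemma strict_derivative_seq (f : R -> R) (al L : R) (N : set R) : nbhs al N ->
  (forall be ga : nat -> R, (forall m, N (be m)) -> (forall m, N (ga m)) ->
     be m @[m --> \oo] --> al -> ga m @[m --> \oo] --> al -> (forall m, be m != ga m) ->
     (f (be m) - f (ga m)) / (be m - ga m) @[m --> \oo] --> L) ->
  forall e : R, 0 < e -> exists2 d : R, 0 < d & forall s t : R,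
    `|s - al| < d -> `|t - al| < d -> s != t -> `|(f s - f t) / (s - t) - L| <= e.
Proof.
move=> /nbhs_ballP[r r0 rN] H e e0; apply: contrapT => nd.
have bad n : exists st : R * R, [/\ `|st.1 - al| < Num.min r n.+1%:R^-1,
    `|st.2 - al| < Num.min r n.+1%:R^-1, st.1 != st.2 &
    e < `|(f st.1 - f st.2) / (st.1 - st.2) - L|].
  apply: contrapT => nst; apply: nd; exists (Num.min r n.+1%:R^-1).
    by rewrite lt_min r0/= invr_gt0.
  move=> s t hs ht st; rewrite leNgt; apply/negP => h.
  by apply: nst; exists (s, t); split.
have [u hu] := choice bad.
have toal (v : nat -> R) : (forall n, `|v n - al| < Num.min r n.+1%:R^-1) ->
    (forall n, N (v n)) /\ v n @[n --> \oo] --> al.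
  move=> hv; split.
    by move=> n; apply: rN; rewrite /ball/= distrC; apply: lt_le_trans (hv n) _; rewrite ge_min lexx.
  apply: (squeeze0 (v := fun n => n.+1%:R^-1)); last exact: cvg_harmonic.
  by move=> n; apply/ltW/(lt_le_trans (hv n)); rewrite ge_min lexx orbT.
have [N1 c1] := toal (fun n => (u n).1) (fun n => let: And4 h _ _ _ := hu n in h).
have [N2 c2] := toal (fun n => (u n).2) (fun n => let: And4 _ h _ _ := hu n in h).
have := H _ _ N1 N2 c1 c2 (fun n => let: And4 _ _ h _ := hu n in h).
move/cvgrPdist_lt => /(_ _ e0)[n _ /(_ n (leqnn n))] /=.
by case: (hu n) => _ _ _ /ltW h; rewrite distrC ltNge h.
Qed.

(** A strict derivative at [al] bounds all difference quotients near [al], hence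
    also the derivatives at the nearby points, which are limits of these. *)
Lemma strict_derivative_C1 (f : R -> R) (A : set R) :
  (forall al, A al -> exists L, forall e : R, 0 < e -> exists2 d : R, 0 < d &
    forall s t : R, `|s - al| < d -> `|t - al| < d -> s != t ->
    `|(f s - f t) / (s - t) - L| <= e) -> open A -> C1_open A f.
Proof.
move=> H oA.
have dL al L : (forall e : R, 0 < e -> exists2 d : R, 0 < d &
    forall s t : R, `|s - al| < d -> `|t - al| < d -> s != t ->
    `|(f s - f t) / (s - t) - L| <= e) -> is_derive al 1 f L.
  move=> hL; apply/is_derive_quotP; apply/cvgrPdist_le => e e0.
  have [d d0 hd] := hL e e0.
  near=> h; rewrite distrC.
  have h0 : h != 0 by near: h; exact: nbhs_dnbhs_neq.
  have hlt : `|h| < d by near: h; exact: dnbhs0_lt.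
  have := hd (h + al) al; rewrite subrr normr0 addrK mulrC; apply => //.
  by rewrite -subr_eq0 addrK.
have dA al : A al -> exists L, (forall e : R, 0 < e -> exists2 d : R, 0 < d &
    forall s t : R, `|s - al| < d -> `|t - al| < d -> s != t ->
    `|(f s - f t) / (s - t) - L| <= e) /\ is_derive al 1 f L.
  by move=> /H[L hL]; exists L; split => //; exact: dL.
split.
  by move=> al; rewrite inE => /dA[L [_ []]].
move=> al; rewrite inE => Aal.
have [L [hL Ld]] := dA al Aal.
apply/cvgrPdist_le => e e0.
have [d d0 hd] := hL e e0.
have nA : \forall t \near al, A t by exact: open_nbhs_nbhs.
rewrite derive1E; have [_ ->] := Ld.
near=> t.
have At : A t by near: t.
have [L' [_ L'd]] := dA t At.
rewrite derive1E; have [_ ->] := L'd.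
have hc := (iffLR (is_derive_quotP f t L') L'd).
have td : `|t - al| < d by near: t; apply: cvgr_distC_lt.
rewrite distrC; apply: (ler_cvg_to (cvg_norm (cvgB hc (cvg_cst L))) (cvg_cst _)).
near=> h; rewrite /=.
have h0 : h != 0 by near: h; exact: nbhs_dnbhs_neq.
have hlt : `|h| < d - `|t - al|.
  by near: h; apply: dnbhs0_lt; rewrite subr_gt0.
have := hd (h + t) t; rewrite addrK mulrC; apply => //.
  apply: le_lt_trans (_ : `|h| + `|t - al| < d); last lra.
  by rewrite -addrA; exact: ler_normD.
by rewrite -subr_eq0 addrK.
Unshelve. all: by end_near. Qed.

End StrictC1.

Section UnitIntervalC1.
Context {R : realType}.
Local Notation leb := (@lebesgue_measure R).
Variables (phi dphi : R -> R).
Hypothesis cd : {within `[0, 1], continuous dphi}.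
Hypothesis hphi : forall x : R, x \in `[0, 1] ->
      (fun y => (phi y - phi x) / (y - x)) @ within `[0, 1] x^' --> dphi x.

Let quot (x e : R) : 0 <= x <= 1 -> 0 < e -> exists2 d : R, 0 < d & forall y : R,
  0 <= y <= 1 -> y != x -> `|y - x| < d -> `|(phi y - phi x) / (y - x) - dphi x| < e.
Proof.
move=> x01 e0; have x01' : x \in `[0, 1] by rewrite in_itv.
have /cvgrPdist_lt/(_ _ e0) := hphi x01'.
rewrite near_withinE near_withinE => /nbhs_ballP[d d0 hd]; exists d => // y y01 yx yd.
rewrite distrC; apply: hd => //; first by rewrite /ball/= distrC.
Qed.

Let phi_lip (x e : R) : 0 <= x <= 1 -> 0 < e -> exists2 d : R, 0 < d & forall y : R,
  0 <= y <= 1 -> `|y - x| < d -> `|phi y - phi x| < e.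
Proof.
move=> x01 e0; have [d d0 hd] := quot x01 ltr01.
have c0 : 0 < `|dphi x| + 1 by rewrite ltr_pwDr.
exists (Num.min d (e / (`|dphi x| + 1))).
  by rewrite lt_min d0 divr_gt0.
move=> y y01; rewrite lt_min => /andP[yd ye].
have [->|yx] := eqVneq y x; first by rewrite subrr normr0.
have h := hd y y01 yx yd.
have y0 : y - x != 0 by rewrite subr_eq0.
rewrite -[phi y - phi x](divfK y0) normrM.
apply: (@le_lt_trans _ _ ((`|dphi x| + 1) * `|y - x|)); last by rewrite mulrC -ltr_pdivlMr.
rewrite ler_wpM2r//.
have := ler_normD ((phi y - phi x) / (y - x) - dphi x) (dphi x); rewrite subrK; lra.
Qed.

Lemma unit_C1_derive (x : R) : 0 < x < 1 -> is_derive x 1 phi (dphi x).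
Proof.
move=> x01; apply/is_derive_quotP; apply/cvgrPdist_lt => e e0.
have x01' : 0 <= x <= 1 by lra.
have [d d0 hd] := quot x01' e0.
near=> h; rewrite distrC.
have h0 : h != 0 by near: h; exact: nbhs_dnbhs_neq.
have hlt : `|h| < Num.min d (Num.min x (1 - x)).
  by near: h; apply: dnbhs0_lt; rewrite !lt_min d0; lra.
move: hlt; rewrite !lt_min => /and3P[h1 h2 h3].
have := hd (h + x); rewrite addrK mulrC; apply => //.
  move: h2 h3; rewrite !ltr_norml; lra.
by rewrite -subr_eq0 addrK.
Unshelve. all: by end_near. Qed.

(** The one-sided difference quotients at 0 and 1 give continuity of [phi] up to the
    end points, and the fundamental theorem applies. *)
Lemma unit_C1_FTC (x : R) : 0 <= x -> x <= 1 ->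
  (\int[leb]_(s in `[x, 1]) dphi s = phi 1 - phi x)%R.
Proof.
move=> x0; rewrite le_eqVlt => /orP[/eqP ->|x1].
  by rewrite set_itv1 Rintegral_set1 subrr.
have x01 : 0 <= x <= 1 by rewrite x0 ltW.
have i1 : 0 <= (1 : R) <= 1 by rewrite ler01 lexx.
rewrite /Rintegral (@continuous_FTC2 _ dphi phi x 1 x1)//.
- apply: continuous_subspaceW cd => z /=; rewrite !in_itv/=; lra.
- split.
  + move=> z; rewrite in_itv/= => /andP[xz z1].
    have z01 : 0 < z < 1 by lra.
    by case: (unit_C1_derive z01).
  + apply/cvgrPdist_lt => e e0; have [d d0 hd] := phi_lip x01 e0.
    near=> y; rewrite distrC; apply: hd.
      have : x < y by near: y; exact: nbhs_right_gt.
      have : y < 1 by near: y; exact: nbhs_right_lt.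
      lra.
    have : x < y by near: y; exact: nbhs_right_gt.
    have : y < x + d by near: y; apply: nbhs_right_lt; lra.
    rewrite ltr_norml; lra.
  + apply/cvgrPdist_lt => e e0; have [d d0 hd] := phi_lip i1 e0.
    near=> y; rewrite distrC; apply: hd.
      have : y < 1 by near: y; exact: nbhs_left_lt.
      have : x < y by near: y; exact: nbhs_left_gt.
      lra.
    have : 1 - d < y by near: y; apply: nbhs_left_gt; lra.
    have : y < 1 by near: y; exact: nbhs_left_lt.
    rewrite ltr_norml; lra.
- move=> z; rewrite in_itv/= => /andP[xz z1].
  have z01 : 0 < z < 1 by lra.
  by rewrite derive1E; case: (unit_C1_derive z01).
Unshelve. all: by end_near. Qed.

End UnitIntervalC1.

(** * Integration against a measure through its distribution function *)

Section IntegralByCdf.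
Context {R : realType}.
Local Notation leb := (@lebesgue_measure R).
Variable mu : probability (measurableTypeR R) R.
Variables phi g : R -> R.
Hypothesis mu01 : mu `[0, 1]%classic = 1%E.
Hypothesis cg : {within `[0, 1], continuous g}.
Hypothesis ftc : forall x : R, 0 <= x -> x <= 1 ->
  (\int[leb]_(s in `[x, 1]) g s = phi 1 - phi x)%R.

Let gi : leb.-integrable `[0, 1] (EFin \o g).
Proof. by apply: continuous_compact_integrable => //; exact: segment_compact. Qed.

Let f (p : measurableTypeR R * measurableTypeR R) : \bar R :=
  if (0 <= p.1) && (p.1 <= p.2) then ((g \_ `[0, 1]) p.2)%:E else 0%E.

Let gi' : leb.-integrable setT (EFin \o (g \_ `[0, 1])).
Proof. by rewrite -restrict_EFin; apply/integrable_restrict => //=; rewrite setTI. Qed.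

Let mg : measurable_fun setT (g \_ `[0, 1]).
Proof. by apply/measurable_EFinP; exact: measurable_int gi'. Qed.

Let mf : measurable_fun setT f.
Proof.
apply: measurable_fun_ifT => //=.
- apply: measurable_and.
    by apply: measurable_fun_ler => //; exact: measurable_cst.
  by apply: measurable_fun_ler.
- by apply/measurable_EFinP; apply: measurableT_comp.
Qed.

Let fi : (mu \x leb)%E.-integrable setT f.
Proof.
apply/integrable12ltyP => //.
have [mG iG] := integrableP _ _ _ gi'.
apply: (@le_lt_trans _ _ (\int[mu]_x \int[leb]_y `|(EFin \o (g \_ `[0%R, 1%R])) y|)%E).
  apply: ge0_le_integral => //.
  - by move=> x _; apply: integral_ge0.
  - apply: (measurable_fun_fubini_tonelli_F (abse \o f)).
      by apply: measurableT_comp => //; exact: mf.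
    by move=> x; exact: abse_ge0.
  - move=> x _; apply: ge0_le_integral => //.
    + apply: measurableT_comp => //; exact: measurableT_comp mf (measurable_pair1 x).
    + exact: measurableT_comp.
    + by move=> y _; rewrite /f /=; case: ifP => // _; rewrite abse0 lee_fin.
by rewrite integral_cst// [X in (_ * X)%E]probability_setT mule1.
Qed.

Let F_in x : 0 <= x <= 1 -> (\int[leb]_y f (x, y) = (phi 1 - phi x)%:E)%E.
Proof.
move=> /andP[x0 x1]; rewrite -(ftc x0 x1) /Rintegral fineK; last first.
  apply: integrable_fin_num => //; apply: (integrableS _ _ _ gi) => // y /=.
  by rewrite !in_itv/=; lra.
rewrite [in RHS]integral_mkcond; apply: eq_integral => y _.
rewrite /f/= x0/= !patchE; case: ifPn => xy; last first.
  rewrite ifF//; apply/negbTE; apply: contra xy; rewrite inE/= in_itv/=.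
  by case/andP.
rewrite !mem_setE/= !in_itv/= xy/= (le_trans x0 xy)/=; by case: ifP.
Qed.

Let F_out x : ~ (0 <= x <= 1) -> (\int[leb]_y f (x, y) = 0)%E.
Proof.
move=> x01; apply: integral0_eq => y _; rewrite /f/=; case: ifP => // /andP[x0 xy].
rewrite patchE ifF//; apply/negbTE/negP; rewrite mem_setE/= in_itv/= => /andP[y0 y1].
by apply: x01; rewrite x0 (le_trans xy).
Qed.

Let G_in y : 0 <= y <= 1 -> (\int[mu]_x f (x, y) = (g y * cdf0 mu y)%:E)%E.
Proof.
move=> y01; transitivity (\int[mu]_(x in `[0%R, y]) (g y)%:E)%E.
  rewrite [RHS]integral_mkcond; apply: eq_integral => x _.
  rewrite /f/= (_ : (g \_ `[0, 1]) y = g y); last by rewrite patchE ifT// inE/= in_itv.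
  rewrite patchE; have [xy|xy] := boolP (0 <= x <= y).
    by rewrite ifT// inE/= in_itv.
  by rewrite ifF//; apply/negbTE; apply: contra xy; rewrite inE/= in_itv.
rewrite integral_cst// /cdf0 EFinM fineK//; exact: mu_fin (measurable_itv _).
Qed.

Let G_out y : ~ (0 <= y <= 1) -> (\int[mu]_x f (x, y) = 0)%E.
Proof.
move=> y01; apply: integral0_eq => x _; rewrite /f/=; case: ifP => // _.
by rewrite patchE ifF//; apply/negbTE/negP; rewrite mem_setE/= in_itv/=.
Qed.

(** Write phi x = phi 1 - \int_x^1 g and exchange the integrals over the triangle
    0 <= x <= s <= 1; the inner integral over x is the distribution function
    at s. *)
Lemma integral_cdf0 :
  (\int[mu]_(x in `[0, 1]%classic) phi x =
   phi 1 - \int[leb]_(s in `[0, 1]%classic) (g s * cdf0 mu s))%R.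
Proof.
have h := Fubini fi.
have iF := integrable_fubini_F fi.
have iF01 : mu.-integrable `[0, 1]%classic (EFin \o (fun x => phi 1 - phi x)).
  have := integrableS measurableT (measurable_itv `[0%R, 1%R] : measurable (`[0, 1]%classic : set (measurableTypeR R))) (@subsetT _ _) iF.
  apply: eq_integrable; first exact: measurable_itv.
  by move=> x; rewrite inE/= in_itv/= => x01; rewrite /fubini_F F_in.
have eF : (\int[mu]_x \int[leb]_y f (x, y) =
    \int[mu]_(x in `[0%R, 1%R]) (phi 1 - phi x)%:E)%E.
  rewrite [RHS]integral_mkcond; apply: eq_integral => x _; rewrite patchE.
  case: ifPn; rewrite mem_setE/= in_itv/= => x01; first exact: F_in.
  by apply: F_out; exact/negP.
have eG : (\int[leb]_y \int[mu]_x f (x, y) =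
    \int[leb]_(y in `[0%R, 1%R]) (g y * cdf0 mu y)%:E)%E.
  rewrite [RHS]integral_mkcond; apply: eq_integral => y _; rewrite patchE.
  case: ifPn; rewrite mem_setE/= in_itv/= => y01; first exact: G_in.
  by apply: G_out; exact/negP.
rewrite eF eG in h.
have ic (c : R) : mu.-integrable `[0, 1]%classic (EFin \o (fun=> c)).
  apply: finite_measure_integrable_cst; exact: measurable_itv.
transitivity (\int[mu]_(x in `[0, 1]%classic) (phi 1 - (phi 1 - phi x)))%R.
  by apply: eq_Rintegral => x _; ring.
rewrite RintegralB//.
congr (_ - _); last by rewrite /Rintegral h.
rewrite Rintegral_cst// -[RHS]mulr1; congr (_ * _).
by rewrite -[RHS]/(fine 1%E) -mu01.
Qed.

End IntegralByCdf.

(** * Response of the distribution function and of the integral *)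

Lemma ratio_quot (K : fieldType) (r r' p p' d : K) : p != 0 -> d != 0 ->
  (r - r') / d = ((r * p - r' * p') / d - r' * ((p - p') / d)) / p.
Proof. by move=> p0 d0; field; rewrite p0 d0. Qed.

Section CdfResponse.
Context {R : realType}.
Local Notation leb := (@lebesgue_measure R).
Variables (a0 a1 : R).
Hypotheses (a00 : 0 < a0) (a01 : a0 <= a1) (a11 : a1 < 1).
Variable nu : R -> probability (measurableTypeR R) R.
Local Notation Th := (Th a0 a1).
Local Notation MM := (MM a0 a1).
Hypothesis acip : forall t, Th t -> is_acip t (nu t).
Implicit Types (s t x y z : R) (n m : nat).

Let br t (tT : Th t) := bb_branches a00 a01 a11 tT.
Let lipb s t n y := @bb_lip R a0 a1 a00 a01 a11 s t n y.
Let lipb1 s t n y := @bb1_lip R a0 a1 a00 a01 a11 s t n y.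
Let lipb2 s t n y := @bb2_lip R a0 a1 a00 a01 a11 s t n y.

Definition LH : R := CH MM (9 * expR 2) * tsum MM.

Let hx x : 0 < x <= 1 -> - ln 2 <= - ln (2 * x).
Proof. by move=> /andP[x0 x1]; rewrite lerN2 ler_ln ?posrE//; lra. Qed.

Let i1 : 0 < (1 : R) <= 1. Proof. by rewrite ltr01 lexx. Qed.

Lemma Hcdf_lip s t x : Th s -> Th t -> 0 < x <= 1 ->
  `|Hcdf x s - Hcdf x t| <= LH * `|s - t|.
Proof.
move=> sT tT /hx hz; rewrite /LH mulrAC.
apply: (Hsum_lip br lipb lipb1 lipb2 sT) => //.
- by move=> r n rT; exact: (Gb_01 a00 a11).
- by move=> r n rT; exact: Gb_M.
- by move=> r r' n rT r'T; exact: (Gb_lip a00 a01 a11).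
Qed.

(** F_s - F_t = (Hcdf x s - Hcdf x t - F_t (Hcdf 1 s - Hcdf 1 t)) / Hcdf 1 s, with a
    denominator at least 1 and F_t at most 1. *)
Lemma cdf0_lip s t x : Th s -> Th t -> 0 < x <= 1 ->
  `|cdf0 (nu s) x - cdf0 (nu t) x| <= 2 * LH * `|s - t|.
Proof.
move=> sT tT x01.
have f1 : cdf0 (nu t) x <= 1.
  by case/andP: x01 => x0 x1; apply: (cdf0_le1 (acip tT)); rewrite ltW.
have f0 := cdf0_ge0 (nu t) x.
have es := cdf0_quot a00 a01 a11 sT (acip sT) x01.
have et := cdf0_quot a00 a01 a11 tT (acip tT) x01.
have h1 := Hcdf1_ge1 a00 a01 a11 sT (acip sT).
have lx := Hcdf_lip sT tT x01; have l1 := Hcdf_lip sT tT i1.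
move: (cdf0 (nu s) x) (cdf0 (nu t) x) (Hcdf 1 s) (Hcdf 1 t) (Hcdf x s) (Hcdf x t) LH
  f0 f1 es et h1 lx l1 => fs ft Hs Ht Xs Xt L f0 f1 es et h1 lx l1.
apply: (@le_trans _ _ (`|fs - ft| * Hs)); first by rewrite ler_peMr.
rewrite -[X in _ * X <= _]ger0_norm; last by apply: le_trans h1.
rewrite -normrM (_ : (fs - ft) * Hs = (Xs - Xt) - ft * (Hs - Ht)); last by rewrite -es -et; ring.
apply: le_trans (ler_normB _ _) _; rewrite normrM (ger0_norm f0).
have := ler_wpM2r (normr_ge0 (Hs - Ht)) f1; rewrite mul1r; lra.
Qed.

Section Sequences.
Variables (al : R) (be ga : nat -> R).
Hypotheses (alT : Th al) (beT : forall m, Th (be m)) (gaT : forall m, Th (ga m)).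
Hypotheses (cbe : be m @[m --> \oo] --> al) (cga : ga m @[m --> \oo] --> al).
Hypothesis bega : forall m, be m != ga m.

Definition dHcdf (al x : R) := let z := - ln (2 * x) in
  dH bb bb1 bb2 al (fun n y => - Gb al n (zt y) * VG al n (zt y))
   (fun t n => Gb t n z) (fun n => - Gb al n z * VG al n z).

Lemma Hcdf_response x : 0 < x <= 1 ->
  (Hcdf x (be m) - Hcdf x (ga m)) / (be m - ga m) @[m --> \oo] --> dHcdf al x.
Proof.
move=> /hx hz.
apply: (Hsum_response br lipb lipb1 lipb2 alT beT gaT cbe cga bega).
- move=> n y y01; apply: (Gb_quot a00 a01 a11) => //.
  by have /andP[] := zt_bounds y01.
- move=> n y y01; apply: (Gb_int a00 a11).
  by have /andP[] := zt_bounds y01.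
- by move=> r n rT; exact: (Gb_01 a00 a11).
- by move=> r n rT; exact: Gb_M.
- by move=> r r' n rT r'T; exact: (Gb_lip a00 a01 a11).
- by move=> n; exact: (Gb_int a00 a11).
- by move=> n; exact: (Gb_quot a00 a01 a11).
Qed.

(** The value at 0, where [Hcdf] has no meaning, is that of the derivative of the
    constant F 0 = 0. *)
Definition dcdf (al x : R) : R :=
  if x == 0 then 0 else (dHcdf al x - cdf0 (nu al) x * dHcdf al 1) / Hcdf 1 al.

(** The quotient rule, along a pair of sequences. *)
Lemma cdf0_response x : 0 <= x <= 1 ->
  (cdf0 (nu (be m)) x - cdf0 (nu (ga m)) x) / (be m - ga m) @[m --> \oo] --> dcdf al x.
Proof.
move=> /andP[x0 x1]; rewrite /dcdf; have [->|xn0] := eqVneq x 0.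
  under eq_fun do rewrite (cdf0_0 (acip (beT _))) (cdf0_0 (acip (gaT _))) subrr mul0r.
  exact: cvg_cst.
have x01 : 0 < x <= 1 by rewrite lt_neqAle eq_sym xn0 x0.
have cF : cdf0 (nu (ga m)) x @[m --> \oo] --> cdf0 (nu al) x.
  apply: (squeeze0 (v := fun m => 2 * LH * `|ga m - al|)); last exact: cvg_dist0.
  by move=> m; exact: cdf0_lip.
have cH : Hcdf 1 (be m) @[m --> \oo] --> Hcdf 1 al.
  apply: (squeeze0 (v := fun m => LH * `|be m - al|)); last exact: cvg_dist0.
  by move=> m; exact: Hcdf_lip.
have H0 r : Th r -> Hcdf 1 r != 0.
  by move=> rT; rewrite lt0r_neq0//; apply: lt_le_trans (Hcdf1_ge1 a00 a01 a11 rT (acip rT)).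
have e m : (cdf0 (nu (be m)) x - cdf0 (nu (ga m)) x) / (be m - ga m) =
    ((Hcdf x (be m) - Hcdf x (ga m)) / (be m - ga m) -
     cdf0 (nu (ga m)) x * ((Hcdf 1 (be m) - Hcdf 1 (ga m)) / (be m - ga m))) / Hcdf 1 (be m).
  have es := cdf0_quot a00 a01 a11 (beT m) (acip (beT m)) x01.
  have et := cdf0_quot a00 a01 a11 (gaT m) (acip (gaT m)) x01.
  have b0 : be m - ga m != 0 by rewrite subr_eq0 bega.
  by rewrite -es -et; apply: ratio_quot => //; exact: H0.
under eq_fun do rewrite e.
apply: cvgM; last by apply: cvgV => //; exact: H0.
by apply: cvgB; [|apply: cvgM => //]; apply: Hcdf_response.
Qed.

Variable dphi : R -> R.
Hypothesis cd : {within `[0, 1], continuous dphi}.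

Let I t : R := (\int[leb]_(s in `[0, 1]%classic) (dphi s * cdf0 (nu t) s))%R.

Let ci t : Th t -> leb.-integrable `[0, 1] (EFin \o (fun s => dphi s * cdf0 (nu t) s)).
Proof.
move=> tT; apply: continuous_compact_integrable; first exact: segment_compact.
by move=> x; apply: cvgM; [exact: cd|exact: (cdf0_cont (acip tT))].
Qed.

Let q m s : R := (dphi s * cdf0 (nu (be m)) s - dphi s * cdf0 (nu (ga m)) s) / (be m - ga m).

Let q_cvg s : 0 <= s <= 1 -> q m s @[m --> \oo] --> dphi s * dcdf al s.
Proof.
move=> s01; have e m : q m s = dphi s * ((cdf0 (nu (be m)) s - cdf0 (nu (ga m)) s) / (be m - ga m)).
  by rewrite /q; ring.
by under eq_fun do rewrite e; apply: cvgMr; exact: cdf0_response.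
Qed.

Let q_le m s : 0 <= s <= 1 -> `|q m s| <= `|dphi s| * (2 * LH).
Proof.
move=> /andP[s0 s1]; have nz : 0 < `|be m - ga m| by rewrite normr_gt0 subr_eq0 bega.
rewrite /q -mulrBr -mulrA normrM ler_wpM2l// normrM normfV ler_pdivrMr//.
have [->|sn0] := eqVneq s 0; last by apply: cdf0_lip => //; rewrite lt_neqAle eq_sym sn0 s0.
rewrite (cdf0_0 (acip (beT _))) (cdf0_0 (acip (gaT _))) subrr normr0.
apply: le_trans (cdf0_lip (beT m) (gaT m) i1); exact: normr_ge0.
Qed.

(** Dominated convergence: by [cdf0_lip] the difference quotients of the
    distribution function are bounded uniformly on [0, 1]. *)
Lemma integral_response :
  (I (be m) - I (ga m)) / (be m - ga m) @[m --> \oo] -->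
  (\int[leb]_(s in `[0, 1]%classic) (dphi s * dcdf al s))%R.
Proof.
have mq m : measurable_fun (`[0, 1]%classic : set (measurableTypeR R)) (q m).
  apply: measurable_funM; last exact: measurable_cst.
  by apply: measurable_funB; apply/measurable_EFinP; exact: measurable_int (ci _).
have cq s : `[0, 1]%classic s -> (q m s)%:E @[m --> \oo] --> (dphi s * dcdf al s)%:E.
  rewrite /= in_itv/= => s01; apply: cvg_EFin; first by apply: nearW.
  exact: q_cvg.
have mqE m : measurable_fun (`[0, 1]%classic : set (measurableTypeR R)) (fun s => (q m s)%:E).
  exact: (iffRL (measurable_EFinP _ _) (mq m)).
have mD : measurable_fun (`[0, 1]%classic : set (measurableTypeR R))
    (fun s => (dphi s * dcdf al s)%:E).
  by apply: (emeasurable_fun_cvg (fun m s => (q m s)%:E)) => //.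
have ig : leb.-integrable `[0, 1] (EFin \o (fun s => `|dphi s| * (2 * LH))).
  apply: continuous_compact_integrable; first exact: segment_compact.
  move=> x; apply: cvgM; last exact: cvg_cst.
  by apply: cvg_norm; exact: cd.
have dom : {ae leb, forall s m, `[0, 1]%classic s -> (`|(q m s)%:E| <= (`|dphi s| * (2 * LH))%:E)%E}.
  by apply: aeW => s m; rewrite /= in_itv/= => s01; rewrite lee_fin; exact: q_le.
have acq : {ae leb, forall s, `[0, 1]%classic s -> (q m s)%:E @[m --> \oo] --> (dphi s * dcdf al s)%:E}.
  exact: aeW.
have [di _ H] := @dominated_convergence _ _ R leb _ (measurable_itv `[0%R, 1%R])
  (fun m s => (q m s)%:E) (fun s => (dphi s * dcdf al s)%:E)
  (EFin \o (fun s => `|dphi s| * (2 * LH))) mqE mD acq ig dom.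
have H' : (\int[leb]_(s in `[0%R, 1%R]) (q m s)%:E)%E @[m --> \oo] -->
    (\int[leb]_(s in `[0%R, 1%R]) (dphi s * dcdf al s))%:E.
  by rewrite /Rintegral fineK//; exact: integrable_fin_num.
have e m : (I (be m) - I (ga m)) / (be m - ga m) =
    (\int[leb]_(s in `[0%R, 1%R]) q m s)%R.
  rewrite /I -RintegralB//; [|exact: ci..].
  rewrite -RintegralZr//.
  by have h := integrableB _ (ci (beT m)) (ci (gaT m)); apply: h; exact: measurable_itv.
under eq_fun do rewrite e; exact: (fine_cvg H').
Qed.

End Sequences.
End CdfResponse.

Lemma interval_window (R : realType) (al : R) : 0 < al < 1 ->
  exists a0 a1 : R, [/\ 0 < a0, a0 <= a1, a1 < 1, nbhs al (Th a0 a1) & Th a0 a1 al].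
Proof.
move=> /andP[al0 al1]; exists (al / 2), ((1 + al) / 2); split; try lra.
- have : nbhs al `](al / 2), ((1 + al) / 2)[%classic.
    by apply: open_nbhs_nbhs; split; [exact: itv_open|rewrite /= in_itv/=; lra].
  by apply: filterS => x /=; rewrite in_itv/= => /andP[x0 x1]; rewrite /Th/= !ltW.
- by rewrite /Th/=; lra.
Qed.

Unset Implicit Arguments.
Set Strict Implicit.
Set Printing Implicit Defensive.

(** * Continuous differentiability *)

Theorem theorem1p1 (R : realType)
    (nu : R -> probability (measurableTypeR R) R)
    (nu_acip : forall alpha : R, 0 < alpha < 1 -> is_acip alpha (nu alpha))
    (phi : R -> R) (phiC1 : C1_unit_interval phi) :
  C1_open `]0, 1[%classic
    (fun alpha : R => (\int[nu alpha]_(x in `[0, 1]%classic) phi x)%R).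
Proof.
have [dphi [cd hphi]] := phiC1.
have IE t : 0 < t < 1 -> (\int[nu t]_(x in `[0, 1]%classic) phi x = phi 1 -
    \int[@lebesgue_measure R]_(s in `[0, 1]%classic) (dphi s * cdf0 (nu t) s))%R.
  move=> /nu_acip[mu01 _ _].
  by apply: integral_cdf0 => // x x0 x1; exact: (unit_C1_FTC cd hphi).
apply: strict_derivative_C1; last exact: itv_open.
move=> al /=; rewrite in_itv/= => al01.
have [a0 [a1 [a00 a01 a11 nT alT]]] := interval_window al01.
have T01 t : Th a0 a1 t -> 0 < t < 1.
  by move=> /andP[h1 h2]; rewrite (lt_le_trans a00 h1) (le_lt_trans h2 a11).
have acip t : Th a0 a1 t -> is_acip t (nu t) by move=> /T01; exact: nu_acip.
exists (- \int[@lebesgue_measure R]_(s in `[0, 1]%classic) (dphi s * dcdf nu al s)).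
apply: (strict_derivative_seq nT) => be ga beT gaT cbe cga bega.
pose I t := (\int[@lebesgue_measure R]_(s in `[0, 1]%classic) (dphi s * cdf0 (nu t) s))%R.
have e m : ((\int[nu (be m)]_(x in `[0, 1]%classic) phi x)%R -
    (\int[nu (ga m)]_(x in `[0, 1]%classic) phi x)%R) / (be m - ga m) =
    - ((I (be m) - I (ga m)) / (be m - ga m)).
  rewrite !IE; [|exact: T01..].
  by rewrite -/(I (be m)) -/(I (ga m)); ring.
under eq_fun do rewrite e.
by apply: cvgN; exact: (integral_response a00 a01 a11 acip).
Qed.
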